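(* Let $H\in(1/2,1]$. The $\mathcal{C}([0,1])$-valued martingale $(B_n)_{n\ge 1}$ converges almost surely (uniformly on $[0,1]$) and in $L^q$ norm for all $q\ge 1$ (i.e. $\mathbb{E}(\|B_n-B\|_\infty^q)\to 0$) to a limit function $B$ of expectation $\mathrm{Id}_{[0,1]}$ (i.e. $\mathbb{E}(B(t))=t$ for all $t\in[0,1]$). Denote this limit by $B$ and, for all $w\in T$, denote the limit of $(B_n(w))_{n\ge1}$ by $B(w)$. With probability 1: (1) For all $p\ge 1$, $w=w_1\cdots w_p\in\{0,1\}^p$ and $t\in I_w$, $$B(t)-B(t_w)=\boldsymbol{\epsilon}(w)\,2^{-pH}\,B(w)\left(S_{w_p}^{-1}\circ\cdots\circ S_{w_1}^{-1}(t)\right);$$ (2) $B$ is $\alpha$-Hölder continuous for all $\alpha\in(0,H)$, and it has everywhere a pointwise Hölder exponent equal to $H$, i.e. for all $t\in[0,1]$ $$\liminf_{s\to t,\ s\ne t}\frac{\log|B(s)-B(t)|}{\log|s-t|}=H;$$ (3) The Hausdorff and box dimensions of the graph of $B$ are equal to $2-H$.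
   Context: $T=\bigcup_{n\ge 0}\{0,1\}^n$ is the set of finite binary words ($\{0,1\}^0=\{\emptyset\}$), and $w\cdot v$ denotes concatenation of words. For $w=w_1\cdots w_n$ put $t_w=\sum_{k=1}^n w_k2^{-k}$ and $I_w=[t_w,t_w+2^{-n}]$. Let $S_0(t)=t/2$ and $S_1(t)=(t+1)/2$. $\mathcal{C}([0,1])$ is the space of real-valued continuous functions on $[0,1]$ with the uniform norm $\|\cdot\|_\infty$, and $\mathrm{Id}_{[0,1]}$ is the identity function on $[0,1]$. Fix $H\le 1$. Let $\epsilon$ be a random variable with values in $\{-1,1\}$, equal to $1$ with probability $(1+2^{H-1})/2$ and to $-1$ with probability $(1-2^{H-1})/2$. Let $(\epsilon(w))_{w\in T}$ be independent copies of $\epsilon$. For $w=w_1\cdots w_n$ let $\boldsymbol{\epsilon}(w)=\prod_{k=1}^n\epsilon(w_1\cdots w_k)\in\{-1,1\}$. For $n\ge 1$ and $t\in[0,1]$ define $$B_n(t)=2^{-nH}\int_0^t 2^n\,\epsilon(u_1)\epsilon(u_1u_2)\cdots\epsilon(u_1\cdots u_n)\,du,$$ where $(u_k)_{k\ge1}$ is the sequence of binary digits of $u$ (the ambiguity at dyadic points is irrelevant). More generally, for $w\in T$, $$B_n(w)(t)=2^{-nH}\int_0^t 2^n\,\epsilon(w\cdot u_1)\cdots\epsilon(w\cdot u_1\cdots u_n)\,du,$$ so that $B_n(\emptyset)=B_n$ and $(B_n(w))_{n\ge1}$ has the same law as $(B_n)_{n\ge1}$. The sequence $(B_n)_{n\ge1}$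 is a martingale with respect to $\mathcal{F}_n=\sigma\{\epsilon(w):w\in\bigcup_{k=1}^n\{0,1\}^k\}$. In the definition of the pointwise exponent, $s$ ranges over $[0,1]$ and $\log 0=-\infty$ (so the ratio is $+\infty$ when $B(s)=B(t)$ and $|s-t|<1$). *)

(* Defs.v *)
From HB Require Import structures.
From mathcomp Require Import all_boot all_order all_algebra.
From mathcomp Require Import all_classical all_reals all_analysis.
From mathcomp Require Import ring.
Set Implicit Arguments.
Unset Strict Implicit.
Unset Printing Implicit Defensive.
Import Order.TTheory GRing.Theory Num.Theory.
Import numFieldNormedType.Exports.
Local Open Scope classical_set_scope.
Local Open Scope ring_scope.

Definition mutually_independent (d : measure_display) (Omega : measurableType d)
    (R : realType) (P : probability Omega R) (I : choiceType)
    (X : I -> {RV P >-> R}) : Prop :=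
  forall (s : seq I) (A : I -> set R),
    uniq s -> (forall i, measurable (A i)) ->
    P (\bigcap_(i in [set` s]) (X i @^-1` A i)) =
    (\prod_(i <- s) P (X i @^-1` A i))%E.

(* The letters w_1, ..., w_n of a word have indices 0, ..., n.-1. *)
Notation word := (seq bool).

Section Words.
Variable R : realType.
Implicit Types (t u : R) (w : word) (b : bool).

Definition wpoint w : R := \sum_(k < size w) (nth false w k)%:R * 2 ^- k.+1.

Definition winterval w : set R :=
  `[wpoint w, wpoint w + 2 ^- size w]%classic.

Definition dyad b t : R := (t + b%:R) / 2.

Definition dyadV b t : R := 2 * t - b%:R.

Lemma dyadK b : cancel (dyad b) (dyadV b).
Proof. by move=> t; rewrite /dyad /dyadV; field. Qed.

Lemma dyadVK b : cancel (dyadV b) (dyad b).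
Proof. by move=> t; rewrite /dyad /dyadV; field. Qed.

(* [foldl] applies the first letter first. *)
Definition wordV w t : R := foldl (fun x b => dyadV b x) t w.

(* Digits of u >= 0; for 0 <= u < 1 they give the binary expansion of u that
   is not eventually equal to 1. *)
Definition bdigit u (k : nat) : bool := odd (Num.truncn (2 ^+ k * u)).

Definition bprefix u (n : nat) : word := [seq bdigit u k | k <- iota 1 n].

End Words.

Arguments winterval : clear implicits.

Section Process.
Variables (R : realType) (Omega : Type) (H : R) (eps : word -> Omega -> R).

Definition epsprod (w : word) (omega : Omega) : R :=
  \prod_(1 <= k < (size w).+1) eps (take k w) omega.

Definition Bn (n : nat) (w : word) (omega : Omega) (t : R) : R :=
  2 `^ (- (n%:R * H)) *
  \int[lebesgue_measure]_(u in `[0, t])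
    (2 ^+ n * \prod_(1 <= k < n.+1) eps (w ++ bprefix u k) omega).

End Process.

Section Functions.
Variable R : realType.
Implicit Types f : R -> R.

Definition supnorm01 f : \bar R :=
  ereal_sup [set `|f t|%:E | t in `[0, 1]%classic].

Definition holder01 (alpha : R) f : Prop :=
  exists C : R, forall s t : R, s \in `[0, 1] -> t \in `[0, 1] ->
    `|f s - f t| <= C * `|s - t| `^ alpha.

(* [lne 0 = -oo], hence the ratio is +oo when f s = f t and 0 < |s - t| < 1. *)
Definition pointwise_exponent01 f (t : R) : \bar R :=
  limf_einf (fun s => lne `|f s - f t|%:E / lne `|s - t|%:E)%E
            (within `[0, 1]%classic t^').

Definition graph01 f : set (R * R) := [set (t, f t) | t in `[0, 1]%classic].

End Functions.

Section Dimensions.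
Local Open Scope ereal_scope.
Variable R : realType.
Implicit Types (F U : set (R * R)) (delta s : R).

(* The library norm on R * R is the max norm, hence an explicit distance. *)
Definition euclid_dist (x y : R * R) : R :=
  Num.sqrt ((x.1 - y.1) ^+ 2 + (x.2 - y.2) ^+ 2)%R.

Definition diam U : \bar R :=
  if U == set0 then 0
  else ereal_sup [set (euclid_dist x.1 x.2)%:E | x in U `*` U].

(* The empty set has weight 0 also when s = 0, while [0 `^ 0 = 1]. *)
Definition gauge s U : \bar R := if U == set0 then 0 else diam U `^ s.

Definition hausdorff_premeasure s delta F : \bar R :=
  ereal_inf [set \sum_(0 <= i <oo) gauge s (U i) |
             U in [set U : (set (R * R))^nat |
                   F `<=` \bigcup_i U i /\ forall i, diam (U i) <= delta%:E]].

Definition hausdorff_measure s F : \bar R :=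
  ereal_sup [set hausdorff_premeasure s delta F |
             delta in [set delta : R | (0 < delta)%R]].

Definition hausdorff_dim F : \bar R :=
  ereal_inf [set s%:E | s in [set s : R |
                              (0 <= s)%R /\ hausdorff_measure s F = 0]].

Definition covering_number F delta : \bar R :=
  ereal_inf [set n%:R%:E | n in [set n : nat |
    exists U : 'I_n -> set (R * R),
      F `<=` \bigcup_i U i /\ forall i, diam (U i) <= delta%:E]].

Definition box_ratio F delta : \bar R :=
  lne (covering_number F delta) / lne (delta^-1)%:E.

Definition lower_box_dim F : \bar R := limf_einf (box_ratio F) 0^'+.

Definition upper_box_dim F : \bar R := limf_esup (box_ratio F) 0^'+.

End Dimensions.

(* Main.v *)
Require Import Defs.
From HB Require Import structures.
From mathcomp Require Import all_boot all_order all_algebra.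
From mathcomp Require Import all_classical all_reals all_analysis.
From mathcomp Require Import measurable_realfun ring lra zify.
Set Implicit Arguments.
Unset Strict Implicit.
Unset Printing Implicit Defensive.
Import Order.TTheory GRing.Theory Num.Theory.
Import numFieldNormedType.Exports.
Local Open Scope classical_set_scope.
Local Open Scope ring_scope.

(** A word [w] carries a function [B(w)] satisfying the recursion
    [B(w)(t) = h * (e(w0) * B(w0)(2 t) + e(w1) * B(w1)(2 t - 1))] with [h = 2^-H],
    where the functions are constant outside [0, 1]. Its approximations are the
    functions [casc], and [B_n(w)] is one of them ([Bn_casc]). Everything is
    governed by the masses [Z_n(w) = B_n(w)(1)]: they satisfy
    [Z_{n+1}(w) = h * (e(w0) * Z_n(w0) + e(w1) * Z_n(w1))], have mean [1] because the
    signs have mean [a = 1 / (2 h)], and bounded second moments because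
    [2 h^2 < 1], that is [H > 1/2].

    Convergence. The increments [Z_{m+1}(v) - Z_m(v)] are sub-Gaussian with standard
    deviation of order [kap^m], for [kap = sqrt 2 * h < 1]
    ([avg_expR_dmass]). High moments bound them simultaneously at all the nodes
    of the tree by [K * b^(size v) * (b * kap)^m], for any [b > 1], with a random
    constant [K] having moments of all orders ([moment_term], [regular_of_series]).
    An increment of the whole function at [t] involves a new error only along the
    branch of [t], and masses elsewhere; hence the same bound holds uniformly in
    [t] ([casc_step]). This gives the uniform limit, its convergence in every [L^q]
    ([limit_process_moment]) and its mean ([limit_process_expectation]).
    Self-similarity ([self_similar]) is the recursion unfolded along a word.

    Regularity. Unfolding the recursion [n] times, two points at distance [2^-n]
    have images at distance at most a constant times [(h b)^n] ([modulus]); as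
    [b] tends to [1] this is the Holder continuity of every order below [H]. Conversely a mass
    is at least [1/2] with positive probability (Paley-Zygmund, [avg_small]), and the
    masses of the descendants of a node are independent. So almost surely every
    dyadic interval of generation [2^m] has a descendant of generation [2^m + 2 m]
    over which the increment is of the size predicted by [H] ([ae_oscillation]),
    which bounds the pointwise exponent from above ([path_rough]).

    Dimension. Covering the graph of a Holder function by squares bounds all the
    dimensions by [2 - H] ([graph_cover]). For the lower bound, the Lebesgue
    measure is lifted to the graph, and one shows that small sets have a small measure.
    This rests on anti-concentration of increments: the characteristic function
    [phi_n] of [Z_n] satisfies
    [phi_{n+1}(x) = (Re phi_n(h x) + i * a * Im phi_n(h x))^2], so that for [a < 1] it
    decays exponentially ([charf2_decay]), and a discrete Fejer kernel bounds the
    probability that an increment over a distance [2^-k] lies in an interval of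
    length [r] by a constant times [r / h^k] ([concentration]). The expected number of
    cells close to a given cell in the plane follows ([expected_bad]), and
    cells with too many neighbours are almost surely so rare that those of small scale cover at most
    half of the time axis; on the other times the mass distribution principle applies
    ([mass_from_cells]). For [H = 1] the process is deterministic and the counting
    is trivial.

    All the probability is done for functions of finitely many signs, with the
    explicit average [avg]; [integral_conf] transfers it to the probability space. *)

(** * The cascade and its limit *)

Lemma eq_ler {R : realType} (x y : R) : x = y -> x <= y.
Proof. by move=> ->. Qed.

Section Cascade.
Context {R : realType}.
Variables (h : R) (e : word -> R).
Implicit Types (w v : word) (t s : R).

(** The depth-[n] approximation of the self-similar function, as a recursion on
    the first letter: level [0] is the identity clamped to [0, 1], so that the
    functions are defined on the whole line and the half-intervals glue without
    case distinctions. For [h = 2^-H] this is the process [B_n(w)]. *)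
Fixpoint casc (n : nat) w t : R :=
  if n is n'.+1 then
    h * (e (rcons w false) * casc n' (rcons w false) (dyadV false t) +
         e (rcons w true) * casc n' (rcons w true) (dyadV true t))
  else Num.max 0 (Num.min t 1).

Lemma cascS n w t : casc n.+1 w t =
    h * (e (rcons w false) * casc n (rcons w false) (dyadV false t) +
         e (rcons w true) * casc n (rcons w true) (dyadV true t)).
Proof. by []. Qed.

(** The total increment over [0, 1]; the whole function is governed by these
    numbers, attached to the nodes of the binary tree. *)
Definition mass n w := casc n w 1.

Lemma casc_le0 n w t : t <= 0 -> casc n w t = 0.
Proof.
elim: n w t => [|n IH] w t t0 /=.
  by rewrite /Num.max /Num.min; case: ifP; case: ifP; lra.
rewrite !IH ?mulr0 ?addr0 ?mulr0 // /dyadV /=; lra.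
Qed.

Lemma casc_ge1 n w t : 1 <= t -> casc n w t = mass n w.
Proof.
rewrite /mass; elim: n w t => [|n IH] w t t1 /=.
  rewrite minxx; congr (Num.max _ _); rewrite /Num.min; case: ifP; lra.
rewrite !(IH _ (dyadV _ t)) ?(IH _ (dyadV _ 1)) // /dyadV /=; lra.
Qed.

Lemma mass0 w : mass 0 w = 1.
Proof. by rewrite /mass /= minxx; apply/max_idPr; rewrite ler01. Qed.

Lemma massS n w : mass n.+1 w =
  h * (e (rcons w false) * mass n (rcons w false) +
       e (rcons w true) * mass n (rcons w true)).
Proof.
rewrite {1}/mass /= !casc_ge1 // /dyadV /=; lra.
Qed.

Lemma casc_continuous n w : continuous (casc n w).
Proof.
elim: n w => [|n IH] w t /=.
  by apply: (@continuous_max _ _ (fun _ => 0) (fun x : R => Num.min x 1)) => //;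
     [exact: cvg_cst|apply: continuous_min => //; exact: cvg_cst].
apply: cvgM; first exact: cvg_cst.
have H b : {for t, continuous (dyadV b)}.
  by apply: cvgB; [apply: cvgM => //; exact: cvg_cst|exact: cvg_cst].
apply: cvgD; apply: cvgM; try exact: cvg_cst.
  by apply: (@continuous_comp _ _ _ (dyadV false)); [exact: H|exact: IH].
by apply: (@continuous_comp _ _ _ (dyadV true)); [exact: H|exact: IH].
Qed.

End Cascade.

Section Regular.
Context {R : realType}.
Variables (h kap : R) (e : word -> R).
Hypotheses (h0 : 0 < h) (h1 : h <= 1) (kap0 : 0 <= kap)
  (kapE : kap ^+ 2 = 2 * h ^+ 2) (e1 : forall w, `|e w| <= 1).
Implicit Types (w v : word) (t s : R).

(** Uniform geometric control of the increments of the masses along the tree.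
    For [kap = sqrt 2 * h < 1] it holds almost surely for every [b > 1], with a
    random [K]: the standard deviation of the [m]-th increment is of order
    [kap ^ m], and the factor [b ^ (size v + m)] pays for the [2 ^ size v] nodes. *)
Definition regular (K b : R) := forall m v,
  `|mass h e m.+1 v - mass h e m v| <= K * b ^+ size v * (b * kap) ^+ m.

Lemma cascS_sub n w t : casc h e n.+2 w t - casc h e n.+1 w t =
  h * (e (rcons w false) * (casc h e n.+1 (rcons w false) (dyadV false t) -
                            casc h e n (rcons w false) (dyadV false t)) +
       e (rcons w true) * (casc h e n.+1 (rcons w true) (dyadV true t) -
                            casc h e n (rcons w true) (dyadV true t))).
Proof. by rewrite [casc _ _ n.+2 w t]cascS [casc _ _ n.+1 w t]cascS; ring. Qed.

(** Uses [4 / 3 < sqrt 2]; it makes the constant [3] of the next lemma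
    reproduce itself under the recursion. *)
Lemma h_le_kap : 4 * h <= 3 * kap.
Proof.
rewrite -ler_sqr ?nnegrE ?mulr_ge0 // ?(ltW h0) //.
have -> : (3 * kap) ^+ 2 = 9 * kap ^+ 2 by ring.
have -> : (4 * h) ^+ 2 = 16 * h ^+ 2 by ring.
rewrite kapE; have := sqr_ge0 h; lra.
Qed.

Lemma casc0_ge0 w t : 0 <= casc h e 0 w t.
Proof. by rewrite /= le_max lexx. Qed.

Lemma casc0_le1 w t : casc h e 0 w t <= 1.
Proof. by rewrite /= ge_max ler01 ge_min lexx orbT. Qed.

Lemma norm_signM w x (y : R) : `|x| <= y -> `|e w * x| <= y.
Proof.
move=> xy; rewrite normrM (le_trans _ xy)// ler_piMl//.
Qed.

(** At a point [t] only the half containing [t] contributes a genuinely new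
    error: the other half contributes [0] or a difference of masses, which
    [regular] controls. Hence the errors at [t] obey the recursion of a single
    branch, and one gets the bound for masses up to the constant [3]. *)
Lemma casc_step K b : 1 <= K -> 1 <= b -> regular K b -> forall n w t,
  `|casc h e n.+1 w t - casc h e n w t| <= 3 * K * b ^+ size w * (b * kap) ^+ n.
Proof.
move=> K1 b1 reg; elim=> [|n IH] w t.
  have B : 1 <= b ^+ size w by rewrite exprn_ege1.
  apply: (@le_trans _ _ 3); last by rewrite expr0; nra.
  have c0 := casc0_ge0 w t; have c1 := casc0_le1 w t.
  have x0 := casc0_ge0 (rcons w false) (dyadV false t).
  have x1 := casc0_le1 (rcons w false) (dyadV false t).
  have y0 := casc0_ge0 (rcons w true) (dyadV true t).
  have y1 := casc0_le1 (rcons w true) (dyadV true t).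
  have ex : `|e (rcons w false) * casc h e 0 (rcons w false) (dyadV false t)| <= 1.
    by apply: norm_signM; rewrite ger0_norm.
  have ey : `|e (rcons w true) * casc h e 0 (rcons w true) (dyadV true t)| <= 1.
    by apply: norm_signM; rewrite ger0_norm.
  have -> : casc h e 1 w t = h *
   (e (rcons w false) * casc h e 0 (rcons w false) (dyadV false t) +
   e (rcons w true) * casc h e 0 (rcons w true) (dyadV true t)) by [].
  move: ex ey; set X := _ * casc _ _ _ _ _; set Y := _ * casc _ _ _ _ _.
  move: (casc _ _ _ w _) c0 c1 => c c0 c1.
  move=> X1 Y1; have XY : `|h * (X + Y)| <= 2.
    rewrite normrM (gtr0_norm h0); apply: (@le_trans _ _ `|X + Y|).
      by rewrite ler_piMl.
    by apply: (le_trans (ler_normD _ _)); lra.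
  by move: XY; rewrite !ler_norml => /andP[? ?]; apply/andP; split; lra.
rewrite cascS_sub normrM (gtr0_norm h0).
set B := b ^+ size w; have B1 : 1 <= B by rewrite exprn_ege1.
have B0 : 0 < B by lra.
set Q := (b * kap) ^+ n; have Q0 : 0 <= Q by rewrite exprn_ge0// mulr_ge0//; lra.
have b0 : 0 <= b by lra.
have K0 : 0 <= K by lra.
suff : `|e (rcons w false) * (casc h e n.+1 (rcons w false) (dyadV false t) -
                       casc h e n (rcons w false) (dyadV false t)) +
  e (rcons w true) * (casc h e n.+1 (rcons w true) (dyadV true t) -
                      casc h e n (rcons w true) (dyadV true t))|
     <= 4 * K * (B * b) * Q.
  move=> H; apply: (le_trans (ler_wpM2l (ltW h0) H)).
  rewrite exprS -/Q.
  have -> : h * (4 * K * (B * b) * Q) = (K * B * b * Q) * (4 * h) by ring.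
  have -> : 3 * K * B * (b * kap * Q) = (K * B * b * Q) * (3 * kap) by ring.
  by apply: ler_wpM2l h_le_kap; rewrite !mulr_ge0// ltW.
have M2 : `|e (rcons w true) * (casc h e n.+1 (rcons w true) (dyadV true t) -
                       casc h e n (rcons w true) (dyadV true t))| <= 3 * K * (B * b) * Q.
  apply: norm_signM; apply: (le_trans (IH _ _)).
  by rewrite size_rcons exprSr.
have M1 : `|e (rcons w false) * (casc h e n.+1 (rcons w false) (dyadV false t) -
                       casc h e n (rcons w false) (dyadV false t))| <= 3 * K * (B * b) * Q.
  apply: norm_signM; apply: (le_trans (IH _ _)).
  by rewrite size_rcons exprSr.
have KB : 0 <= K * (B * b) * Q by rewrite !mulr_ge0// ltW.
have [t2|t2] := leP (2 * t) 1.
  rewrite !(casc_le0 _ _ _ _ (_ : dyadV true t <= 0)) ?subr0 ?mulr0 ?addr0; last first.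
  - by rewrite /dyadV /=; lra.
  - by rewrite /dyadV /=; lra.
  apply: (le_trans M1); nra.
rewrite !(casc_ge1 _ _ _ _ (_ : 1 <= dyadV false t)); last first.
- by rewrite /dyadV /=; lra.
- by rewrite /dyadV /=; lra.
apply: (le_trans (ler_normD _ _)).
have := reg n (rcons w false); rewrite size_rcons exprSr => /(norm_signM (rcons w false)).
rewrite -/B -/Q; move: M2; lra.
Qed.

Lemma casc_cauchy K b : 1 <= K -> 1 <= b -> regular K b -> b * kap < 1 ->
  forall n m w t,
  `|casc h e (n + m) w t - casc h e n w t| <=
  3 * K * b ^+ size w * (b * kap) ^+ n * (1 - b * kap)^-1.
Proof.
move=> K1 b1 reg q1 n m w t.
set q := b * kap; have q0 : 0 <= q by rewrite mulr_ge0//; lra.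
set A := 3 * K * _ ; have A0 : 0 <= A.
  rewrite /A !mulr_ge0//; first lra; rewrite exprn_ge0//; lra.
have iq : 0 < (1 - q)^-1 by rewrite invr_gt0 subr_gt0.
suff : `|casc h e (n + m) w t - casc h e n w t| <=
    A * q ^+ n * ((1 - q ^+ m) * (1 - q)^-1).
  move/le_trans; apply; apply: ler_wpM2l; first by rewrite mulr_ge0// exprn_ge0.
  by apply: ler_piMl; [exact: ltW|rewrite lerBlDr lerDl exprn_ge0].
elim: m => [|m IH]; first by rewrite addn0 subrr normr0 subrr mul0r mulr0.
rewrite addnS.
have -> : casc h e (n + m).+1 w t - casc h e n w t =
  (casc h e (n + m).+1 w t - casc h e (n+m) w t) + (casc h e (n + m) w t - casc h e n w t) by ring.
apply: (le_trans (ler_normD _ _)).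
have := casc_step K1 b1 reg (n + m) w t; rewrite -/q -/A => S1.
have -> : A * q ^+ n * ((1 - q ^+ m.+1) / (1 - q)) =
   A * q ^+ (n + m) + A * q ^+ n * ((1 - q ^+ m) / (1 - q)).
  rewrite exprD exprS; field; by rewrite lt0r_neq0// subr_gt0.
lra.
Qed.

Definition casc_lim w t : R := lim (casc h e n w t @[n --> \oo]).

Section Limit.
Variables (K b : R).
Hypotheses (K1 : 1 <= K) (b1 : 1 <= b) (reg : regular K b) (q1 : b * kap < 1).

Let q := b * kap.
Let q0 : 0 <= q. Proof. by rewrite mulr_ge0// (le_trans ler01). Qed.

Let A w := 3 * K * b ^+ size w * (1 - q)^-1.
Let A0 w : 0 <= A w.
Proof.
have b0 : 0 <= b by rewrite (le_trans ler01).
have K0 : 0 <= K by rewrite (le_trans ler01).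
rewrite !mulr_ge0//; first exact: exprn_ge0.
by rewrite invr_ge0 subr_ge0 ltW.
Qed.

Lemma casc_is_cvg w t : cvgn (fun n => casc h e n w t).
Proof.
apply/cauchy_cvgP/cauchy_exP => eps eps0.
have /(_ (eps / (A w + 1))) : forall d, 0 < d -> \forall n \near \oo, `|q ^+ n| < d.
  move=> d d0; have : q ^+ n @[n --> \oo] --> 0.
    by apply: cvg_expr; rewrite ger0_norm.
  by move/cvgr0Pnorm_lt; apply.
case; first by rewrite divr_gt0// ltr_wpDl.
move=> N _ HN; exists (casc h e N w t).
exists N => // m /= Nm.
rewrite /ball/= -(subnKC Nm) distrC.
apply: (le_lt_trans (casc_cauchy K1 b1 reg q1 _ _ _ _)).
have := HN N (leqnn N); rewrite ger0_norm ?exprn_ge0//.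
rewrite ltr_pdivlMr ?ltr_wpDl// => H.
apply: le_lt_trans H; rewrite -/q.
have -> : 3 * K * b ^+ size w * q ^+ N / (1 - q) = q ^+ N * A w by rewrite /A; ring.
by apply: ler_wpM2l; [exact: exprn_ge0|lra].
Qed.

Lemma casc_lim_cvg w t : casc h e n w t @[n --> \oo] --> casc_lim w t.
Proof. exact: casc_is_cvg. Qed.

Lemma casc_lim_dist n w t :
  `|casc_lim w t - casc h e n w t| <=
  3 * K * b ^+ size w * (b * kap) ^+ n * (1 - b * kap)^-1.
Proof.
set B := _ * _^-1.
have C : casc h e m w t - casc h e n w t @[m --> \oo] --> casc_lim w t - casc h e n w t.
  by apply: cvgB; [exact: casc_lim_cvg|exact: cvg_cst].
have C' := cvg_norm C; rewrite -(cvg_lim (@norm_hausdorff _ _) (C' _)).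
apply: limr_le; first by apply: is_cvg_norm; apply/cvg_ex; eexists; exact: C.
exists n => // m /= nm.
by rewrite -(subnKC nm); exact: casc_cauchy.
Qed.

Lemma casc_lim_le0 w t : t <= 0 -> casc_lim w t = 0.
Proof.
move=> t0; rewrite /casc_lim; under eq_fun do rewrite casc_le0//.
exact: lim_cst.
Qed.

Lemma casc_lim_ge1 w t : 1 <= t -> casc_lim w t = casc_lim w 1.
Proof.
by move=> t1; rewrite /casc_lim; under eq_fun do rewrite casc_ge1//.
Qed.

Lemma casc_limS w t : casc_lim w t =
  h * (e (rcons w false) * casc_lim (rcons w false) (dyadV false t) +
       e (rcons w true) * casc_lim (rcons w true) (dyadV true t)).
Proof.
have := @casc_lim_cvg w t; rewrite -(cvg_shiftS (fun n => casc h e n w t)) => C.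
rewrite -(cvg_lim (@norm_hausdorff _ _) C).
apply: (cvg_lim (@norm_hausdorff _ _)) => /=.
by apply: cvgMr; apply: cvgD; apply: cvgMr; exact: casc_lim_cvg.
Qed.

Lemma casc_lim_bound w t : `|casc_lim w t| <= (1 + 3 * K * (1 - b * kap)^-1) * b ^+ size w.
Proof.
have := casc_lim_dist 0 w t; rewrite expr0 mulr1 => H.
have -> : casc_lim w t = casc h e 0 w t + (casc_lim w t - casc h e 0 w t) by ring.
apply: (le_trans (ler_normD _ _)).
rewrite (ger0_norm (casc0_ge0 _ _)) mulrDl.
have -> : 3 * K / (1 - b * kap) * b ^+ size w = 3 * K * b ^+ size w / (1 - b * kap) by ring.
apply: lerD => //; rewrite mul1r; apply: (le_trans (casc0_le1 w t)).
by rewrite exprn_ege1.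
Qed.

Lemma casc_lim_continuous w : continuous (casc_lim w).
Proof.
move=> t; apply/cvgrPdist_lt => eps eps0.
pose A1 := A w + 1.
have A1g : 0 < A1 by rewrite ltr_wpDl.
have [N HN] : exists N, A w * q ^+ N < eps / 3.
  have : q ^+ n @[n --> \oo] --> 0 by apply: cvg_expr; rewrite ger0_norm.
  have e3 : 0 < eps / 3 / A1 by rewrite !divr_gt0.
  move/cvgr0Pnorm_lt => /(_ _ e3) [N _ /(_ N (leqnn N))].
  rewrite ger0_norm ?exprn_ge0// ltr_pdivlMr// => HN.
  exists N; apply: le_lt_trans HN; rewrite mulrC /A1 mulrDr mulr1 lerDl exprn_ge0//.
have D s : `|casc_lim w s - casc h e N w s| < eps / 3.
  apply: le_lt_trans HN; apply: (le_trans (casc_lim_dist N w s)).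
  by rewrite le_eqVlt; apply/orP; left; apply/eqP; rewrite /A -/q; ring.
have := @casc_continuous R h e N w t.
move/cvgrPdist_lt => /(_ (eps / 3)) H.
have e3 : 0 < eps / 3 by rewrite divr_gt0.
near=> s.
have Hs : `|casc h e N w t - casc h e N w s| < eps / 3 by near: s; exact: H.
have -> : casc_lim w t - casc_lim w s = (casc_lim w t - casc h e N w t) +
  (casc h e N w t - casc h e N w s) - (casc_lim w s - casc h e N w s) by ring.
apply: (le_lt_trans (ler_normB _ _)).
have := ler_normD (casc_lim w t - casc h e N w t) (casc h e N w t - casc h e N w s).
have := D s; have := D t; lra.
Unshelve. all: by end_near.
Qed.

End Limit.
End Regular.

(** * Dyadic intervals, self-similarity and modulus of continuity *)

Section DyadicWords.
Context {R : realType}.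
Implicit Types (w v : word) (t s : R).

Lemma wordV_cons c v t : wordV (c :: v) t = wordV v (dyadV c t).
Proof. by []. Qed.

Lemma wpoint_nil : wpoint R [::] = 0.
Proof. by rewrite /wpoint big_ord0. Qed.

Lemma wpoint_cons c v : wpoint R (c :: v) = (c%:R + wpoint R v) / 2.
Proof.
rewrite /wpoint /= big_ord_recl /= expr1 mulrDl; congr (_ + _).
rewrite big_distrl /=; apply: eq_bigr => i _.
by rewrite /bump /= add1n exprSr -mulrA invfM.
Qed.

Lemma wordVE v t : wordV v t = 2 ^+ size v * (t - wpoint R v).
Proof.
elim: v t => [|c v IH] t; first by rewrite wpoint_nil expr0 mul1r subr0.
by rewrite wordV_cons IH wpoint_cons /dyadV exprS /=; field.
Qed.

Lemma wpoint_ge0 v : 0 <= wpoint R v.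
Proof. by apply: sumr_ge0 => i _; rewrite mulr_ge0// invr_ge0 exprn_ge0. Qed.

Lemma wpoint_le1 v : wpoint R v + 2 ^- size v <= 1.
Proof.
elim: v => [|c v IH]; first by rewrite wpoint_nil expr0 invr1 add0r.
rewrite wpoint_cons [size _]/= exprS invfM.
by case: c => /=; move: IH; set x := _^-1; lra.
Qed.

Lemma wpoint_nat m l : (l < 2 ^ m)%N ->
  exists2 w, size w = m & wpoint R w = l%:R / 2 ^+ m.
Proof.
elim: m l => [|m IH] l lm.
  by exists [::]; rewrite // wpoint_nil expr0 divr1; move: lm; rewrite expn0 ltnS leqn0 => /eqP ->.
have [lt|ge] := ltnP l (2 ^ m).
  have [w sw ww] := IH _ lt; exists (false :: w); rewrite /= ?sw//.
  by rewrite wpoint_cons ww exprS /=; field; apply/lt0r_neq0/exprn_gt0.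
have [|w sw ww] := IH (l - 2 ^ m)%N; first by rewrite expnS in lm; lia.
exists (true :: w); rewrite /= ?sw//.
rewrite wpoint_cons ww natrB// natrX exprS /=; field.
by apply/lt0r_neq0/exprn_gt0.
Qed.

Lemma winterval_cover m t : t \in `[0, 1] ->
  exists2 w, size w = m & t \in winterval R w.
Proof.
rewrite in_itv /= => /andP[t0 t1].
have p0 : 0 < 2 ^+ m :> R by rewrite exprn_gt0.
have [E|N] := eqVneq t 1.
  have [|w sw ww] := @wpoint_nat m (2 ^ m).-1; first by rewrite prednK ?expn_gt0.
  exists w => //; rewrite inE /winterval /= in_itv /= sw ww E.
  rewrite -subn1 natrB ?expn_gt0// natrX.
  rewrite mulrBl divff ?lt0r_neq0// mul1r subrK lexx andbT gerBl invr_ge0.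
  exact: ltW.
have t1' : t < 1 by rewrite lt_neqAle N.
have x0 : 0 <= 2 ^+ m * t by rewrite mulr_ge0// ltW.
have [|w sw ww] := @wpoint_nat m (Num.truncn (2 ^+ m * t)).
  rewrite truncn_lt_nat// natrX mulrC gtr_pMl//.
exists w => //; rewrite inE /winterval /= in_itv /= sw ww.
have /andP[a b] := truncn_itv x0.
rewrite ler_pdivrMr// [t * _]mulrC a /=.
by rewrite -{2}[_^-1]mul1r -mulrDl ler_pdivlMr// mulrC natr1 ltW.
Qed.

End DyadicWords.

Section SelfSimilar.
Context {R : realType}.
Variables (h : R) (e : word -> R) (f : word -> R -> R).
Hypotheses (h0 : 0 < h)
  (f_le0 : forall w (t : R), t <= 0 -> f w t = 0)
  (f_ge1 : forall w (t : R), 1 <= t -> f w t = f w 1)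
  (fS : forall w t, f w t =
     h * (e (rcons w false) * f (rcons w false) (dyadV false t) +
       e (rcons w true) * f (rcons w true) (dyadV true t))).
Implicit Types (w v : word) (t s : R).

(** On the dyadic interval of [v] the branches that leave the path [v] are
    constant, so the recursion reduces to its diagonal terms. *)
Lemma self_similar w v t : t \in winterval R v ->
  f w t - f w (wpoint R v) =
  \prod_(1 <= k < (size v).+1) e (w ++ take k v) * h ^+ size v *
    f (w ++ v) (wordV v t).
Proof.
elim: v w t => [|c v IH] w t.
  by rewrite wpoint_nil (@f_le0 _ 0) // subr0 big_geq // !mul1r cats0.
move=> tI.
have tI' : dyadV c t \in winterval R v.
  move: tI; rewrite !inE /winterval /= !in_itv /= wpoint_cons /dyadV exprS invfM.
  set x := (2 ^+ size v)^-1; move=> /andP[a b]; apply/andP; split; lra.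
have [a b] : 0 <= dyadV c t /\ dyadV c t <= 1.
  move: tI'; rewrite inE /winterval /= in_itv /= => /andP[a b]; split.
    exact: le_trans (wpoint_ge0 v) a.
  exact: le_trans b (wpoint_le1 v).
have p0 := @wpoint_ge0 R v.
have p1 : wpoint R v <= 1.
  by apply: le_trans (wpoint_le1 v); rewrite lerDl invr_ge0 exprn_ge0.
have pE : dyadV c (wpoint R (c :: v)) = wpoint R v.
  by rewrite wpoint_cons /dyadV; field.
have Erec : f w t - f w (wpoint R (c :: v)) =
   h * (e (rcons w c) * (f (rcons w c) (dyadV c t) - f (rcons w c) (wpoint R v))).
  rewrite (fS w t) (fS w (wpoint R _)).
  case: c a b pE {tI tI'} => a b ->; move: a b; rewrite /dyadV /= ?wpoint_cons /=.
    move=> a b; rewrite !(f_ge1 (rcons w false)) //; first ring; lra.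
  move=> a b; rewrite !(f_le0 (rcons w true)); first ring; lra.
rewrite Erec (IH _ _ tI') wordV_cons.
rewrite [size (c :: v)]/= [in RHS]big_nat_recl// -[take 1 (c :: v)]/(c :: take 0 v) take0 cats1 -cat_rcons.
rewrite exprS.
have -> : \prod_(1 <= i < (size v).+1) e (w ++ take i.+1 (c :: v)) =
  \prod_(1 <= i < (size v).+1) e (rcons w c ++ take i v).
  by apply: eq_bigr => i _; rewrite cat_rcons.
rewrite !mulrA; do 2 congr (_ * _); ring.
Qed.

Variables (K b : R).
Hypotheses (b1 : 1 <= b) (e1 : forall w, `|e w| <= 1)
  (fb : forall w t, `|f w t| <= K * b ^+ size w).

Let b0 : 0 <= b. Proof. exact: le_trans ler01 b1. Qed.
Let K0 : 0 <= K.
Proof.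
by have := fb [::] 0; rewrite expr0 mulr1; apply: le_trans; exact: normr_ge0.
Qed.

Lemma sub_single w c (x y C : R) n :
  `|x - y| <= C * b ^+ size (rcons w c) * (h * b) ^+ n ->
  `|h * (e (rcons w c) * x) - h * (e (rcons w c) * y)|
     <= C * b ^+ size w * (h * b) ^+ n.+1.
Proof.
move=> H; rewrite -!mulrBr !normrM (gtr0_norm h0).
have -> : C * b ^+ size w * (h * b) ^+ n.+1 =
          h * (C * b ^+ size (rcons w c) * (h * b) ^+ n).
  by rewrite size_rcons !exprS; ring.
apply: ler_wpM2l; first exact: ltW.
by apply: le_trans H; rewrite ler_piMl.
Qed.

(** A point at distance [2^-n] of the left end stays in the leftmost branch
    for [n] steps; each step gains a factor [h], and the bound on the branch
    loses a factor [b]. *)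
Lemma near_left n w t : 2 ^+ n * t <= 1 -> `|f w t| <= K * b ^+ size w * (h * b) ^+ n.
Proof.
elim: n w t => [|n IH] w t; first by rewrite expr0 mulr1.
rewrite exprS => t1.
have p1 : 1 <= 2 ^+ n :> R by rewrite exprn_ege1// ler1n.
rewrite fS (@f_le0 _ (dyadV true t)) ?mulr0 ?addr0; last first.
  by rewrite /dyadV /=; nra.
have := @sub_single w false (f (rcons w false) (dyadV false t)) 0 K n.
rewrite !mulr0 !subr0; apply; apply: IH; rewrite /dyadV /=; lra.
Qed.

Lemma near_right n w t : 2 ^+ n * (1 - t) <= 1 ->
  `|f w 1 - f w t| <= 2 * K * b ^+ size w * (h * b) ^+ n.
Proof.
elim: n w t => [|n IH] w t.
  move=> _; rewrite expr0 mulr1; apply: (le_trans (ler_normB _ _)).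
  by have := fb w 1; have := fb w t; lra.
rewrite exprS => t1.
have p1 : 1 <= 2 ^+ n :> R by rewrite exprn_ege1// ler1n.
rewrite (fS w 1) (fS w t).
rewrite !(@f_ge1 _ (dyadV false _)); [|by rewrite /dyadV /=; nra|by rewrite /dyadV /=; nra].
rewrite !mulrDr [X in X - _]addrC addrKA; apply: sub_single.
have -> : dyadV true 1 = 1 :> R by rewrite /dyadV /=; ring.
by apply: IH; rewrite /dyadV /=; lra.
Qed.

(** Two points at distance at most [2^-n] stay in a common branch until they
    are separated by a midpoint; from then on one is near the right end of its
    branch, the other near the left end of its own. *)
Lemma modulus n w s t : s <= t -> 2 ^+ n * (t - s) <= 1 ->
  `|f w t - f w s| <= 4 * K * b ^+ size w * (h * b) ^+ n.
Proof.
elim: n w s t => [|n IH] w s t st.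
  move=> _; rewrite expr0 mulr1; apply: (le_trans (ler_normB _ _)).
  have : 0 <= K * b ^+ size w by rewrite mulr_ge0// exprn_ge0.
  by have := fb w s; have := fb w t; lra.
rewrite exprS => t1.
rewrite (fS w t) (fS w s).
have [t2|t2] := leP (2 * t) 1.
  rewrite !(@f_le0 _ (dyadV true _)); [|by rewrite /dyadV /=; lra|by rewrite /dyadV /=; lra].
  rewrite !mulr0 !addr0; apply: sub_single; apply: IH; rewrite /dyadV /=; lra.
have [s2|s2] := leP 1 (2 * s).
  rewrite !(@f_ge1 _ (dyadV false _)); [|by rewrite /dyadV /=; lra|by rewrite /dyadV /=; lra].
  rewrite !mulrDr [X in X - _]addrC addrKA; apply: sub_single; apply: IH; rewrite /dyadV /=; lra.
have p1 : 1 <= 2 ^+ n :> R by rewrite exprn_ege1// ler1n.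
rewrite (@f_le0 _ (dyadV true s)); last by rewrite /dyadV /=; lra.
rewrite (@f_ge1 _ (dyadV false t)); last by rewrite /dyadV /=; lra.
rewrite mulr0 addr0 mulrDr addrAC.
have L : 2 ^+ n * (dyadV true t) <= 1 by rewrite /dyadV /=; nra.
have L' : 2 ^+ n * (1 - dyadV false s) <= 1 by rewrite /dyadV /=; nra.
apply: (le_trans (ler_normD _ _)).
have H1 := sub_single (near_right (rcons w false) L').
have H2 := @sub_single w true (f (rcons w true) (dyadV true t)) 0 K n.
rewrite mulr0 mulr0 !subr0 in H2.
have {}H2 := H2 (near_left (rcons w true) L).
apply: (le_trans (lerD H1 H2)).
have : 0 <= K * b ^+ size w * (h * b) ^+ n.+1.
  by rewrite !mulr_ge0// exprn_ge0// mulr_ge0// ltW.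
lra.
Qed.

End SelfSimilar.

(** * Averages over finitely many independent signs *)

Definition sgn {R : realType} (c : bool) : R := if c then 1 else -1.

Section Average.
Context {R : realType} {I : eqType}.
Variable (p : R).
Implicit Types (f g : (I -> bool) -> R) (s : I -> bool) (l : seq I) (D : pred I).

Definition upd s i c : I -> bool := fun j => if j == i then c else s j.

(** The expectation of [f] when the coordinates in [l] are redrawn, independently
    [true] with probability [p], and the others keep their value in [s]. All the
    probabilistic estimates take place at this finite level, where product rules
    are algebraic identities; they are transferred to the probability space
    afterwards. *)
Fixpoint avg l f s : R :=
  if l is i :: l' then p * avg l' f (upd s i true) + (1 - p) * avg l' f (upd s i false)
  else f s.

Definition depends D f := forall s s', (forall i, D i -> s i = s' i) -> f s = f s'.

Lemma eq_avg l f g s : f =1 g -> avg l f s = avg l g s.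
Proof. by move=> fg; congr (avg _ _ _); apply/funext. Qed.

Lemma avgD l f g s : avg l (fun s => f s + g s) s = avg l f s + avg l g s.
Proof. by elim: l s => //= i l IH s; rewrite !IH; ring. Qed.

Lemma avgZ l c f s : avg l (fun s => c * f s) s = c * avg l f s.
Proof. by elim: l s => //= i l IH s; rewrite !IH; ring. Qed.

Lemma avgB l f g s : avg l (fun s => f s - g s) s = avg l f s - avg l g s.
Proof. by elim: l s => //= i l IH s; rewrite !IH; ring. Qed.

Lemma avg_cst l c s : avg l (fun=> c) s = c.
Proof. by elim: l s => //= i l IH s; rewrite !IH; ring. Qed.

Lemma avg_sum (J : Type) (r : seq J) (P : pred J) l (F : J -> (I -> bool) -> R) s :
  avg l (fun s => \sum_(j <- r | P j) F j s) s = \sum_(j <- r | P j) avg l (F j) s.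
Proof.
elim: r => [|j r IH].
  by rewrite big_nil (@eq_avg _ _ (fun=> 0)) ?avg_cst// => ?; rewrite big_nil.
rewrite big_cons -IH; case: (boolP (P j)) => Pj.
  by rewrite -avgD; apply: eq_avg => ?; rewrite big_cons Pj.
by apply: eq_avg => ?; rewrite big_cons (negbTE Pj).
Qed.

Hypothesis (p01 : 0 <= p <= 1).

Lemma ler_avg l f g s : (forall s, f s <= g s) -> avg l f s <= avg l g s.
Proof.
move=> fg; elim: l s => //= i l IH s; have /andP[p0 p1] := p01.
by apply: lerD; apply: ler_wpM2l; rewrite ?subr_ge0.
Qed.

Lemma avg_ge0 l f s : (forall s, 0 <= f s) -> 0 <= avg l f s.
Proof. by move=> f0; rewrite -(avg_cst l 0 s); exact: ler_avg. Qed.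

Lemma ler_norm_avg l f s : `|avg l f s| <= avg l (fun s => `|f s|) s.
Proof.
rewrite ler_norml -mulN1r -avgZ; apply/andP; split; apply: ler_avg => s'.
  by rewrite mulN1r lerNl -normrN ler_norm.
exact: ler_norm.
Qed.

Lemma dependsW D D' f : {subset D <= D'} -> depends D f -> depends D' f.
Proof. by move=> DD H s s' ss; apply: H => i Di; apply: ss; exact: DD. Qed.

Lemma depends_comp D (T : R -> R) f : depends D f -> depends D (fun s => T (f s)).
Proof. by move=> H s s' ss; rewrite (H _ _ ss). Qed.

Lemma depends_comp2 D (T : R -> R -> R) f g : depends D f -> depends D g ->
  depends D (fun s => T (f s) (g s)).
Proof. by move=> H H' s s' ss; rewrite (H _ _ ss) (H' _ _ ss). Qed.

Lemma depends_sign D i (T : bool -> R) : D i -> depends D (fun s => T (s i)).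
Proof. by move=> Di s s' ss; rewrite ss. Qed.

Lemma depends_avg D l f : depends D f -> depends D (avg l f).
Proof.
move=> H; elim: l => //= i l IH s s' ss.
by congr (_ * _ + _ * _); apply: IH => j Dj; rewrite /upd; case: ifP => // _; exact: ss.
Qed.

Lemma depends_upd D f s i c : depends D f -> ~~ D i -> f (upd s i c) = f s.
Proof.
move=> H Di; apply: H => j Dj; rewrite /upd; case: eqP => // ji.
by rewrite -ji Dj in Di.
Qed.

(** Independence: at each redrawn coordinate one of the two factors is a
    constant. *)
Lemma avgM D D' l f g s : depends D f -> depends D' g -> (forall i, ~~ (D i && D' i)) ->
  avg l (fun s => f s * g s) s = avg l f s * avg l g s.
Proof.
move=> Hf Hg dis; elim: l s => //= i l IH s; rewrite !IH.
have [Di|Di] := boolP (D i).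
  have D'i : ~~ D' i by have := dis i; rewrite Di.
  rewrite !(depends_upd _ _ (depends_avg l Hg) D'i); ring.
rewrite !(depends_upd _ _ (depends_avg l Hf) Di); ring.
Qed.

Lemma avg_sign l i (T : bool -> R) s : i \in l ->
  avg l (fun s => T (s i)) s = p * T true + (1 - p) * T false.
Proof.
elim: l s => //= j l IH s; rewrite inE => /orP[/eqP <-|il]; last by rewrite !IH//; ring.
have [il|il] := boolP (i \in l); first by rewrite !IH//; ring.
have H c : avg l (fun s => T (s i)) (upd s i c) = T c.
  rewrite -[RHS](avg_cst l _ (upd s i c)).
  have : forall s', s' i = c -> avg l (fun s => T (s i)) s' = avg l (fun=> T c) s'.
    elim: l il {IH} => [|k l IH] /= il s' sc; first by rewrite sc.
    rewrite inE negb_or in il; have /andP[ik il'] := il.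
    by rewrite !IH// /upd (negbTE ik).
  by apply; rewrite /upd eqxx.
by rewrite !H.
Qed.

(** Conditioning on one coordinate that [f] ignores. *)
Lemma avg_signM D l i (T : R -> R) f s : i \in l -> depends D f -> ~~ D i ->
  avg l (fun s => T (sgn (s i) * f s)) s =
  p * avg l (fun s => T (f s)) s + (1 - p) * avg l (fun s => T (- f s)) s.
Proof.
move=> il Hf Di.
pose t1 (c : bool) : R := c%:R; pose t2 (c : bool) : R := (~~ c)%:R.
have dis j : ~~ (pred1 i j && D j).
  by apply/negP => /andP[/eqP -> Dj]; rewrite Dj in Di.
rewrite (@eq_avg _ _ (fun s => t1 (s i) * T (f s) + t2 (s i) * T (- f s))); last first.
  by move=> s'; rewrite /t1 /t2 /sgn; case: (s' i); rewrite /= !(mul1r, mul0r, mulN1r, addr0, add0r).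
have dsg T' : depends (pred1 i) (fun s => T' (s i)) by apply: depends_sign => /=.
rewrite avgD.
rewrite (avgM l s (dsg t1) (depends_comp T Hf) dis).
rewrite (avgM l s (dsg t2) (depends_comp (fun x => T (- x)) Hf) dis).
rewrite !avg_sign// /t1 /t2 /=; ring.
Qed.

End Average.

Section Subtree.
Implicit Types (w v i : word).

Definition descendant w : pred word := fun i => (i != w) && prefix w i.

Lemma descendant_rcons w c i : prefix (rcons w c) i -> descendant w i.
Proof.
move=> H; apply/andP; split; last first.
  exact: prefix_trans (prefix_rcons w c) H.
apply/eqP => iw; move: H; rewrite iw => /size_prefix.
by rewrite size_rcons ltnn.
Qed.

Lemma descendantW w i : descendant w i -> prefix w i.
Proof. by case/andP. Qed.

Lemma prefix_rcons_disj w i : ~~ (prefix (rcons w false) i && prefix (rcons w true) i).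
Proof.
apply/negP; rewrite !prefixE !size_rcons => /andP[/eqP-> /eqP].
by move/rcons_inj => [].
Qed.

Lemma descendant_irr w : ~~ descendant w w.
Proof. by rewrite /descendant eqxx. Qed.

End Subtree.

Section CascadeDep.
Context {R : realType}.
Variable (h : R).
Implicit Types (w v : word) (s : word -> bool).

Definition sg s : word -> R := fun w => sgn (s w).

Definition subtree w n : pred word :=
  fun i => descendant w i && (size i <= size w + n)%N.

Lemma subtree_rcons w n c i : subtree (rcons w c) n i -> subtree w n.+1 i.
Proof.
case/andP => H1; rewrite size_rcons addSnnS => H2.
by rewrite /subtree H2 andbT; exact/descendant_rcons/descendantW/H1.
Qed.

Lemma casc_depends n w t : depends (subtree w n) (fun s => casc h (sg s) n w t).
Proof.
elim: n w t => [|n IH] w t s s' ss //; rewrite !cascS.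
have E c : sg s (rcons w c) = sg s' (rcons w c).
  rewrite /sg ss// /subtree size_rcons addnS ltnS leq_addr andbT.
  exact/descendant_rcons/prefix_refl.
have F c x : casc h (sg s) n (rcons w c) x = casc h (sg s') n (rcons w c) x.
  by apply: IH => i /subtree_rcons; exact: ss.
by rewrite !E !F.
Qed.

Lemma casc_depends_descendant n w t : depends (descendant w) (fun s => casc h (sg s) n w t).
Proof. by apply: (dependsW _ (@casc_depends n w t)) => i /andP[]. Qed.

End CascadeDep.

(** * Elementary inequalities *)

Section Elementary.
Context {R : realType}.
Implicit Types x u : R.

Lemma cos_ge1B x : 1 - `|x| <= cos x.
Proof.
rewrite -cos_norm; set y := `|x|; have y0 : 0 <= y := normr_ge0 x.
have D : forall z : R, z \in `]0, y[ -> is_derive z 1 cos (- sin z).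
  by move=> z _; exact: is_derive_cos.
have C : {within `[0, y], continuous (cos : R -> R)}.
  by apply: continuous_subspaceT => z; exact: continuous_cos.
have [c _] := MVT_segment y0 D C.
rewrite cos0 subr0 => /eqP; rewrite subr_eq => /eqP ->.
have := sin_le1 c; nra.
Qed.

Lemma sin_dist x : `|sin x - x| <= x ^+ 2.
Proof.
wlog x0 : x / 0 <= x.
  move=> H; have [/H//|xn] := leP 0 x.
  have x0' : 0 <= - x by rewrite oppr_ge0 ltW.
  have := H (- x) x0'; rewrite sinN sqrrN.
  have -> : - sin x - - x = - (sin x - x) by ring.
  by rewrite normrN.
have D : forall z : R, z \in `]0, x[ -> is_derive z 1 sin (cos z).
  by move=> z _; exact: is_derive_sin.
have C : {within `[0, x], continuous (sin : R -> R)}.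
  by apply: continuous_subspaceT => z; exact: continuous_sin.
have [c] := MVT_segment x0 D C.
rewrite in_itv /= => /andP[c0 cx]; rewrite sin0 !subr0 => ->.
have := cos_ge1B c; rewrite (ger0_norm c0) => c1; have c2 := cos_le1 c.
rewrite ler_norml; apply/andP; split; nra.
Qed.

(** Turns a centred bounded variable into a sub-Gaussian one: the linear term
    averages to zero. For [u] outside [-1/2, 1/2] one of the two terms on the
    right is already large enough; inside, [exp u <= 1 / (1 - u)]. *)
Lemma expR_le_gauss u : expR u <= u + expR (2 * u ^+ 2).
Proof.
have E := expR_ge1Dx (2 * u ^+ 2).
have [u1|u1] := ltP u (-2^-1).
  have : expR u <= 1 by rewrite -expR0 ler_expR; lra.
  nra.
have [u2|u2] := ltP u 2^-1; last first.
  have : expR u <= expR (2 * u ^+ 2) by rewrite ler_expR; nra.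
  lra.
have H : expR u * (1 - u) <= 1.
  have := expR_ge1Dx (- u); rewrite expRN => H.
  by rewrite mulrC -ler_pdivlMr ?expR_gt0// div1r.
have e0 := expR_gt0 u.
nra.
Qed.

Lemma expr_le_exp (q : nat) x : 0 <= x -> (0 < q)%N -> x ^+ q <= q%:R ^+ q * expR x.
Proof.
move=> x0 q0; have Q : 0 < q%:R :> R by rewrite ltr0n.
have H : x / q%:R <= expR (x / q%:R).
  by apply: (le_trans _ (expR_ge1Dx _)); rewrite lerDr.
have -> : expR x = expR (x / q%:R) ^+ q.
  by rewrite -expRM_natl mulrC divfK// gt_eqF.
have e0 : 0 <= q%:R * expR (x / q%:R) by rewrite mulr_ge0 ?expR_ge0// ltW.
by rewrite -exprMn; apply: lerXn2r; rewrite ?nnegrE// mulrC -ler_pdivrMr.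
Qed.

Lemma sum_geom_le (th : R) n : 0 <= th < 1 -> \sum_(0 <= k < n) th ^+ k <= (1 - th)^-1.
Proof.
move=> /andP[t0 t1].
have H : (1 - th) * \sum_(0 <= k < n) th ^+ k = 1 - th ^+ n.
  elim: n => [|n IH]; first by rewrite big_geq// mulr0 expr0 subrr.
  by rewrite big_nat_recr//= mulrDr IH exprS; ring.
rewrite -[X in _ <= X]mul1r ler_pdivlMr ?subr_gt0// mulrC H.
by rewrite gerBl exprn_ge0.
Qed.

Lemma sum_geom2_le (th : R) (j n : nat) : 0 <= th < 1 ->
  \sum_(0 <= k < n) th ^+ ((j - k) + (k - j)) <= 2 / (1 - th).
Proof.
move=> T.
have I0 : 0 <= (1 - th)^-1 by case/andP: T => ? ?; rewrite invr_ge0 subr_ge0 ltW.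
have H1 : forall j n, (n <= j)%N -> \sum_(0 <= k < n) th ^+ ((j - k) + (k - j)) <= (1 - th)^-1.
  move=> {}j {}n nj; apply: (le_trans _ (@sum_geom_le th j.+1 T)).
  rewrite [X in _ <= X]big_nat_rev /= add0n.
  rewrite (@big_cat_nat _ _ _ n 0 j.+1)//=; last exact: leqW.
  rewrite -[X in X <= _]addr0; apply: lerD; last first.
    by apply: sumr_ge0 => i _; rewrite exprn_ge0//; case/andP: T.
  rewrite le_eqVlt; apply/orP; left; apply/eqP; apply: eq_big_nat => k /andP[_ kn].
  congr (_ ^+ _); lia.
have [nj|jn] := leqP n j.
  by apply: (le_trans (H1 _ _ nj)); rewrite ler_peMl// ler1n.
rewrite (@big_cat_nat _ _ _ j 0 n)//=; last exact: ltnW.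
rewrite mulrDl mul1r; apply: lerD; first exact: H1.
rewrite -{1}[j]add0n big_addn; apply: (le_trans _ (@sum_geom_le th (n - j) T)).
rewrite le_eqVlt; apply/orP; left; apply/eqP; apply: eq_big_nat => k _.
congr (_ ^+ _); lia.
Qed.

End Elementary.

(** * Moments of the masses *)

Section Estimates.
Context {R : realType}.
Variables (h a : R) (l : seq word) (N : nat) (s0 : word -> bool).
Hypotheses (ah : 2 * h * a = 1) (h_ge : 1 <= 2 * h) (h_lt : 2 * h ^+ 2 < 1)
  (lN : forall w, (size w <= N)%N -> w \in l).
Implicit Types (w v : word) (s : word -> bool) (x y xi : R).

(** The law of a sign with mean [a]; with [2 * h * a = 1] the masses form a
    martingale along each branch. *)
Definition upprob : R := (1 + a) / 2.
Local Notation p := upprob.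
Local Notation E f := (avg p l f s0).

Let h0 : 0 < h. Proof. by move: h_ge; lra. Qed.
Let a0 : 0 < a.
Proof. by rewrite -(pmulr_rgt0 _ (_ : 0 < 2 * h)) ?ah ?ltr01//; move: h_ge; lra. Qed.
Let a1 : a <= 1. Proof. by move: a0 h_ge ah; nra. Qed.

Lemma upprob01 : 0 <= p <= 1.
Proof. by move: a0 a1 => ? ?; rewrite /upprob; apply/andP; split; lra. Qed.

Let p01 := upprob01.
Let pa : p - (1 - p) = a. Proof. by rewrite /upprob; field. Qed.

Local Notation Z n w s := (mass h (sg s) n w).
Local Notation D n w s := (mass h (sg s) n.+1 w - mass h (sg s) n w).

Lemma mass_depends n w : depends (descendant w) (fun s => Z n w s).
Proof. exact: casc_depends_descendant. Qed.

Lemma dmass_depends n w : depends (descendant w) (fun s => D n w s).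
Proof. exact: (depends_comp2 (fun x y => x - y) (@mass_depends _ _) (@mass_depends _ _)). Qed.

(** The average of [G] over a random sign times an independent copy of [X]. *)
Definition symm w (G : R -> R) (X : (word -> bool) -> R) :=
  p * E (fun s => G (X s)) + (1 - p) * E (fun s => G (- X s)).

(** The branching property: the two halves, signs included, are independent. *)
Lemma avg_branch w (G0 G1 : R -> R) X0 X1 : (size w < N)%N ->
  depends (descendant (rcons w false)) X0 -> depends (descendant (rcons w true)) X1 ->
  E (fun s => G0 (sg s (rcons w false) * X0 s) * G1 (sg s (rcons w true) * X1 s)) =
  symm w G0 X0 * symm w G1 X1.
Proof.
move=> wN d0 d1.
have dep c (G : R -> R) X : depends (descendant (rcons w c)) X ->
    depends (prefix (rcons w c)) (fun s => G (sg s (rcons w c) * X s)).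
  move=> d; apply: (depends_comp2 (fun x y => G (x * y))).
    by apply: (@depends_sign _ _ _ _ sgn); exact: prefix_refl.
  by apply: dependsW d => i /descendantW.
rewrite (avgM _ _ _ (dep _ G0 _ d0) (dep _ G1 _ d1)); last exact: prefix_rcons_disj.
congr (_ * _).
  by apply: avg_signM d0 _; [apply: lN; rewrite size_rcons|exact: descendant_irr].
by apply: avg_signM d1 _; [apply: lN; rewrite size_rcons|exact: descendant_irr].
Qed.

Lemma avg_branch0 w (G : R -> R) X : (size w < N)%N ->
  depends (descendant (rcons w false)) X ->
  E (fun s => G (sg s (rcons w false) * X s)) = symm w G X.
Proof.
by move=> wN d; apply: avg_signM d _; [apply: lN; rewrite size_rcons|exact: descendant_irr].
Qed.

Lemma avg_branch1 w (G : R -> R) X : (size w < N)%N ->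
  depends (descendant (rcons w true)) X ->
  E (fun s => G (sg s (rcons w true) * X s)) = symm w G X.
Proof.
by move=> wN d; apply: avg_signM d _; [apply: lN; rewrite size_rcons|exact: descendant_irr].
Qed.

Lemma symm_id w X : symm w id X = a * E X.
Proof.
rewrite /symm (_ : E (fun s => id (- X s)) = - E X); last first.
  by rewrite -mulN1r -avgZ; apply: eq_avg => s; rewrite mulN1r.
by rewrite -pa; ring.
Qed.

(** The martingale property: the mean at every depth is the identity, since the
    two halves of the clamped identity glue back to it. *)
Lemma avg_casc n w t : (size w + n <= N)%N ->
  E (fun s => casc h (sg s) n w t) = Num.max 0 (Num.min t 1).
Proof.
elim: n w t => [|n IH] w t wn; first by rewrite /= avg_cst.
have wN : (size w < N)%N by clear -wn; lia.
pose X c s := casc h (sg s) n (rcons w c) (dyadV c t).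
have d c : depends (descendant (rcons w c)) (X c) by exact: casc_depends_descendant.
rewrite (@eq_avg _ _ _ _ _ (fun s => h * (id (sg s (rcons w false) * X false s) +
   id (sg s (rcons w true) * X true s))))//.
rewrite avgZ avgD (@avg_branch0 w id _ wN (d _)) (@avg_branch1 w id _ wN (d _)).
rewrite !symm_id /X !IH ?size_rcons; [|clear -wn; lia..].
rewrite -mulrDr mulrA.
have -> : h * a = 2^-1 by move: ah; lra.
rewrite /dyadV /= /Num.max /Num.min.
by do ?case: ifP; lra.
Qed.

Lemma avg_mass n w : (size w + n <= N)%N -> E (fun s => Z n w s) = 1.
Proof.
move=> wn; rewrite /mass avg_casc// minxx.
by apply/max_idPr; rewrite ler01.
Qed.

Section SecondMoment.
Variable m2 : R.
Hypotheses (m2_ge1 : 1 <= m2) (m2_rec : 2 * h ^+ 2 * m2 + 2^-1 <= m2).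

Lemma symm_sqr w X : symm w (fun x => x ^+ 2) X = E (fun s => X s ^+ 2).
Proof.
rewrite /symm (@eq_avg _ _ _ _ (fun s => (- X s) ^+ 2) (fun s => X s ^+ 2)); first by ring.
by move=> s; rewrite sqrrN.
Qed.

(** The second moments [m_n] satisfy [m_{n+1} = 2 h^2 m_n + 1/2], whose
    coefficient is below [1] exactly because [H > 1/2]. *)
Lemma avg_mass2 n w : (size w + n <= N)%N -> E (fun s => Z n w s ^+ 2) <= m2.
Proof.
elim: n w => [|n IH] w wn.
  rewrite (@eq_avg _ _ _ _ _ (fun=> 1)) ?avg_cst// => s.
  by rewrite mass0 expr1n.
have wN : (size w < N)%N by clear -wn; lia.
pose X c s := Z n (rcons w c) s.
have d c : depends (descendant (rcons w c)) (X c) by exact: mass_depends.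
rewrite (@eq_avg _ _ _ _ _ (fun s => h ^+ 2 * ((sg s (rcons w false) * X false s) ^+ 2 +
   (2 * (id (sg s (rcons w false) * X false s) * id (sg s (rcons w true) * X true s))
    + (sg s (rcons w true) * X true s) ^+ 2)))); last first.
  by move=> s; rewrite massS /X; ring.
rewrite avgZ avgD avgD avgZ (@avg_branch w id id _ _ wN (d _) (d _)).
rewrite (@avg_branch0 w (fun x => x ^+ 2) _ wN (d _)).
rewrite (@avg_branch1 w (fun x => x ^+ 2) _ wN (d _)).
rewrite !symm_sqr !symm_id /X !avg_mass ?size_rcons; [|clear -wn; lia..].
have H c : E (fun s => Z n (rcons w c) s ^+ 2) <= m2.
  by apply: IH; rewrite size_rcons; clear -wn; lia.
have := H false; have := H true.
set u := E _; set v := E _ => u1 v1.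
have h2 : 0 <= h ^+ 2 by rewrite sqr_ge0.
have : h ^+ 2 * (u + v) <= h ^+ 2 * (2 * m2) by apply: ler_wpM2l => //; lra.
have : h ^+ 2 * (2 * (a * 1 * (a * 1))) = 2^-1.
  have -> : h ^+ 2 * (2 * (a * 1 * (a * 1))) = (2 * h * a) ^+ 2 / 2 by field.
  by rewrite ah expr1n mul1r.
move: m2_rec; lra.
Qed.

Definition small n w s : R := ((Z n w s <= 2^-1)%R)%:R.

(** A mass has mean [1] and second moment at most [m2], so it cannot be
    mostly below [1/2]: this is the Paley-Zygmund inequality, here through the
    quadratic majorant of the indicator that vanishes to second order at
    [2 * m2]. *)
Lemma avg_small n w : (size w + n <= N)%N ->
  E (fun s => small n w s) <= 1 - (4 * m2)^-1.
Proof.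
move=> wn.
have m0 : 0 < m2 := lt_le_trans ltr01 m2_ge1.
have H s : small n w s <= (1 + (2 * m2)^-1) +
   ((4 * m2 ^+ 2)^-1 * Z n w s ^+ 2 - m2^-1 * Z n w s).
  rewrite /small; set z := mass _ _ _ _.
  have -> : (1 + (2 * m2)^-1) + ((4 * m2 ^+ 2)^-1 * z ^+ 2 - m2^-1 * z) =
    (z / (2 * m2) - 1) ^+ 2 + (2 * m2)^-1.
    by field; lra.
  have -> : (z / (2 * m2) - 1) ^+ 2 + (2 * m2)^-1 =
     1 + (z / (2 * m2)) ^+ 2 + (2^-1 - z) / m2 by field; lra.
  have [z2|z2] := leP z 2^-1 => /=.
    have : 0 <= (2^-1 - z) / m2 by rewrite divr_ge0//; lra.
    have := sqr_ge0 (z / (2 * m2)); lra.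
  have -> : 1 + (z / (2 * m2)) ^+ 2 + (2^-1 - z) / m2 =
     (z / (2 * m2) - 1) ^+ 2 + (2 * m2)^-1 by field; lra.
  by rewrite addr_ge0 ?sqr_ge0// invr_ge0; lra.
apply: (le_trans (ler_avg p01 _ _ H)).
rewrite avgD avg_cst avgB !avgZ avg_mass//.
have := avg_mass2 wn; set u := E _ => um.
have : (4 * m2 ^+ 2)^-1 * u <= (4 * m2 ^+ 2)^-1 * m2.
  by apply: ler_wpM2l => //; rewrite invr_ge0 mulr_ge0// sqr_ge0.
have -> : (4 * m2 ^+ 2)^-1 * m2 = (4 * m2)^-1 by field; lra.
have -> : (2 * m2)^-1 = 2 * (4 * m2)^-1 by field; lra.
have -> : m2^-1 = 4 * (4 * m2)^-1 by field; lra.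
lra.
Qed.

(** The indicator that all the [2 ^ m] descendants of [w] at distance [m] have a
    small mass; they are independent, so its mean decays doubly
    exponentially in [m]. *)
Fixpoint allsmall n m w s : R :=
  if m is m'.+1 then allsmall n m' (rcons w false) s * allsmall n m' (rcons w true) s
  else small n w s.

Lemma allsmall_depends n m w : depends (descendant w) (allsmall n m w).
Proof.
elim: m w => [|m IH] w /=.
  exact: (depends_comp (fun x => ((x <= 2^-1)%R)%:R) (@mass_depends n w)).
by apply: (depends_comp2 (fun x y => x * y)); apply: dependsW (IH _) => i /descendantW /descendant_rcons.
Qed.

Lemma avg_allsmall n m w : (size w + m + n <= N)%N ->
  E (allsmall n m w) <= (1 - (4 * m2)^-1) ^+ (2 ^ m).
Proof.
elim: m w => [|m IH] w wn.
  by rewrite expn0 expr1; apply: avg_small; lia.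
rewrite /= (avgM _ _ _ (D := descendant (rcons w false)) (D' := descendant (rcons w true))).
- rewrite expnS mul2n -addnn exprD; apply: ler_pM.
  + by apply: avg_ge0 => // s; elim: (m) (rcons _ _) => [|k IHk] v /=; rewrite /small ?mulr_ge0.
  + by apply: avg_ge0 => // s; elim: (m) (rcons _ _) => [|k IHk] v /=; rewrite /small ?mulr_ge0.
  + by apply: IH; rewrite size_rcons; clear -wn; lia.
  + by apply: IH; rewrite size_rcons; clear -wn; lia.
- exact: allsmall_depends.
- exact: allsmall_depends.
- move=> i; apply: contra (prefix_rcons_disj w i) => /andP[/descendantW -> /descendantW ->] //.
Qed.

End SecondMoment.

Lemma allsmall_ge0 n m w s : 0 <= allsmall n m w s.
Proof. by elim: m w => [|k IHk] v /=; rewrite /small ?mulr_ge0. Qed.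

Lemma allsmall0 n m w s : allsmall n m w s = 0 ->
  exists2 v, size v = m & 2^-1 < Z n (w ++ v) s.
Proof.
elim: m w => [|m IH] w /=.
  rewrite /small; case: leP => [_ /= /eqP|z _]; first by rewrite oner_eq0.
  by exists [::]; rewrite ?cats0.
move/eqP; rewrite mulf_eq0 => /orP[] /eqP /IH [v sv zv].
  by exists (false :: v); rewrite /= ?sv// -cat_rcons.
by exists (true :: v); rewrite /= ?sv// -cat_rcons.
Qed.

(** The increments are sub-Gaussian with variance proxy of order
    [(2 h^2) ^ n]: one step of the recursion multiplies the Laplace transforms
    of two copies at the scaled argument [x * h]. The first increment is the sum
    of two centred signs, to which [expR_le_gauss] applies. *)
Lemma avg_expR_dmass n w x : (size w + n < N)%N ->
  E (fun s => expR (x * D n w s)) <= expR (8 * (2 * h ^+ 2) ^+ n * x ^+ 2).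
Proof.
have expD X w' y : symm w' (fun z => expR (y * z)) X =
    p * E (fun s => expR (y * X s)) + (1 - p) * E (fun s => expR (- y * X s)).
  rewrite /symm; congr (_ + _ * _); apply: eq_avg => s; congr expR; ring.
have/andP[p0 p1] := p01.
elim: n w x => [|n IH] w x wn.
  have wN : (size w < N)%N by clear -wn; lia.
  have d c : depends (descendant (rcons w c)) (fun=> 1 : R) by [].
  rewrite (@eq_avg _ _ _ _ _ (fun s =>
    expR (x * h * (sg s (rcons w false) * 1) - x * h * a) *
    expR (x * h * (sg s (rcons w true) * 1) - x * h * a))); last first.
    move=> s; rewrite massS !mass0 -expRD; congr expR.
    have -> : x * h * a = x / 2 * (2 * h * a) by field.
    rewrite ah mulr1.
    by field.
  rewrite (@avg_branch w (fun z => expR (x * h * z - x * h * a))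
     (fun z => expR (x * h * z - x * h * a)) (fun=> 1) (fun=> 1) wN (d _) (d _)).
  rewrite expr0 mulr1 -expr2 /symm !avg_cst !mulr1 mulrN1.
  set y := x * h.
  have -> : expR (8 * x ^+ 2) = expR (4 * x ^+ 2) ^+ 2.
    by rewrite -expRM_natl; congr expR; ring.
  have nn (u u' : R) : 0 <= p * expR u + (1 - p) * expR u'.
    by rewrite addr_ge0// mulr_ge0// ?subr_ge0// expR_ge0.
  apply: lerXn2r; rewrite ?nnegrE ?expR_ge0//.
  have M b : `|b| = 1 :> R -> 2 * (y * b - y * a) ^+ 2 <= 4 * x ^+ 2.
    move=> b1.
    have -> : 2 * (y * b - y * a) ^+ 2 = x ^+ 2 * (2 * h ^+ 2) * (b - a) ^+ 2.
      by rewrite /y; ring.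
    have H1 : (b - a) ^+ 2 <= 4.
      have [b2 b3] : -1 <= b /\ b <= 1.
        by apply/andP; rewrite -ler_norml b1.
      move: a0 a1; nra.
    have H2 := sqr_ge0 x; have H3 := sqr_ge0 (b - a).
    have H4 : 0 <= 2 * h ^+ 2 by rewrite mulr_ge0// sqr_ge0.
    rewrite -mulrA [X in _ <= X]mulrC; apply: ler_wpM2l => //.
    by apply: (@le_trans _ _ (1 * 4)); [apply: ler_pM => //; exact: ltW|rewrite mul1r].
  have U b : `|b| = 1 :> R ->
     expR (y * b - y * a) <= (y * b - y * a) + expR (4 * x ^+ 2).
    move=> b1; apply: (le_trans (expR_le_gauss _)); rewrite lerD2l ler_expR.
    exact: M.
  have U1 := U 1 (normr1 _); have U2 := U (-1) (normrN1 _).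
  rewrite mulr1 in U1; rewrite mulrN1 in U2.
  have : p * expR (y - y * a) <= p * ((y - y * a) + expR (4 * x ^+ 2)).
    exact: ler_wpM2l.
  have : (1 - p) * expR (- y - y * a) <= (1 - p) * ((- y - y * a) + expR (4 * x ^+ 2)).
    by apply: ler_wpM2l => //; rewrite subr_ge0.
  have : p * (y - y * a) + (1 - p) * (- y - y * a) = 0.
    by rewrite -pa; ring.
  lra.
have wN : (size w < N)%N by clear -wn; lia.
have d c := @dmass_depends n (rcons w c).
rewrite (@eq_avg _ _ _ _ _ (fun s =>
    expR (x * h * (sg s (rcons w false) * D n (rcons w false) s)) *
    expR (x * h * (sg s (rcons w true) * D n (rcons w true) s)))); last first.
  by move=> s; rewrite (massS h _ n.+1 w) (massS h _ n w) -expRD; congr expR; ring.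
rewrite (@avg_branch w (fun z => expR (x * h * z)) (fun z => expR (x * h * z)) _ _ wN (d _) (d _)).
have B c : symm w (fun z => expR (x * h * z)) (fun s => D n (rcons w c) s) <=
    expR (8 * (2 * h ^+ 2) ^+ n * (x * h) ^+ 2).
  rewrite expD.
  have H1 := IH (rcons w c) (x * h); have H2 := IH (rcons w c) (- (x * h)).
  rewrite size_rcons in H1 H2; rewrite sqrrN in H2.
  have {}H1 := ler_wpM2l p0 (H1 ltac:(clear -wn; lia)).
  have p1' : 0 <= 1 - p by rewrite subr_ge0.
  have {}H2 := ler_wpM2l p1' (H2 ltac:(clear -wn; lia)).
  apply: (le_trans (lerD H1 H2)); apply: eq_ler; ring.
have nn c : 0 <= symm w (fun z => expR (x * h * z)) (fun s => D n (rcons w c) s).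
  rewrite /symm addr_ge0// mulr_ge0// ?subr_ge0//; apply: avg_ge0 => // s; exact: expR_ge0.
apply: (le_trans (ler_pM (nn _) (nn _) (B _) (B _))).
rewrite -expRD ler_expR [_ ^+ n.+1]exprS; set Q := _ ^+ n; apply: eq_ler; ring.
Qed.

Lemma avg_dmass_pow (q : nat) n w kap : (0 < q)%N -> ~~ odd q -> 0 < kap ->
  kap ^+ 2 = 2 * h ^+ 2 -> (size w + n < N)%N ->
  E (fun s => (D n w s / kap ^+ n) ^+ q) <= 2 * q%:R ^+ q * expR 8.
Proof.
move=> q0 qe k0 kE wn.
have kn0 : 0 < kap ^+ n by rewrite exprn_gt0.
have H s : (D n w s / kap ^+ n) ^+ q <=
  q%:R ^+ q * (expR ((kap ^+ n)^-1 * D n w s) + expR (- (kap ^+ n)^-1 * D n w s)).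
  rewrite [X in X ^+ q]mulrC mulNr; set y := _ * (_ - _).
  have -> : y ^+ q = `|y| ^+ q.
    by rewrite -normrX ger0_norm// exprn_even_ge0.
  apply: (le_trans (expr_le_exp (normr_ge0 _) q0)).
  apply: ler_wpM2l; first by rewrite exprn_ge0.
  have e1 := expR_ge0 y; have e2 := expR_ge0 (- y).
  by case: (ger0P y) => _; lra.
apply: (le_trans (ler_avg p01 _ _ H)).
rewrite avgZ avgD.
have H1 := avg_expR_dmass (kap ^+ n)^-1 wn.
have H2 := avg_expR_dmass (- (kap ^+ n)^-1) wn.
have E8 : 8 * (2 * h ^+ 2) ^+ n * (kap ^+ n)^-1 ^+ 2 = 8.
  rewrite -kE -exprM mulnC exprM exprVn -mulrA divff ?mulr1//.
  by rewrite expf_neq0// gt_eqF.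
rewrite sqrrN E8 in H2; rewrite E8 in H1.
rewrite [2 * _]mulrC -mulrA; apply: ler_wpM2l; first by rewrite exprn_ge0.
lra.
Qed.

End Estimates.

(** * Characteristic function of the mass and anti-concentration *)

Section CharFun.
Context {R : realType}.
Variables (h a m2 : R).
Hypotheses (ah : 2 * h * a = 1) (h_gt : 1 < 2 * h) (h_lt : 2 * h ^+ 2 < 1).
Hypotheses (m2_ge1 : 1 <= m2) (m2_rec : 2 * h ^+ 2 * m2 + 2^-1 <= m2).
Implicit Types (w v : word) (s : word -> bool) (x y xi : R).

Let h0 : 0 < h. Proof. by move: h_gt; lra. Qed.
Let h1 : h < 1. Proof. by move: h_lt; have := sqr_ge0 (h - 1); nra. Qed.
Let a0 : 0 < a.
Proof. by rewrite -(pmulr_rgt0 _ (_ : 0 < 2 * h)) ?ah ?ltr01//; move: h_gt; lra. Qed.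
Let a1 : a < 1. Proof. by move: a0 h_gt ah; nra. Qed.
Let a2 : a ^+ 2 < 1. Proof. by move: a0 a1; nra. Qed.

(** The mean of [cos (xi * Z)] and [sin (xi * Z)] for the mass [Z] at depth
    [n]. With [phi] the characteristic function the branching property reads
    [phi_{n+1}(xi) = (p phi_n(h xi) + (1 - p) conj(phi_n(h xi)))^2]: the random
    sign shrinks the imaginary part by the factor [a], and squaring comes from
    the two halves. *)
Fixpoint charf (n : nat) xi : R * R :=
  if n is n'.+1 then
    let u := charf n' (h * xi) in (u.1 ^+ 2 - a ^+ 2 * u.2 ^+ 2, 2 * a * u.1 * u.2)
  else (cos xi, sin xi).

Definition charf2 n xi := (charf n xi).1 ^+ 2 + (charf n xi).2 ^+ 2.

Lemma charf2S n xi : charf2 n.+1 xi =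
  ((charf n (h * xi)).1 ^+ 2 + a ^+ 2 * (charf n (h * xi)).2 ^+ 2) ^+ 2.
Proof. by rewrite /charf2 /=; ring. Qed.

Lemma charf2_ge0 n xi : 0 <= charf2 n xi.
Proof. by rewrite addr_ge0// sqr_ge0. Qed.

Lemma charf2S_le n xi : charf2 n.+1 xi <= charf2 n (h * xi) ^+ 2.
Proof.
rewrite charf2S; apply: lerXn2r; rewrite ?nnegrE ?charf2_ge0//.
  by rewrite addr_ge0 ?sqr_ge0// mulr_ge0 ?sqr_ge0.
by rewrite /charf2 lerD2l ler_piMl ?sqr_ge0// ltW.
Qed.

Lemma charf2_le1 n xi : charf2 n xi <= 1.
Proof.
elim: n xi => [|n IH] xi; first by rewrite /charf2 /= cos2Dsin2.
by apply: (le_trans (charf2S_le _ _)); rewrite exprn_ile1// charf2_ge0.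
Qed.

(** Up to this frequency the sine of [xi * Z] has a mean bounded below by
    a multiple of [xi], because [Z] has mean [1] and second moment [m2]. *)
Definition freq0 : R := (2 * m2)^-1.
Definition decay : R := (1 - a ^+ 2) * (h * freq0) ^+ 2 / 4 * h / freq0.
Definition conc_cst : R := 64 * freq0 / (1 - expR (- (decay * freq0 / 2))).

Let m0 : 0 < m2. Proof. exact: lt_le_trans ltr01 m2_ge1. Qed.
Let x0_gt0 : 0 < freq0. Proof. by rewrite invr_gt0 mulr_gt0. Qed.
Lemma decay_gt0 : 0 < decay.
Proof.
rewrite /decay divr_gt0// mulr_gt0// divr_gt0// mulr_gt0 ?subr_gt0//.
by rewrite exprn_gt0// mulr_gt0.
Qed.

(** In the fundamental range [h * freq0, freq0] the imaginary part of the
    characteristic function is bounded below, and its contraction by [a]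
    gives a definite loss of modulus. One application of the recursion
    squares the modulus and multiplies the frequency by [1 / h < 2], so that
    exponential decay propagates to all frequencies up to [freq0 / h ^ n]. *)
Lemma charf2_decay n xi : (forall k y, (k < n)%N -> 0 <= y ->
     y - y ^+ 2 * m2 <= (charf k y).2) ->
  (0 < n)%N -> freq0 <= xi -> h ^+ n * xi <= freq0 ->
  charf2 n xi <= expR (- (decay * xi)).
Proof.
elim: n xi => // n IH xi Hs _ x1 x2.
have [xs|xl] := leP (h * xi) freq0; last first.
  have n0 : (0 < n)%N.
    by case: n {IH Hs} x2 => //; rewrite expr1; move: xl => /lt_le_trans H /H; rewrite ltxx.
  apply: (le_trans (charf2S_le _ _)).
  have H : charf2 n (h * xi) <= expR (- (decay * (h * xi))).
    apply: IH => //; last 1 first.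
    - by rewrite mulrA -exprSr.
    - by move=> k y kn; apply: Hs; exact: ltnW.
    - exact: ltW.
  apply: (@le_trans _ _ (expR (- (decay * (h * xi))) ^+ 2)).
    by apply: lerXn2r; rewrite ?nnegrE ?charf2_ge0 ?expR_ge0.
  rewrite -expRM_natl ler_expR mulrN lerN2.
  have -> : 2%:R * (decay * (h * xi)) = decay * xi * (2 * h) by ring.
  rewrite ler_peMr ?ltW// mulr_gt0 ?decay_gt0//.
  exact: lt_le_trans x1.
have y1 : h * freq0 <= h * xi by rewrite ler_pM2l.
set y := h * xi in xs y1 *.
have hx0 : 0 < h * freq0 by rewrite mulr_gt0.
have y0 : 0 < y := lt_le_trans hx0 y1.
have sy : h * freq0 / 2 <= (charf n y).2.
  apply: (le_trans _ (Hs n y (ltnSn _) (ltW y0))).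
  have : y * m2 <= 2^-1.
    apply: (@le_trans _ _ (freq0 * m2)); first by rewrite ler_pM2r.
    by apply: eq_ler; rewrite /freq0; field; rewrite gt_eqF.
  nra.
rewrite charf2S -/y; set c := (charf n y).1; set sn := (charf n y).2 in sy *.
have Q1 : c ^+ 2 + sn ^+ 2 <= 1 := charf2_le1 n y.
have S2 : (h * freq0 / 2) ^+ 2 <= sn ^+ 2.
  by apply: lerXn2r; rewrite ?nnegrE// ?(le_trans _ sy)// divr_ge0// ltW.
set u := c ^+ 2 + _.
have u1 : u <= 1 - (1 - a ^+ 2) * (h * freq0 / 2) ^+ 2.
  have : (1 - a ^+ 2) * (h * freq0 / 2) ^+ 2 <= (1 - a ^+ 2) * sn ^+ 2.
    by apply: ler_wpM2l => //; rewrite subr_ge0 ltW.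
  rewrite /u; lra.
have u0 : 0 <= u by rewrite addr_ge0 ?sqr_ge0// mulr_ge0 ?sqr_ge0.
have pos : 0 <= (1 - a ^+ 2) * (h * freq0 / 2) ^+ 2.
  by rewrite mulr_ge0 ?sqr_ge0// subr_ge0 ltW.
have u1' : u <= 1 by lra.
apply: (@le_trans _ _ u); first by rewrite expr2 ler_piMl.
apply: (le_trans u1); apply: (le_trans (expR_ge1Dx _)); rewrite ler_expR lerN2.
have -> : (1 - a ^+ 2) * (h * freq0 / 2) ^+ 2 = decay * (freq0 / h).
  by rewrite /decay; field; rewrite !gt_eqF.
by rewrite ler_pM2l ?decay_gt0// ler_pdivlMr// mulrC.
Qed.

Section Avg.
Variables (l : seq word) (N : nat) (s0 : word -> bool).
Hypothesis lN : forall w, (size w <= N)%N -> w \in l.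
Local Notation p := (upprob a).
Local Notation E f := (avg p l f s0).
Local Notation Z n w s := (mass h (sg s) n w).

Let h_ge : 1 <= 2 * h. Proof. exact: ltW. Qed.
Let p01 := upprob01 ah h_ge.
Let pa : p - (1 - p) = a. Proof. by rewrite /upprob; field. Qed.

Lemma avg_charf n w xi : (size w + n <= N)%N ->
  E (fun s => cos (xi * Z n w s)) = (charf n xi).1 /\
  E (fun s => sin (xi * Z n w s)) = (charf n xi).2.
Proof.
elim: n w xi => [|n IH] w xi wn.
  split.
    by rewrite (@eq_avg _ _ _ _ _ (fun=> cos xi)) ?avg_cst// => s; rewrite mass0 mulr1.
  by rewrite (@eq_avg _ _ _ _ _ (fun=> sin xi)) ?avg_cst// => s; rewrite mass0 mulr1.
have wN : (size w < N)%N by clear -wn; lia.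
pose X c s := Z n (rcons w c) s.
have d c : depends (descendant (rcons w c)) (X c) by exact: mass_depends.
have IHc c : (size (rcons w c) + n <= N)%N by rewrite size_rcons; clear -wn; lia.
have Sc c : symm a l s0 w (fun x => cos (xi * h * x)) (X c) = (charf n (h * xi)).1.
  have [<- _] := IH (rcons w c) (h * xi) (IHc c).
  rewrite /symm (@eq_avg _ _ _ _ (fun s => cos (xi * h * - X c s)) (fun s => cos (xi * h * X c s))).
    by rewrite (mulrC xi h) -mulrDl [p + _]addrC subrK mul1r.
  by move=> s; rewrite mulrN cosN.
have Ss c : symm a l s0 w (fun x => sin (xi * h * x)) (X c) = a * (charf n (h * xi)).2.
  have [_ <-] := IH (rcons w c) (h * xi) (IHc c).
  rewrite /symm (@eq_avg _ _ _ _ (fun s => sin (xi * h * - X c s)) (fun s => -1 * sin (xi * h * X c s))).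
    rewrite avgZ (mulrC xi h) /X; set u := E _; rewrite -[X in _ = X * _]pa; ring.
  by move=> s; rewrite mulrN sinN mulN1r.
split.
  rewrite (@eq_avg _ _ _ _ _ (fun s =>
    cos (xi * h * (sg s (rcons w false) * X false s)) * cos (xi * h * (sg s (rcons w true) * X true s))
   - sin (xi * h * (sg s (rcons w false) * X false s)) * sin (xi * h * (sg s (rcons w true) * X true s)))).
    rewrite avgB.
    rewrite (@avg_branch _ a l N s0 lN w (fun x => cos (xi * h * x)) (fun x => cos (xi * h * x)) _ _ wN (d _) (d _)).
    rewrite (@avg_branch _ a l N s0 lN w (fun x => sin (xi * h * x)) (fun x => sin (xi * h * x)) _ _ wN (d _) (d _)).
    by rewrite !Sc !Ss /=; ring.
  by move=> s; rewrite massS -cosD; congr cos; rewrite /X; ring.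
rewrite (@eq_avg _ _ _ _ _ (fun s =>
    sin (xi * h * (sg s (rcons w false) * X false s)) * cos (xi * h * (sg s (rcons w true) * X true s))
   + cos (xi * h * (sg s (rcons w false) * X false s)) * sin (xi * h * (sg s (rcons w true) * X true s)))).
  rewrite avgD.
  rewrite (@avg_branch _ a l N s0 lN w (fun x => sin (xi * h * x)) (fun x => cos (xi * h * x)) _ _ wN (d _) (d _)).
  rewrite (@avg_branch _ a l N s0 lN w (fun x => cos (xi * h * x)) (fun x => sin (xi * h * x)) _ _ wN (d _) (d _)).
  by rewrite !Sc !Ss /=; ring.
by move=> s; rewrite massS -sinD; congr sin; rewrite /X; ring.
Qed.

Lemma charf_sin_ge n y : (n <= N)%N -> 0 <= y -> y - y ^+ 2 * m2 <= (charf n y).2.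
Proof.
move=> nN y0.
have sN : (size ([::] : word) + n <= N)%N by [].
have [_ <-] := avg_charf y sN.
have H s : y * Z n [::] s - y ^+ 2 * Z n [::] s ^+ 2 <= sin (y * Z n [::] s).
  rewrite -exprMn; have := sin_dist (y * Z n [::] s).
  by rewrite ler_norml => /andP[? _]; lra.
apply: (le_trans _ (ler_avg p01 _ _ H)).
rewrite avgB !avgZ (avg_mass s0 ah lN sN) mulr1 lerD2l lerN2.
by apply: ler_wpM2l; [exact: sqr_ge0|exact: (avg_mass2 s0 ah lN m2_ge1 m2_rec sN)].
Qed.

Variables (n : nat) (w : word) (D : pred word) (X Y : (word -> bool) -> R) (g r : R).
Hypotheses (n0 : (0 < n)%N) (wn : (size w + n <= N)%N)
  (dX : depends D X) (dY : depends D Y) (disj : forall i, ~~ (D i && descendant w i))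
  (Y1 : forall s, Y s = 1 \/ Y s = -1)
  (g0 : 0 < g) (r0 : 0 < r) (gr : g * h ^+ n <= freq0 * r).

(* An increment of the process: an independent remainder plus a random sign
   times a scaled mass. *)
Let W s := X s + Y s * (g * Z n w s).

Let th := expR (- (decay * freq0 / 2)).
Let th01 : 0 <= th < 1.
Proof.
rewrite expR_ge0 /= -expR0 ltr_expR oppr_lt0 divr_gt0// mulr_gt0//.
exact: decay_gt0.
Qed.

Let charf_le (m : nat) : (0 < m)%N -> m%:R * h ^+ n <= 1 ->
  `|(charf n (m%:R * freq0)).1| <= th ^+ m /\ `|(charf n (m%:R * freq0)).2| <= th ^+ m.
Proof.
move=> mp mh.
have xm : freq0 <= m%:R * freq0 by rewrite ler_peMl ?(ltW x0_gt0)// ler1n.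
have H : charf2 n (m%:R * freq0) <= expR (- (decay * (m%:R * freq0))).
  apply: charf2_decay => //.
    by move=> k y kn; apply: charf_sin_ge; clear -wn kn; lia.
  by rewrite mulrA ler_piMl ?(ltW x0_gt0)// mulrC.
have E2 : expR (- (decay * (m%:R * freq0))) = (th ^+ m) ^+ 2.
  by rewrite -exprM /th -expRM_natl natrM; congr expR; field.
have t0 : 0 <= th ^+ m by rewrite exprn_ge0// expR_ge0.
move: H; rewrite E2 /charf2; set c := _.1; set sn := _.2 => H.
split; rewrite -(@ler_pXn2r _ 2) ?nnegrE// real_normK ?num_real//.
  by have := sqr_ge0 sn; lra.
by have := sqr_ge0 c; lra.
Qed.

Let mu := freq0 / g.

Let avg_cosW (m : nat) : m%:R * h ^+ n <= 1 ->
  E (fun s => cos (m%:R * mu * W s)) <= 2 * th ^+ m.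
Proof.
case: m => [|m] mh.
  rewrite (@eq_avg _ _ _ _ _ (fun=> 1)) ?avg_cst ?expr0 ?mulr1//; first lra.
  by move=> s; rewrite !mul0r cos0.
have [c1 c2] := charf_le (ltn0Sn m) mh; move: c1 c2; set M := m.+1%:R; rewrite -/M.
have [<- <-] := avg_charf (M * freq0) wn => c1 c2.
pose XC s := cos (M * mu * X s); pose XS s := Y s * sin (M * mu * X s).
rewrite (@eq_avg _ _ _ _ _ (fun s => XC s * cos (M * freq0 * Z n w s) -
   XS s * sin (M * freq0 * Z n w s))); last first.
  move=> s; rewrite /W mulrDr cosD.
  have -> : M * mu * (Y s * (g * Z n w s)) = Y s * (M * freq0 * Z n w s).
    by rewrite /mu; field; rewrite gt_eqF.
  by rewrite /XC /XS; case: (Y1 s) => ->; rewrite ?(mul1r, mulN1r, cosN, sinN, mulNr, mulrN).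
have dC : depends D XC by exact: (depends_comp (fun x => cos (M * mu * x)) dX).
have dS : depends D XS by exact: (depends_comp2 (fun y x => y * sin (M * mu * x)) dY dX).
have dz := @mass_depends R h n w.
have dc := depends_comp (fun x => cos (M * freq0 * x)) dz.
have ds := depends_comp (fun x => sin (M * freq0 * x)) dz.
rewrite avgB (avgM _ _ _ dC dc disj) (avgM _ _ _ dS ds disj).
have nC : `|E XC| <= 1.
  apply: (le_trans (ler_norm_avg p01 _ _ _)).
  rewrite -[X in _ <= X](avg_cst p l 1 s0); apply: (ler_avg p01) => s; exact: cos_max.
have nS : `|E XS| <= 1.
  apply: (le_trans (ler_norm_avg p01 _ _ _)).
  rewrite -[X in _ <= X](avg_cst p l 1 s0); apply: (ler_avg p01) => s.
  by rewrite /XS; case: (Y1 s) => ->; rewrite ?mul1r ?mulN1r ?normrN sin_max.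
apply: (le_trans (ler_norm _)); apply: (le_trans (ler_normB _ _)).
rewrite !normrM mulr_natl mulr2n.
by apply: lerD; [apply: (le_trans _ c1)|apply: (le_trans _ c2)]; rewrite ler_piMl.
Qed.

(** Anti-concentration by a discrete Fejer kernel. If [|W| <= r] then the [J]
    phases [j * mu * W] are all within [1/2] of [0], so that
    [|sum_j exp(i j mu W)|^2 >= (J / 2)^2]; but the average of the left side is
    at most a constant times [J], as the off-diagonal terms decay geometrically
    by [charf2_decay]. The admissible [J] is of order [g / r]. *)
Lemma concentration : E (fun s => ((`|W s| <= r)%R)%:R) <= conc_cst * r / g.
Proof.
have [t0 t1] := andP th01.
have it : 1 <= (1 - th)^-1 by rewrite invf_ge1 ?subr_gt0//; lra.
pose q := g / (2 * freq0 * r).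
have q0 : 0 < q by rewrite divr_gt0// !mulr_gt0.
pose J := Num.truncn q.
have /andP[Jq qJ] := truncn_itv (ltW q0).
rewrite -/J in Jq qJ.
have Cq : conc_cst * r / g = 32 / (1 - th) / q.
  rewrite /conc_cst -/th /q; field; rewrite !gt_eqF ?subr_gt0//.
rewrite Cq.
have P1 : E (fun s => ((`|W s| <= r)%R)%:R) <= 1.
  rewrite -[X in _ <= X](avg_cst p l 1 s0); apply: (ler_avg p01) => s.
  by case: (`|W s| <= r) => /=; rewrite ?ler01.
(* If g / r is below a constant, the right side exceeds the trivial bound 1. *)
have [J0|Jp] := posnP J.
  apply: (le_trans P1); rewrite ler_pdivlMr// mul1r.
  move: qJ; rewrite J0; lra.
have Jge1 : 1 <= J%:R :> R by rewrite ler1n.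
pose F s := \sum_(0 <= j < J) \sum_(0 <= k < J) cos ((j - k + (k - j))%:R * mu * W s).
(* F is the square of the modulus of the sum of the J phases. *)
have FE s : F s = (\sum_(0 <= j < J) cos (j%:R * mu * W s)) ^+ 2 +
                  (\sum_(0 <= j < J) sin (j%:R * mu * W s)) ^+ 2.
  rewrite !expr2 !big_distrlr /= -big_split /=; apply: eq_bigr => j _.
  rewrite -big_split /=; apply: eq_bigr => k _; rewrite -cosB.
  have [jk|kj] := leqP j k.
    rewrite (eqP jk) add0n natrB// -cosN; congr cos; ring.
  rewrite (eqP (ltnW kj)) addn0 natrB 1?ltnW//; congr cos; ring.
have mh (m : nat) : (m < J)%N -> m%:R * h ^+ n <= 1.
  move=> mJ; apply: (@le_trans _ _ (q * h ^+ n)).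
    rewrite ler_pM2r ?exprn_gt0//; apply: le_trans Jq; by rewrite ler_nat ltnW.
  rewrite /q mulrAC ler_pdivrMr ?mul1r ?mulr_gt0//.
  have : 0 < freq0 * r by rewrite mulr_gt0.
  by move: gr; lra.
have F1 : E F <= J%:R * (2 * (2 / (1 - th))).
  rewrite /F avg_sum.
  have -> : J%:R * (2 * (2 / (1 - th))) = \sum_(0 <= j < J) (2 * (2 / (1 - th))).
    by rewrite sumr_const_nat subn0 mulr_natl.
  rewrite big_nat [X in _ <= X]big_nat; apply: ler_sum => j /andP[_ jJ].
  rewrite avg_sum.
  apply: (@le_trans _ _ (\sum_(0 <= k < J) 2 * th ^+ (j - k + (k - j)))).
    rewrite big_nat [X in _ <= X]big_nat; apply: ler_sum => k /andP[_ kJ].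
    by apply: avg_cosW; apply: mh; clear -jJ kJ; lia.
  by rewrite -mulr_sumr ler_pM2l//; exact: sum_geom2_le.
have F2 s : (J%:R / 2) ^+ 2 * ((`|W s| <= r)%R)%:R <= F s.
  rewrite FE; case: (leP `|W s| r) => Wr; last by rewrite mulr0 addr_ge0// sqr_ge0.
  rewrite mulr1 -[X in X <= _]addr0; apply: lerD; last exact: sqr_ge0.
  have H : J%:R / 2 <= \sum_(0 <= j < J) cos (j%:R * mu * W s).
    have -> : J%:R / 2 = \sum_(0 <= j < J) 2^-1 :> R.
      by rewrite sumr_const_nat subn0 mulr_natl.
    rewrite big_nat [X in _ <= X]big_nat; apply: ler_sum => j /andP[_ jJ].
    apply: (le_trans _ (cos_ge1B _)).
    have mu0 : 0 <= j%:R * mu by rewrite mulr_ge0// /mu divr_ge0// ltW.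
    rewrite normrM (ger0_norm mu0).
    have : j%:R * mu * `|W s| <= q * mu * r.
      apply: ler_pM => //.
      apply: ler_wpM2r; first by rewrite /mu divr_ge0// ltW.
      by apply: le_trans Jq; rewrite ler_nat ltnW.
    have -> : q * mu * r = 2^-1 by rewrite /q /mu; field; rewrite !gt_eqF.
    lra.
  by apply: lerXn2r; rewrite ?nnegrE ?divr_ge0// (le_trans _ H)// divr_ge0.
have := le_trans (ler_avg p01 l s0 F2) F1; rewrite avgZ.
set P := E _ => H.
have J0 : 0 < J%:R :> R by rewrite ltr0n.
have {}H : P * J%:R <= 16 / (1 - th).
  rewrite -(ler_pM2l (_ : 0 < J%:R / 4)) ?divr_gt0//.
  apply: le_trans (le_trans H _); apply: eq_ler; first by field.
  by field; rewrite gt_eqF// subr_gt0.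
rewrite ler_pdivlMr//.
have P0 : 0 <= P by apply: (avg_ge0 p01) => s; exact: ler0n.
have : P * q <= P * (2 * J%:R).
  by apply: ler_wpM2l => //; rewrite -natr1 in qJ; lra.
lra.
Qed.

End Avg.
End CharFun.

(** * From finite averages to the probability space *)

Section Tree.
Definition level (k : nat) : seq word := map val (enum {: k.-tuple bool}).
(** The signs on which the process at depth [N] depends. *)
Definition tree (N : nat) : seq word := flatten [seq level k | k <- iota 0 N.+1].

Lemma mem_tree N w : (w \in tree N) = (size w <= N)%N.
Proof.
apply/flattenP/idP => [[s /mapP[k]]|wN].
  rewrite mem_iota add0n ltnS => /andP[_ kN] -> /mapP[t _ ->].
  by rewrite size_tuple.
exists (level (size w)).
  by apply/mapP; exists (size w); rewrite // mem_iota add0n ltnS.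
by apply/mapP; exists (in_tuple w); rewrite // mem_enum.
Qed.
End Tree.

Section Bridge.
Context {R : realType} {d : measure_display} {Omega : measurableType d}.
Variables (P : probability Omega R) (p : R) (eps : word -> {RV P >-> R}).
Hypotheses (p01 : 0 <= p <= 1)
  (eps_val : forall w omega, eps w omega = 1 \/ eps w omega = -1)
  (eps_pos : forall w, P [set omega | eps w omega = 1] = p%:E)
  (eps_neg : forall w, P [set omega | eps w omega = -1] = (1 - p)%:E)
  (eps_indep : mutually_independent eps).
Implicit Types (f : (word -> bool) -> R) (r l : seq word) (tau : word -> bool).

(** The signs as booleans, so that the averages above apply to a sample. *)
Definition conf (omega : Omega) : word -> bool := fun w => eps w omega == 1.

Lemma sg_conf omega w : sg (conf omega) w = eps w omega :> R.
Proof.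
rewrite /sg /sgn /conf; case: eqP => [->//|H].
by case: (eps_val w omega).
Qed.

Lemma conf_sgn omega w c : (conf omega w = c) <-> eps w omega = sgn c.
Proof.
rewrite -sg_conf /sg; split=> [->//|].
by case: (conf omega w); case: c => //=; rewrite /sgn => H; exfalso; lra.
Qed.

Definition cyl r tau : set Omega := [set omega | forall i, i \in r -> conf omega i = tau i].

Lemma cylE r tau : cyl r tau = \bigcap_(i in [set` r]) (eps i @^-1` [set sgn (tau i)]).
Proof.
apply/seteqP; split => omega H i /= ir; first exact/conf_sgn/H.
exact/conf_sgn/(H i ir).
Qed.

Lemma cyl_measurable r tau : measurable (cyl r tau).
Proof.
by rewrite cylE; apply: fin_bigcap_measurable => // i _.
Qed.

Definition prob_sign (c : bool) : R := if c then p else 1 - p.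

Lemma cyl_prob r tau : uniq r -> P (cyl r tau) = (\prod_(i <- r) prob_sign (tau i))%:E.
Proof.
move=> ur.
have H := eps_indep (A := fun i => [set sgn (tau i)]) ur (fun i => measurable_set1 _).
rewrite cylE H.
rewrite -prodEFin; apply: eq_bigr => i _; rewrite /prob_sign /sgn.
by case: (tau i); [rewrite -(eps_pos i)|rewrite -(eps_neg i)].
Qed.

Lemma cyl_cons i r tau : i \notin r ->
  cyl r tau = cyl (i :: r) (upd tau i true) `|` cyl (i :: r) (upd tau i false).
Proof.
move=> ir; apply/seteqP; split => omega H /=.
  have K c : conf omega i = c -> cyl (i :: r) (upd tau i c) omega.
    move=> ic j; rewrite inE /upd; case: eqP => [->//|_] /= jr; exact: H.
  by case E : (conf omega i); [left|right]; exact: K.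
have K c : cyl (i :: r) (upd tau i c) omega -> cyl r tau omega.
  move=> {}H j jr; have := H j; rewrite inE jr orbT => /(_ isT) ->.
  by rewrite /upd; case: eqP => // ji; rewrite -ji jr in ir.
by case: H; exact: K.
Qed.

Lemma cyl_disj i r tau :
  [disjoint cyl (i :: r) (upd tau i true) & cyl (i :: r) (upd tau i false)].
Proof.
apply/disj_setPS => omega [/(_ i) + /(_ i)]; rewrite !inE eqxx => /(_ isT) -> /(_ isT).
by rewrite /upd eqxx.
Qed.

(** Measurability and the integral are obtained together, by conditioning on one
    more coordinate at each step until the function is constant on the
    cylinder; [avg] follows the same recursion. *)
Lemma cylinder_integral l r tau f : uniq (l ++ r) -> depends (mem (l ++ r)) f ->
  measurable_fun (cyl r tau) (f \o conf) /\
  ((forall s, 0 <= f s) ->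
   (\int[P]_(omega in cyl r tau) (f (conf omega))%:E =
    (avg p l f tau * \prod_(i <- r) prob_sign (tau i))%:E)%E).
Proof.
elim: l r tau => [|i l IH] r tau u df.
  have C omega : cyl r tau omega -> f (conf omega) = f tau by exact: df.
  split.
    apply: (eq_measurable_fun (cst (f tau))) => // omega; rewrite inE => H.
    by rewrite /= C.
  move=> f0; rewrite (eq_integral (cst (f tau)%:E)); last first.
    by move=> omega; rewrite inE => H; rewrite /= C.
  transitivity ((f tau)%:E * P (cyl r tau))%E.
    exact: (integral_cst _ (cyl_measurable _ _)).
  by rewrite cyl_prob// EFinM.
have ir : i \notin r.
  by move: u; rewrite /= mem_cat negb_or => /andP[/andP[]].
have u' : uniq (l ++ i :: r).
  by move: u; rewrite -[(i :: l) ++ r]/([:: i] ++ l ++ r) uniq_catCA.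
have df' : depends (mem (l ++ i :: r)) f.
  by apply: dependsW df => j; rewrite !(mem_cat, inE) => /orP[/orP[|]|] ->; rewrite ?orbT.
have [m1 i1] := IH (i :: r) (upd tau i true) u' df'.
have [m0 i0] := IH (i :: r) (upd tau i false) u' df'.
have mU : measurable_fun (cyl r tau) (f \o conf).
  rewrite (cyl_cons _ ir); by apply/measurable_funU; [exact: cyl_measurable|exact: cyl_measurable|split].
split=> // f0; rewrite (cyl_cons _ ir) ge0_integral_setU//=.
- rewrite i1// i0// !big_cons -EFinD; congr EFin.
  have E c : \prod_(j <- r) prob_sign (upd tau i c j) = \prod_(j <- r) prob_sign (tau j).
    apply: eq_big_seq => j jr; rewrite /upd; case: eqP => // ji; by rewrite -ji jr in ir.
  by rewrite !E /upd eqxx /prob_sign; ring.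
- exact: cyl_measurable.
- exact: cyl_measurable.
- by rewrite -(cyl_cons _ ir); exact/measurable_EFinP.
- by move=> x _; rewrite lee_fin.
- exact: cyl_disj.
Qed.

Lemma cyl_nil tau : cyl [::] tau = setT.
Proof. by apply/seteqP; split. Qed.

Lemma conf_measurable l f : depends (mem l) f -> measurable_fun setT (f \o conf).
Proof.
move=> df; rewrite -(cyl_nil (fun=> true)).
have [] := @cylinder_integral (undup l) [::] (fun=> true) f => //.
  by rewrite cats0 undup_uniq.
by rewrite cats0; apply: dependsW df => j; rewrite /= -!topredE /= mem_undup.
Qed.

Lemma integral_conf l f s0 : depends (mem l) f -> (forall s, 0 <= f s) ->
  (\int[P]_omega (f (conf omega))%:E = (avg p (undup l) f s0)%:E)%E.
Proof.
move=> df f0; rewrite -(cyl_nil s0).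
have [||_ ->//] := @cylinder_integral (undup l) [::] s0 f.
- by rewrite cats0 undup_uniq.
- by rewrite cats0; apply: dependsW df => j; rewrite /= -!topredE /= mem_undup.
- by rewrite big_nil mulr1.
Qed.

Lemma integral_conf_series (Y : nat -> (word -> bool) -> R) (l : nat -> seq word) s0 (C q : R) :
  (forall n s, 0 <= Y n s) -> (forall n, depends (mem (l n)) (Y n)) ->
  0 <= q < 1 -> 0 <= C ->
  (forall n, avg p (undup (l n)) (Y n) s0 <= C * q ^+ n) ->
  (\int[P]_omega (\sum_(0 <= i <oo) (Y i (conf omega))%:E) <= (C / (1 - q))%:E)%E.
Proof.
move=> Y0 dY q01 C0 H.
rewrite integral_nneseries//; last 2 first.
- by move=> n; apply/measurable_EFinP; exact: (conf_measurable (dY n)).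
- by move=> n omega _; rewrite lee_fin.
apply: lime_le.
  by apply: is_cvg_nneseries => n _ _; apply: integral_ge0 => omega _; rewrite lee_fin.
apply: nearW => n.
rewrite (eq_bigr (fun i => (avg p (undup (l i)) (Y i) s0)%:E)); last first.
  by move=> i _; exact: integral_conf.
rewrite sumEFin lee_fin; apply: (@le_trans _ _ (\sum_(0 <= i < n) C * q ^+ i)).
  by apply: ler_sum => i _.
by rewrite -mulr_sumr; apply: ler_wpM2l => //; exact: sum_geom_le.
Qed.

(** The form of the Borel-Cantelli lemma used below: a series of nonnegative
    variables with geometrically decaying means is almost surely finite. *)
Lemma ae_bounded_series (Y : nat -> (word -> bool) -> R) (l : nat -> seq word) s0 (C q : R) :
  (forall n s, 0 <= Y n s) -> (forall n, depends (mem (l n)) (Y n)) ->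
  0 <= q < 1 -> 0 <= C ->
  (forall n, avg p (undup (l n)) (Y n) s0 <= C * q ^+ n) ->
  {ae P, forall omega, exists K : R, forall n, \sum_(0 <= i < n) Y i (conf omega) <= K}.
Proof.
move=> Y0 dY q01 C0 H.
have I := integral_conf_series Y0 dY q01 C0 H.
set S := fun omega => (\sum_(0 <= i <oo) (Y i (conf omega))%:E)%E in I.
have S0 omega : (0 <= S omega)%E.
  by apply: nneseries_ge0 => n _ _; rewrite lee_fin.
have mS : measurable_fun setT S.
  apply: ge0_emeasurable_sum => n; first by move=> omega _ _; rewrite lee_fin.
  by move=> _; apply/measurable_EFinP; exact: (conf_measurable (dY n)).
have iS : P.-integrable setT S.
  apply/integrableP; split => //.
  under eq_integral do rewrite gee0_abs//.
  exact: le_lt_trans I (ltry _).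
have := integrable_ae measurableT iS; apply: filterS => omega /(_ Logic.I) Sf.
exists (fine (S omega)) => n; rewrite -lee_fin fineK// -sumEFin.
by apply: nneseries_lim_ge => i _ _; rewrite lee_fin.
Qed.

End Bridge.

(** * The integral defining the process *)

Section Density.
Context {R : realType}.
Variable (e : word -> R).
Implicit Types (w : word) (t u x : R).
Local Notation mu := (@lebesgue_measure R).

(** The integrand of [B_n(w)] on [0, 1), as a recursion on the first binary
    digit. The half-open interval makes the two branches disjoint. *)
Fixpoint dens (n : nat) w u : R :=
  if n is n'.+1 then
    2 * (e (rcons w false) * dens n' (rcons w false) (dyadV false u) +
         e (rcons w true) * dens n' (rcons w true) (dyadV true u))
  else \1_(`[0, 1[%classic) u.

Lemma dens_out n w u : u \notin `[0, 1[ -> dens n w u = 0.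
Proof.
elim: n w u => [|n IH] w u; first by rewrite /= indicE mem_setE => /negbTE ->.
rewrite in_itv /= => H; rewrite !IH ?mulr0 ?addr0 ?mulr0//;
  apply: contra H; rewrite in_itv /= /dyadV /= => /andP[? ?]; apply/andP; split; lra.
Qed.

Lemma bdigitS b u k : 0 <= dyadV b u -> (0 < k)%N ->
  bdigit u k.+1 = bdigit (dyadV b u) k.
Proof.
move=> x0 k0; rewrite /bdigit.
have -> : 2 ^+ k.+1 * u = 2 ^+ k * dyadV b u + (2 ^ k * b)%:R.
  by rewrite /dyadV natrM natrX exprS; ring.
set y := 2 ^+ k * _; have y0 : 0 <= y by rewrite mulr_ge0// exprn_ge0.
have -> : Num.truncn (y + (2 ^ k * b)%:R) = (Num.truncn y + 2 ^ k * b)%N.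
  by apply: truncn_def; rewrite -addSn !natrD lerD2r ltrD2r; exact: truncn_itv.
by rewrite oddD oddM oddX eqn0Ngt k0 /= addbF.
Qed.

Lemma bprefixS b u n : 0 <= dyadV b u < 1 ->
  bprefix u n.+1 = b :: bprefix (dyadV b u) n.
Proof.
move=> /andP[x0 x1]; rewrite /bprefix /= -[2%N]/(1 + 1)%N iotaDl -map_comp.
congr (_ :: _).
  rewrite /bdigit expr1 (truncn_def (n := b)); first by case: b {x0 x1}.
  by move: x0 x1; rewrite /dyadV -natr1 => ? ?; apply/andP; split; lra.
apply/eq_in_map => k; rewrite mem_iota => /andP[k0 _] /=.
by rewrite add1n (@bdigitS b).
Qed.

Lemma dens_prefix n w u : 0 <= u < 1 ->
  dens n w u = 2 ^+ n * \prod_(1 <= k < n.+1) e (w ++ bprefix u k).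
Proof.
elim: n w u => [|n IH] w u u01.
  rewrite /= big_geq// expr0 mulr1 indicE mem_setE.
  by rewrite in_itv /= u01.
have [b ub] : exists b, 0 <= dyadV b u < 1.
  have [u2|u2] := ltP u 2^-1; [exists false|exists true]; rewrite /dyadV /=;
    by case/andP: u01 => ? ?; apply/andP; split; lra.
have H c : c != b -> dens n (rcons w c) (dyadV c u) = 0.
  move=> cb; apply: dens_out; rewrite in_itv /=.
  move: ub; apply: contraL; case: c b cb => -[]// _; rewrite /dyadV /= => /andP[? ?];
    by apply/negP => /andP[? ?]; lra.
have -> : dens n.+1 w u = 2 * (e (rcons w b) * dens n (rcons w b) (dyadV b u)).
  rewrite /=; case: b ub H => ub H.
    by rewrite (H false)// mulr0 add0r.
  by rewrite (H true)// mulr0 addr0.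
rewrite IH// [in RHS]big_nat_recl// exprS.
have -> : bprefix u 1 = [:: b] by rewrite (bprefixS _ ub).
have -> : \prod_(1 <= k < n.+1) e (w ++ bprefix u k.+1) =
   \prod_(1 <= k < n.+1) e (rcons w b ++ bprefix (dyadV b u) k).
  by apply: eq_big_nat => k _; rewrite (bprefixS _ ub) cat_rcons.
rewrite cats1; ring.
Qed.

(** The primitive of [dens]; the powers of [2] cancel against the change of
    variable at each step. *)
Fixpoint prim (n : nat) w t : R :=
  if n is n'.+1 then
    e (rcons w false) * prim n' (rcons w false) (dyadV false t) +
    e (rcons w true) * prim n' (rcons w true) (dyadV true t)
  else Num.max 0 (Num.min t 1).

Lemma casc_prim h n w t : casc h e n w t = h ^+ n * prim n w t.
Proof.
elim: n w t => [|n IH] w t; first by rewrite expr0 mul1r.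
by rewrite cascS !IH exprS /=; ring.
Qed.

(** The affine arguments [2 ^+ k * u - l] are exactly those produced by the
    recursion, so the induction needs only linearity of the integral and the
    length of a dyadic interval cut at [t]; no change of variable occurs. *)
Lemma dens_integral n w (k l : nat) t : 0 <= t ->
  mu.-integrable `[0, t[ (EFin \o (fun u => dens n w (2 ^+ k * u - l%:R))) /\
  (\int[mu]_(u in `[0, t[) (dens n w (2 ^+ k * u - l%:R))) =
  2 ^- k * prim n w (2 ^+ k * t - l%:R) :> R.
Proof.
move=> t0; elim: n w k l => [|n IH] w k l.
  have p0 : 0 < 2 ^+ k :> R by rewrite exprn_gt0.
  pose a : R := l%:R / 2 ^+ k; pose b : R := l.+1%:R / 2 ^+ k.
  have E u : dens 0 w (2 ^+ k * u - l%:R) = \1_(`[a, b[%classic) u.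
    rewrite /= !indicE !mem_setE !in_itv /= /a /b ler_pdivrMr// ltr_pdivlMr//.
    by rewrite subr_ge0 ltrBlDr (mulrC u) nat1r.
  have mA : measurable (`[0, t[ `&` `[a, b[ : set R)%classic by exact: measurableI.
  pose D : set R := `[0, t[%classic.
  have fA : (mu D < +oo)%E.
    by rewrite /D lebesgue_measure_itv /=; case: ifP => _; rewrite -?EFinB ltry.
  have mD : measurable D by exact: measurable_itv.
  split.
    refine (@eq_integrable _ _ _ mu D mD (EFin \o \1_(`[a, b[%classic)) _ _ _).
      by move=> u _ /=; rewrite -E.
    apply/integrableP; split; first exact/measurable_EFinP/measurable_indic.
    apply: (@le_lt_trans _ _ (mu (`[a, b[%classic `&` D))).
      rewrite -integral_indic//; rewrite le_eqVlt; apply/orP; left; apply/eqP; apply: eq_integral => u _ /=.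
      by rewrite ger0_norm.
    apply: le_lt_trans fA; apply: le_measure; rewrite ?inE//.
    exact: measurableI.
  rewrite (@eq_Rintegral _ _ _ mu D (\1_(`[a, b[%classic))); last by move=> u _; exact: E.
  rewrite /Rintegral integral_indic//
  setIC.
  have a0 : 0 <= a by rewrite divr_ge0// ltW.
  have ab : b = a + 2 ^- k by rewrite /b /a -natr1 mulrDl mul1r.
  pose b' : R := Num.min b t.
  have -> : (D `&` `[a, b[%classic : set R) = (`[a, b'[%classic : set R).
    apply/seteqP; split=> u /=; rewrite /D /b' /= !in_itv /= lt_min.
      by move=> [/andP[? ->] /andP[-> ->]].
    by move=> /andP[au /andP[-> ->]]; rewrite au (le_trans a0 au).
  transitivity (fine (mu (`[a, b'[%classic : set R))); first by [].
  rewrite lebesgue_measure_itv /= lte_fin /b'.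
  have i0 : 0 < (2 ^+ k)^-1 :> R by rewrite invr_gt0.
  have Et : 2 ^+ k * t - l%:R = 2 ^+ k * (t - a) by rewrite mulrBr /a mulrCA divff ?gt_eqF// mulr1.
  rewrite Et; set x := t - a.
  have -> : Num.min (2 ^+ k * x) 1 = 2 ^+ k * Num.min x (2 ^- k).
    by rewrite minr_pMr ?(ltW p0)// divff// gt_eqF.
  have -> : Num.max 0 (2 ^+ k * Num.min x (2 ^- k)) = 2 ^+ k * Num.max 0 (Num.min x (2 ^- k)).
    by rewrite maxr_pMr ?(ltW p0)// mulr0.
  rewrite mulKf ?gt_eqF// ab /x.
  have -> : Num.min (a + 2 ^- k) t = a + Num.min (t - a) (2 ^- k).
    by rewrite addr_minr [a + (t - a)]addrC subrK minC.
  set m := Num.min (t - a) _; rewrite ltrDl.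
  case: ltP => m0 /=; first by rewrite addrC addKr.
  by [].
have H c := IH (rcons w c) k.+1 (l.*2 + c)%N.
have Ed c u : dyadV c (2 ^+ k * u - l%:R) = 2 ^+ k.+1 * u - (l.*2 + c)%:R.
  by rewrite /dyadV natrD -muln2 natrM exprS; ring.
have E u : dens n.+1 w (2 ^+ k * u - l%:R) =
   2 * (e (rcons w false) * dens n (rcons w false) (2 ^+ k.+1 * u - (l.*2 + false)%:R) +
        e (rcons w true) * dens n (rcons w true) (2 ^+ k.+1 * u - (l.*2 + true)%:R)).
  by rewrite /= !Ed.
pose D : set R := `[0, t[%classic.
have mD : measurable D by exact: measurable_itv.
have [i0 v0] := H false; have [i1 v1] := H true.
have j0 := @integrableZl _ _ _ mu D mD (e (rcons w false)) _ i0.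
have j1 := @integrableZl _ _ _ mu D mD (e (rcons w true)) _ i1.
have j := @integrableD _ _ _ mu D mD _ _ j0 j1.
split.
  refine (@eq_integrable _ _ _ mu D mD _ _ _ (@integrableZl _ _ _ mu D mD 2 _ j)).
  by move=> u _ /=; rewrite !Ed !(EFinM, EFinD).
rewrite (@eq_Rintegral _ _ _ mu D _ _ (fun u _ => E u)).
rewrite (@RintegralZl _ _ _ mu D _ 2 mD j) (@RintegralD _ _ _ mu D _ _ mD j0 j1).
rewrite (@RintegralZl _ _ _ mu D _ (e (rcons w false)) mD i0).
rewrite (@RintegralZl _ _ _ mu D _ (e (rcons w true)) mD i1) v0 v1 /= !Ed exprS invfM.
by field; rewrite expf_neq0.
Qed.

End Density.

Lemma Bn_casc (R : realType) (Omega : Type) (H : R) (eps : word -> Omega -> R) n w omega t :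
  t \in `[0, 1] ->
  Bn H eps n w omega t = casc (2 `^ (- H)) (fun v => eps v omega) n w t.
Proof.
rewrite in_itv /= => /andP[t0 t1]; rewrite /Bn.
have -> : 2 `^ (- (n%:R * H)) = 2 `^ (- H) ^+ n.
  by rewrite -powR_mulrn ?powR_ge0// -powRrM mulNr [H * _]mulrC.
rewrite casc_prim; congr (_ * _).
have E u : 2 ^+ 0 * u - 0%:R = u :> R by rewrite expr0 mul1r mulr0n subr0.
pose D : set R := `[0, t[%classic.
have mD : measurable D by exact: measurable_itv.
have Ed u : u \in D -> dens (fun v => eps v omega) n w (2 ^+ 0 * u - 0%:R) =
   2 ^+ n * \prod_(1 <= k < n.+1) eps (w ++ bprefix u k) omega.
  rewrite inE /D /= in_itv /= => /andP[u0 u1].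
  by rewrite E dens_prefix// u0 (lt_le_trans u1 t1).
have [I V] := dens_integral (fun v => eps v omega) n w 0 0 t0.
have I' : (@lebesgue_measure R).-integrable D
   (EFin \o (fun u => 2 ^+ n * \prod_(1 <= k < n.+1) eps (w ++ bprefix u k) omega)).
  refine (@eq_integrable _ _ _ (@lebesgue_measure R) D mD _ _ _ I) => u uD /=.
  by rewrite Ed.
rewrite E expr0 invr1 mul1r in V; rewrite -V -(Rintegral_itv_bndo_bndc I').
by apply: eq_Rintegral => u uD; rewrite Ed.
Qed.

(** * Logarithmic ratios and the pointwise exponent *)

Section LogRatios.
Context {R : realType}.
Implicit Types (x y c : R).
Local Open Scope ereal_scope.

Lemma lne_ratio_ge x y c : (0 < x < 1)%R -> (0 <= y)%R -> (y <= x `^ c)%R ->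
  c%:E <= lne y%:E / lne x%:E.
Proof.
move=> /andP[x0 x1] y0 yx.
have lx : (ln x < 0)%R by rewrite ln_lt0// x0.
rewrite (lne_EFin x0) inver lt_eqF// lee_ndivlMr// -EFinM.
move: y0; rewrite le_eqVlt => /predU1P[<-|y0]; first by rewrite le0_lneNy// leNye.
by rewrite lne_EFin// lee_fin -ln_powR ler_ln ?posrE// powR_gt0.
Qed.

Lemma lne_ratio_le x y c : (0 < x < 1)%R -> (x `^ c <= y)%R ->
  lne y%:E / lne x%:E <= c%:E.
Proof.
move=> /andP[x0 x1] yx.
have lx : (ln x < 0)%R by rewrite ln_lt0// x0.
have xc : (0 < x `^ c)%R by rewrite powR_gt0.
rewrite (lne_EFin x0) inver lt_eqF// lee_ndivrMr// -EFinM.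
by rewrite lne_EFin ?(lt_le_trans xc yx)// lee_fin -ln_powR ler_ln ?posrE// (lt_le_trans xc yx).
Qed.

Lemma lne_inv_ratio_ge x (y : \bar R) c : (0 < x < 1)%R -> (x `^ (- c))%:E <= y ->
  c%:E <= lne y / lne (x^-1)%:E.
Proof.
move=> /andP[x0 x1] yx.
have xi : (0 < x^-1)%R by rewrite invr_gt0.
have lx : (0 < ln x^-1)%R by rewrite ln_gt0// invf_gt1.
have xc : (0 < x `^ (-c))%R by rewrite powR_gt0.
rewrite (lne_EFin xi) inver gt_eqF// lee_pdivlMr// -EFinM.
have -> : (c * ln x^-1)%:E = lne (x `^ (- c))%:E.
  by rewrite lne_EFin// ln_powR lnV ?posrE// mulrN mulNr.
rewrite lee_lne//.
  by rewrite in_itv /= lee_fin ltW// leey.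
by rewrite in_itv /= leey (le_trans _ yx)// lee_fin ltW.
Qed.

Lemma lne_inv_ratio_le x (y : \bar R) c : (0 < x < 1)%R -> 0 <= y -> y <= (x `^ (- c))%:E ->
  lne y / lne (x^-1)%:E <= c%:E.
Proof.
move=> /andP[x0 x1] y0 yx.
have xi : (0 < x^-1)%R by rewrite invr_gt0.
have lx : (0 < ln x^-1)%R by rewrite ln_gt0// invf_gt1.
have xc : (0 < x `^ (-c))%R by rewrite powR_gt0.
rewrite (lne_EFin xi) inver gt_eqF// lee_pdivrMr// -EFinM.
have -> : (c * ln x^-1)%:E = lne (x `^ (- c))%:E.
  by rewrite lne_EFin// ln_powR lnV ?posrE// mulrN mulNr.
rewrite lee_lne//.
  by rewrite in_itv /= leey y0.
by rewrite in_itv /= lee_fin ltW// leey.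
Qed.

End LogRatios.

Section LimInf.
Context {T : choiceType} {X : filteredType T} {R : realType}.
Local Open Scope ereal_scope.

Lemma limf_einf_ge (F : set_system X) (g : X -> \bar R) (c : \bar R) :
  F [set x | c <= g x] -> c <= limf_einf g F.
Proof.
move=> Fc; rewrite limf_einfE; apply: le_ereal_sup_tmp.
exists (ereal_inf (g @` [set x | c <= g x])); first by exists [set x | c <= g x].
by apply: le_ereal_inf_tmp => _ [x ? <-].
Qed.

Lemma limf_einf_le (F : set_system X) (g : X -> \bar R) (c : \bar R) :
  (forall V, F V -> exists2 x, V x & g x <= c) -> limf_einf g F <= c.
Proof.
move=> H; rewrite limf_einfE; apply: ge_ereal_sup => _ [V FV <-].
have [x Vx gx] := H V FV.
by apply: le_trans gx; apply: ereal_inf_lbound; exists x.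
Qed.

Lemma limf_esup_le (F : set_system X) (g : X -> \bar R) (c : \bar R) :
  F [set x | g x <= c] -> limf_esup g F <= c.
Proof.
move=> Fc; rewrite limf_esupE; apply: ge_ereal_inf.
exists (ereal_sup (g @` [set x | g x <= c])); first by exists [set x | g x <= c].
by apply: ge_ereal_sup => _ [x ? <-].
Qed.

Lemma limf_einf_le_esup (F : set_system X) (g : X -> \bar R) : ProperFilter F ->
  limf_einf g F <= limf_esup g F.
Proof.
move=> PF; rewrite limf_einfE limf_esupE; apply: ge_ereal_sup => _ [V FV <-].
apply: le_ereal_inf_tmp => _ [W FW <-].
have [x [Vx Wx]] := filter_ex (filterI FV FW).
apply: (@le_trans _ _ (g x)).
  by apply: ereal_inf_lbound; exists x.
by apply: ereal_sup_ubound; exists x.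
Qed.

End LimInf.

Section Exponent.
Context {R : realType}.
Variables (H : R) (f : R -> R).

Lemma lee_lt_approx (x : \bar R) (c : R) : (forall e : R, (0 < e)%R -> (c - e)%:E <= x)%E -> (c%:E <= x)%E.
Proof.
move=> Hx; apply/lee_addgt0Pr => e e0; rewrite -leeBlDr// -EFinB.
exact: Hx.
Qed.

Lemma lee_gt_approx (x : \bar R) (c : R) : (forall e : R, (0 < e)%R -> x <= (c + e)%:E)%E -> (x <= c%:E)%E.
Proof. by move=> Hx; apply/lee_addgt0Pr => e e0; rewrite -EFinD; exact: Hx. Qed.

(** Reads the exponent off power bounds: an upper bound near [t] for every
    exponent below [H], and a lower bound along points approaching [t] for every
    exponent above [H]. *)
Lemma pointwise_exponent_eq t :
  (forall c, c < H -> exists2 d : R, 0 < d & forall s, s \in `[0, 1] -> 0 < `|s - t| < d ->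
     `|f s - f t| <= `|s - t| `^ c) ->
  (forall c, H < c -> forall d : R, 0 < d -> exists s, [/\ s \in `[0, 1], 0 < `|s - t| < d &
     `|s - t| `^ c <= `|f s - f t|]) ->
  pointwise_exponent01 f t = H%:E.
Proof.
move=> H1 H2; apply/eqP; rewrite eq_le; apply/andP; split.
- apply: lee_gt_approx => e e0; apply: limf_einf_le => V.
  rewrite /within /= => /nbhs_ballP[r /= r0 rV].
  have m0 : 0 < Num.min r 1 by rewrite lt_min r0/=.
  have [s [s01 /andP[st0 st] sf]] := H2 (H + e) (ltr_pwDr e0 (lexx _)) _ m0.
  move: st; rewrite lt_min => /andP[sr s1].
  exists s.
    apply: rV => //=; first by rewrite /ball /= distrC.
    by apply/eqP => E; move: st0; rewrite E subrr normr0 ltxx.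
  by apply: lne_ratio_le => //; rewrite st0.
- apply: lee_lt_approx => e e0; apply: limf_einf_ge.
  have He : H - e < H by rewrite ltrBlDr ltrDl.
  have [r r0 rf] := H1 _ He.
  apply/nbhs_ballP; exists (Num.min r 1) => /=; first by rewrite lt_min r0/=.
  move=> s /=; rewrite /ball /= distrC lt_min => /andP[sr s1] st s01.
  have st0 : 0 < `|s - t| by rewrite normr_gt0 subr_eq0.
  apply: lne_ratio_ge; [by rewrite st0 s1|exact: normr_ge0|].
  by apply: rf; [exact: s01|rewrite st0 sr].
Qed.

End Exponent.

(** * Scales, diameters and coverings of a graph *)

Section Scales.
Context {R : realType}.
Implicit Types (x y r : R).

Lemma exists_expn_gt (x : R) : exists n, x < 2 ^+ n.
Proof.
exists (Num.truncn x).+1; apply: (lt_le_trans (truncnS_gt x)).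
by rewrite -natrX ler_nat ltnW// ltn_expl.
Qed.

Lemma dyadic_scale x : 0 < x <= 1 -> exists n, 2 ^- n.+1 < x <= 2 ^- n.
Proof.
move=> /andP[x0 x1].
have ex : exists n, 2 ^- n.+1 < x.
  have [n nx] := exists_expn_gt x^-1; exists n.
  rewrite invf_plt ?posrE ?exprn_gt0//; apply: (lt_le_trans nx).
  by rewrite exprS ler_peMl// ?exprn_ge0// ler1n.
case: (ex_minnP ex) => -[|n] nx nmin; first by exists 0%N; rewrite nx expr0 invr1 x1.
exists n.+1; rewrite nx leNgt; apply/negP => H.
by have := nmin n H; rewrite ltnn.
Qed.

Lemma small_powR (K e : R) : 0 <= K -> 0 < e ->
  exists2 d : R, 0 < d & forall x, 0 < x <= d -> K * x `^ e <= 1.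
Proof.
move=> K0 e0; have K1 : 0 < K + 1 by lra.
exists ((K + 1)^-1 `^ e^-1); first by rewrite powR_gt0 ?invr_gt0.
move=> x /andP[x0 xd].
have H : x `^ e <= (K + 1)^-1.
  have -> : (K + 1)^-1 = ((K + 1)^-1 `^ e^-1) `^ e.
    by rewrite -powRrM mulVf ?gt_eqF// powRr1// invr_ge0 ltW.
  by apply: ge0_ler_powR; rewrite ?nnegrE ?powR_ge0// ltW.
apply: (le_trans (ler_wpM2l K0 H)).
by rewrite ler_pdivrMr// mul1r; lra.
Qed.

Lemma grid_cell n (t : R) : t \in `[0, 1] ->
  exists2 k, (k < 2 ^ n)%N & k%:R / 2 ^+ n <= t <= k.+1%:R / 2 ^+ n.
Proof.
move=> t01; have [w sw] := winterval_cover n t01.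
rewrite inE /winterval /= in_itv /= sw => /andP[a b].
have p0 : 0 < 2 ^+ n :> R by rewrite exprn_gt0.
move: t01; rewrite in_itv /= => /andP[t0 t1].
have [E|N] := eqVneq t 1.
  exists (2 ^ n).-1; first by rewrite prednK ?expn_gt0.
  rewrite prednK ?expn_gt0// natrX divff ?gt_eqF// E lexx andbT.
  rewrite ler_pdivrMr// mul1r -natrX ler_nat leq_pred//.
exists (Num.truncn (2 ^+ n * t)).
  by rewrite truncn_lt_nat ?mulr_ge0// ?ltW// natrX gtr_pMr// lt_neqAle N.
have x0 : 0 <= 2 ^+ n * t by rewrite mulr_ge0// ltW.
have /andP[c d] := truncn_itv x0.
by rewrite ler_pdivrMr// ler_pdivlMr// ![t * _]mulrC c ltW.
Qed.

Lemma diam_ge0 (U : set (R * R)) : (0 <= diam U)%E.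
Proof.
rewrite /diam; case: ifPn => // /set0P[x Ux].
apply: le_ereal_sup_tmp; exists (euclid_dist x x)%:E; first by exists (x, x).
by rewrite lee_fin sqrtr_ge0.
Qed.

Lemma diam_le (U : set (R * R)) r : 0 <= r ->
  (forall x y : R * R, U x -> U y -> `|x.1 - y.1| <= r /\ `|x.2 - y.2| <= r) ->
  (diam U <= (2 * r)%:E)%E.
Proof.
move=> r0 H; rewrite /diam; case: ifPn => _; first by rewrite lee_fin mulr_ge0.
apply: ge_ereal_sup => _ [[x y] /= [Ux Uy] <-]; rewrite lee_fin.
have [h1 h2] := H _ _ Ux Uy.
have r2 : 0 <= 2 * r by rewrite mulr_ge0.
rewrite /euclid_dist -(ger0_norm r2) -sqrtr_sqr ler_wsqrtr//.
have sq (z : R) : `|z| <= r -> z ^+ 2 <= r ^+ 2.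
  by move=> zr; rewrite -(real_normK (num_real z)); apply: lerXn2r; rewrite ?nnegrE.
have := sq _ h1; have := sq _ h2; have := sqr_ge0 r; lra.
Qed.

Lemma diam_dist (U : set (R * R)) r (x y : R * R) : (diam U <= r%:E)%E -> U x -> U y ->
  `|x.1 - y.1| <= r /\ `|x.2 - y.2| <= r.
Proof.
move=> dU Ux Uy.
have H : euclid_dist x y <= r.
  rewrite -lee_fin; apply: le_trans dU; rewrite /diam.
  case: ifPn => [/eqP E|_]; first by move: Ux; rewrite E.
  by apply: ereal_sup_ubound; exists (x, y).
split; apply: le_trans H; rewrite /euclid_dist -sqrtr_sqr ler_wsqrtr//.
  by rewrite lerDl sqr_ge0.
by rewrite lerDr sqr_ge0.
Qed.

End Scales.

Section CoverUpper.
Context {R : realType}.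
Variables (f : R -> R).

(** Above each of the [2 ^ n] dyadic intervals the graph of an [alpha]-Holder
    function has height at most [2 A] with [A = C * 2^(- n alpha)], and is
    covered by [q], about [2 A * 2 ^ n], squares of side [2^-n]. *)
Lemma graph_cover (alpha C : R) n : 0 < alpha <= 1 -> 0 <= C ->
  (forall s t, s \in `[0, 1] -> t \in `[0, 1] -> `|f s - f t| <= C * `|s - t| `^ alpha) ->
  exists N (U : 'I_N -> set (R * R)), [/\ graph01 f `<=` \bigcup_i U i,
    forall i, (diam (U i) <= (2 * 2 ^- n)%:E)%E &
    N%:R <= (2 * C + 1) * (2 ^+ n) `^ (2 - alpha)].
Proof.
move=> /andP[a0 a1] C0 Hf.
have p0 : 0 < 2 ^+ n :> R by rewrite exprn_gt0.
have p1 : 1 <= 2 ^+ n :> R by rewrite exprn_ege1// ler1n.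
pose A := C * (2 ^- n) `^ alpha.
have A0 : 0 <= A by rewrite mulr_ge0// powR_ge0.
pose q := (Num.truncn (2 * A * 2 ^+ n)).+1.
have q0 : (0 < q)%N by [].
have x0 : 0 <= 2 * A * 2 ^+ n by rewrite !mulr_ge0// ltW.
have /andP[qa qb] := truncn_itv x0.
pose g k : R := k%:R / 2 ^+ n.
(* The quotient of i by q is the index of the column, the remainder that of the
   square in the column. *)
pose U (i : 'I_(2 ^ n * q)) : set (R * R) := [set z |
  (g (i %/ q)%N <= z.1 <= g (i %/ q).+1) /\
  (f (g (i %/ q)%N) - A + g (i %% q)%N <= z.2 <= f (g (i %/ q)%N) - A + g (i %% q).+1)].
have gS k : g k.+1 = g k + 2 ^- n by rewrite /g -natr1 mulrDl mul1r.
exists (2 ^ n * q)%N, U; split.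
- move=> _ [t t01 <-].
  have [k kn /andP[k1 k2]] := grid_cell n t01.
  have gk : g k \in `[0, 1].
    rewrite in_itv /= /g divr_ge0 ?(ltW p0)//= ler_pdivrMr// mul1r -natrX ler_nat.
    exact: ltnW.
  have dk : `|f t - f (g k)| <= A.
    apply: (le_trans (Hf _ _ t01 gk)); apply: ler_wpM2l => //.
    apply: ge0_ler_powR; rewrite ?nnegrE ?invr_ge0 ?(ltW p0) ?(ltW a0)//.
    rewrite ger0_norm; last by rewrite subr_ge0.
    by rewrite lerBlDl -gS.
  move: dk; rewrite ler_norml => /andP[d1 d2].
  pose y := (f t - f (g k) + A) * 2 ^+ n.
  have y0 : 0 <= y by rewrite mulr_ge0// ?(ltW p0)//; lra.
  have yq : (Num.truncn y < q)%N.
    rewrite truncn_lt_nat//; apply: le_lt_trans qb.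
    by rewrite ler_pM2r//; lra.
  have /andP[y1 y2] := truncn_itv y0.
  have ik : (k * q + Num.truncn y < 2 ^ n * q)%N.
    by apply: (@leq_trans (k.+1 * q)); [rewrite mulSn addnC ltn_add2r|rewrite leq_mul2r kn orbT].
  exists (Ordinal ik) => //; rewrite /U /= divnMDl// divn_small// addn0 modnMDl modn_small//.
  split; first by rewrite k1 k2.
  have Ey : f t - (f (g k) - A) = f t - f (g k) + A by ring.
  apply/andP; split.
    by rewrite -lerBrDl Ey /g ler_pdivrMr.
  by rewrite -lerBlDl Ey {2}/g ler_pdivlMr// ltW.
- move=> i; apply: diam_le; first by rewrite invr_ge0 ltW.
  move=> x y [/andP[a b] /andP[c d]] [/andP[a' b'] /andP[c' d']].
  rewrite !gS in b d b' d'.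
  by split; rewrite ler_norml; apply/andP; split; lra.
- rewrite natrM natrX.
  have E : A * 2 ^+ n * 2 ^+ n = C * (2 ^+ n) `^ (2 - alpha).
    rewrite /A -mulrA -mulrA; congr (_ * _).
    rewrite -expr2; move: (2 ^+ n) p0 => P P0.
    rewrite -(powR_inv1 (ltW P0)) -powRrM -(powR_mulrn 2 (ltW P0)) -powRD.
      by congr (_ `^ _); lra.
    by rewrite (gt_eqF P0) implybT.
  have F : 2 ^+ n <= (2 ^+ n) `^ (2 - alpha) :> R.
    by rewrite -[X in X <= _](powRr1 (ltW p0)) ler_powR//; lra.
  apply: (@le_trans _ _ (2 ^+ n * (2 * A * 2 ^+ n + 1))).
    by rewrite ler_pM2l// /q -[X in X <= _]natr1 lerD2r.
  have -> : 2 ^+ n * (2 * A * 2 ^+ n + 1) = 2 * (A * 2 ^+ n * 2 ^+ n) + 2 ^+ n by ring.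
  by rewrite E; move: F; set X := _ `^ _ => F; lra.
Qed.

End CoverUpper.

(** * Dimensions of the graph *)

Section DimUpper.
Context {R : realType}.
Variable f : R -> R.
Local Open Scope ereal_scope.

(** Finite covers become sequences by adding empty sets, which have weight [0]. *)
Definition extend_cover N (U : 'I_N -> set (R * R)) : nat -> set (R * R) :=
  fun i => if insub i is Some j then U j else set0.

Lemma extend_cover_sub N (U : 'I_N -> set (R * R)) F :
  F `<=` \bigcup_i U i -> F `<=` \bigcup_i extend_cover U i.
Proof.
move=> FU x /FU[i _ Ux]; exists (val i) => //.
by rewrite /extend_cover valK.
Qed.

Lemma diam0 : diam (set0 : set (R * R)) = 0.
Proof. by rewrite /diam eqxx. Qed.

Lemma gauge0 s : gauge s (set0 : set (R * R)) = 0.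
Proof. by rewrite /gauge eqxx. Qed.

Lemma gauge_ge0 s (U : set (R * R)) : 0 <= gauge s U.
Proof. by rewrite /gauge; case: ifP => // _; exact: poweR_ge0. Qed.

Lemma gauge_le s (U : set (R * R)) r : (0 <= s)%R -> (0 <= r)%R -> diam U <= r%:E ->
  gauge s U <= (r `^ s)%:E.
Proof.
move=> s0 r0 dU; rewrite /gauge; case: ifP => _; first by rewrite lee_fin powR_ge0.
rewrite -poweR_EFin; apply: gt0_ler_poweR => //.
  by rewrite in_itv /= diam_ge0 leey.
by rewrite in_itv /= lee_fin r0 leey.
Qed.

Lemma extend_cover_diam N (U : 'I_N -> set (R * R)) (r : R) : (0 <= r)%R ->
  (forall i, diam (U i) <= r%:E) -> forall i, diam (extend_cover U i) <= r%:E.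
Proof.
move=> r0 H i; rewrite /extend_cover; case: insub => [j|]; first exact: H.
by rewrite diam0 lee_fin.
Qed.

Lemma extend_cover_gauge N (U : 'I_N -> set (R * R)) (s r : R) : (0 <= s)%R -> (0 <= r)%R ->
  (forall i, diam (U i) <= r%:E) ->
  \sum_(0 <= i <oo) gauge s (extend_cover U i) <= (N%:R * r `^ s)%:E.
Proof.
move=> s0 r0 H; apply: lime_le.
  by apply: is_cvg_nneseries => n _ _; exact: gauge_ge0.
apply: nearW => m.
apply: (@le_trans _ _ (\sum_(0 <= i < m) (((i < N)%N)%:R * r `^ s)%:E)).
  apply: lee_sum => i _; rewrite /extend_cover; case: insubP => [j jN _|/negbTE ->].
    by rewrite jN mul1r; exact: gauge_le.
  by rewrite gauge0 mul0r.
rewrite sumEFin lee_fin -mulr_suml; apply: ler_wpM2r; first exact: powR_ge0.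
suff -> : (\sum_(0 <= i < m) ((i < N)%N)%:R = (minn m N)%:R :> R)%R.
  by rewrite ler_nat geq_minr.
elim: m => [|m IH]; first by rewrite big_geq// min0n.
rewrite big_nat_recr//= IH -natrD; congr (_%:R); case: (ltnP m N) => /=; lia.
Qed.

Variables (H : R).
Hypotheses (H0 : (0 < H)%R) (H1 : (H <= 1)%R)
  (hol : forall alpha, (0 < alpha < H)%R -> holder01 alpha f).

Lemma holder_approx (e : R) : (0 < e)%R -> exists alpha C : R,
  [/\ (0 < alpha <= 1)%R, (H - alpha < e)%R, (0 <= C)%R &
   forall s t, s \in `[0%R, 1%R] -> t \in `[0%R, 1%R] ->
     (`|f s - f t| <= C * `|s - t| `^ alpha)%R].
Proof.
move=> e0; pose alpha := (Num.max (H / 2) (H - e / 2))%R.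
have a0 : (0 < alpha)%R by rewrite /alpha lt_max divr_gt0.
have a1 : (alpha < H)%R by rewrite /alpha gt_max; move: H0 => h0; apply/andP; split; lra.
have ae : (H - alpha <= e / 2)%R.
  by rewrite lerBlDr -lerBlDl /alpha le_max lexx orbT.
have [C Hf] := hol (introT andP (conj a0 a1)).
exists alpha, (Num.max C 0)%R; split.
- by rewrite a0 (le_trans (ltW a1)).
- by lra.
- by rewrite le_max lexx orbT.
- move=> s t s01 t01; apply: (le_trans (Hf _ _ s01 t01)).
  by apply: ler_wpM2r; [exact: powR_ge0|rewrite le_max lexx].
Qed.

Lemma hausdorff_dim_le : hausdorff_dim (graph01 f) <= (2 - H)%:E.
Proof.
apply: lee_gt_approx => e e0.
have [alpha [C [a01 ae C0 HfC]]] := holder_approx e0.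
pose s := (2 - H + e)%R.
have s0 : (0 <= s)%R by rewrite /s; move: H1; lra.
apply: ereal_inf_lbound; exists s => //=; split=> //.
apply/eqP; rewrite eq_le; apply/andP; split; last first.
  apply: (@le_trans _ _ (hausdorff_premeasure s 1%R (graph01 f))); last first.
    by apply: ereal_sup_ubound; exists 1%R => /=.
  apply: le_ereal_inf_tmp => _ [U _ <-].
  by apply: nneseries_ge0 => n _ _; exact: gauge_ge0.
apply: ge_ereal_sup => _ [delta /= d0 <-].
apply/lee_addgt0Pr => eta eta0; rewrite add0e.
pose K := ((2 * C + 1) * 2 `^ s / eta)%R.
have K0 : (0 <= K)%R.
  by rewrite /K divr_ge0 ?mulr_ge0 ?powR_ge0 ?ltW//; lra.
have se : (0 < s - (2 - alpha))%R by rewrite /s; lra.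
have [dd dd0 Hd] := small_powR K0 se.
have [n nd] := exists_expn_gt (Num.max dd^-1 (2 / delta))%R.
move: nd; rewrite gt_max => /andP[n1 n2].
have p0 : (0 < 2 ^+ n :> R)%R by rewrite exprn_gt0.
have r0 : (0 <= 2 * 2 ^- n :> R)%R by rewrite mulr_ge0// invr_ge0 ltW.
have [N [U [cU dU NU]]] := graph_cover n a01 C0 HfC.
apply: (@le_trans _ _ (\sum_(0 <= i <oo) gauge s (extend_cover U i))).
  apply: ereal_inf_lbound; exists (extend_cover U) => //; split.
    exact: extend_cover_sub.
  move=> i; apply: (le_trans (extend_cover_diam r0 dU i)); rewrite lee_fin.
  by rewrite ler_pdivrMr// mulrC -ler_pdivrMr// ltW.
apply: (le_trans (extend_cover_gauge s0 r0 dU)); rewrite lee_fin.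
have := Hd (2 ^- n)%R; rewrite invr_gt0 p0 /=.
have -> : (2 ^- n <= dd)%R.
  by rewrite invf_ple ?posrE// ltW.
move=> /(_ isT) HK.
apply: (@le_trans _ _ (((2 * C + 1) * (2 ^+ n) `^ (2 - alpha)) * (2 * 2 ^- n) `^ s)%R).
  by apply: ler_wpM2r => //; exact: powR_ge0.
rewrite powRM// ?invr_ge0 ?(ltW p0)//.
have E : ((2 ^+ n) `^ (2 - alpha) * (2 ^- n) `^ s = (2 ^- n) `^ (s - (2 - alpha)) :> R)%R.
  move: (2 ^+ n)%R p0 => P P0.
  rewrite -(powR_inv1 (ltW P0)) -!powRrM -powRD; last by rewrite (gt_eqF P0) implybT.
  by congr (_ `^ _)%R; ring.
have -> : ((2 * C + 1) * (2 ^+ n) `^ (2 - alpha) * (2 `^ s * (2 ^- n) `^ s) =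
  eta * (K * (2 ^- n) `^ (s - (2 - alpha))))%R.
  by rewrite -E /K; field; rewrite gt_eqF.
by rewrite -[X in (_ <= X)%R]mulr1 ler_pM2l.
Qed.

Lemma upper_box_dim_le : upper_box_dim (graph01 f) <= (2 - H)%:E.
Proof.
apply: lee_gt_approx => e e0; apply: limf_esup_le.
have [alpha [C [a01 ae C0 HfC]]] := holder_approx e0.
pose c := (2 - H + e)%R.
have c2 : (0 < c - (2 - alpha))%R by rewrite /c; lra.
pose K := ((2 * C + 1) * 4 `^ (2 - alpha))%R.
have K0 : (0 <= K)%R by rewrite /K mulr_ge0 ?powR_ge0//; lra.
have [dd dd0 Hd] := small_powR K0 c2.
have m0 : (0 < Num.min dd (1 / 2))%R by rewrite lt_min dd0 divr_gt0.
near=> x.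
have x0 : (0 < x)%R by near: x; exact: nbhs_right_gt.
have xm : (x < Num.min dd (1 / 2))%R by near: x; exact: nbhs_right_lt.
move: xm; rewrite lt_min => /andP[xd x2].
have x01 : (0 < x < 1)%R by rewrite x0; lra.
have x01' : (0 < x <= 1)%R by rewrite x0; lra.
have [n /andP[n1 n2]] := dyadic_scale x01'.
apply: lne_inv_ratio_le => //.
  by apply: le_ereal_inf_tmp => _ [m _ <-]; rewrite lee_fin.
have [N [U [cU dU NU]]] := graph_cover n.+2 a01 C0 HfC.
apply: (@le_trans _ _ N%:R%:E).
  apply: ereal_inf_lbound; exists N => //; exists U; split => // i.
  apply: (le_trans (dU i)); rewrite lee_fin; apply: le_trans (ltW n1).
  by rewrite exprS invfM mulrA divff// mul1r.
rewrite lee_fin; apply: (le_trans NU).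
have p0 : (0 < 2 ^+ n.+2 :> R)%R by rewrite exprn_gt0.
have a2 : (0 <= 2 - alpha)%R by move/andP: a01 => [_ ?]; lra.
have xc : (0 < x `^ c)%R by rewrite powR_gt0.
apply: (@le_trans _ _ ((2 * C + 1) * (4 / x) `^ (2 - alpha))%R).
  apply: ler_wpM2l; first lra.
  apply: ge0_ler_powR; rewrite ?nnegrE ?(ltW p0) ?divr_ge0 ?(ltW x0)//.
  rewrite ler_pdivlMr//.
  have -> : (2 ^+ n.+2 * x = 4 * (2 ^+ n * x))%R by rewrite !exprS; ring.
  rewrite -[X in (_ <= X)%R]mulr1 ler_pM2l// mulrC -ler_pdivlMr ?exprn_gt0//.
  by rewrite div1r.
have := Hd x; rewrite x0 (ltW xd) => /(_ isT) HK.
have -> : ((4 / x) `^ (2 - alpha) = 4 `^ (2 - alpha) * x `^ (- (2 - alpha)))%R.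
  by rewrite powRM ?invr_ge0 ?(ltW x0)// -(powR_inv1 (ltW x0)) -powRrM mulN1r.
rewrite mulrA -/K -[X in (_ <= X)%R]mul1r -ler_pdivrMr ?powR_gt0//.
apply: le_trans HK; rewrite -mulrA; apply: ler_wpM2l => //.
rewrite -powRN opprK -powRD; last by rewrite (gt_eqF x0) implybT.
by rewrite addrC.
Unshelve. all: by end_near.
Qed.

End DimUpper.

Section DimLower.
Context {R : realType}.
Local Open Scope ereal_scope.
Implicit Types (F : set (R * R)) (g : R).

(** The lower bound provided by a mass distribution of dimension [g]: coverings
    by small sets have a [g]-weight bounded away from [0]. It bounds the
    Hausdorff and the lower box dimension from below at once. *)
Definition massive g F := exists c delta0 : R, [/\ (0 < c)%R, (0 < delta0)%R &
  forall U : nat -> set (R * R), F `<=` \bigcup_i U i ->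
    (forall i, diam (U i) <= delta0%:E) -> c%:E <= \sum_(0 <= i <oo) gauge g (U i)].

Lemma hausdorff_dim_ge g F : massive g F -> g%:E <= hausdorff_dim F.
Proof.
move=> [c [d0 [c0 d00 M]]]; apply: le_ereal_inf_tmp => _ [s /= [s0 Hs] <-].
rewrite lee_fin leNgt; apply/negP => sg.
have m0 : (0 < Num.min d0 1)%R by rewrite lt_min d00 ltr01.
have : c%:E <= hausdorff_measure s F.
  apply: le_ereal_sup_tmp; exists (hausdorff_premeasure s (Num.min d0 1%R) F).
    by exists (Num.min d0 1)%R.
  apply: le_ereal_inf_tmp => _ [U [cU dU] <-].
  apply: (@le_trans _ _ (\sum_(0 <= i <oo) gauge g (U i))).
    apply: M => // i; apply: (le_trans (dU i)).
    by rewrite lee_fin ge_min lexx.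
  apply: lee_nneseries => [i _ _|i _]; first exact: gauge_ge0.
  rewrite /gauge; case: ifPn => // U0.
  have := dU i; have := diam_ge0 (U i).
  case: (diam (U i)) => [r| |] //; rewrite !lee_fin le_min => r0 /andP[_ r1].
  move: r0; rewrite le_eqVlt => /predU1P[<-|r0].
    by rewrite powR0 ?powR_ge0// gt_eqF// (le_lt_trans s0).
  have -> : g = (s + (g - s))%R by rewrite addrC subrK.
  rewrite powRD; last by rewrite (gt_eqF r0) implybT.
  have E1 : (1 = 1 `^ (g - s) :> R)%R by rewrite powR1.
  rewrite ler_piMr ?powR_ge0// E1; apply: ge0_ler_powR => //.
  - by rewrite subr_ge0 ltW.
  - by rewrite nnegrE ltW.
  - by rewrite nnegrE.
by rewrite Hs lee_fin leNgt c0.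
Qed.

Lemma lower_box_dim_ge g F : (0 <= g)%R -> massive g F -> g%:E <= lower_box_dim F.
Proof.
move=> g0 [c [d0 [c0 d00 M]]]; apply: lee_lt_approx => e e0.
apply: limf_einf_ge.
have ci : (0 <= c^-1)%R by rewrite invr_ge0 ltW.
have [dd dd0 Hd] := small_powR ci e0.
have m0 : (0 < Num.min dd (Num.min d0 1))%R by rewrite !lt_min dd0 d00 ltr01.
near=> x.
have x0 : (0 < x)%R by near: x; exact: nbhs_right_gt.
have xm : (x < Num.min dd (Num.min d0 1))%R by near: x; exact: nbhs_right_lt.
move: xm; rewrite !lt_min => /andP[xd /andP[x1 x2]].
apply: lne_inv_ratio_ge; first by rewrite x0.
apply: le_ereal_inf_tmp => _ [n [U [cU dU]] <-]; rewrite lee_fin.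
have dx i : diam (extend_cover U i) <= d0%:E.
  by apply: (extend_cover_diam (ltW d00)) => j; apply: (le_trans (dU j)); rewrite lee_fin ltW.
have := le_trans (M _ (extend_cover_sub cU) dx) (extend_cover_gauge g0 (ltW x0) dU).
rewrite lee_fin => H.
have := Hd x; rewrite x0 (ltW xd) => /(_ isT).
rewrite mulrC ler_pdivrMr// mul1r => xe.
have xg : (0 < x `^ g)%R by rewrite powR_gt0.
rewrite -(ler_pM2r xg); apply: le_trans H; apply: le_trans xe.
rewrite -powRD; last by rewrite (gt_eqF x0) implybT.
by apply: eq_ler; congr (_ `^ _)%R; ring.
Unshelve. all: by end_near.
Qed.

End DimLower.

Lemma graph_dims (R : realType) (f : R -> R) (H : R) : 0 < H <= 1 ->
  (forall alpha, 0 < alpha < H -> holder01 alpha f) ->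
  (forall g, 0 < g < 2 - H -> massive g (graph01 f)) ->
  [/\ hausdorff_dim (graph01 f) = (2 - H)%:E,
      lower_box_dim (graph01 f) = (2 - H)%:E &
      upper_box_dim (graph01 f) = (2 - H)%:E].
Proof.
move=> /andP[H0 H1] hol mas.
have U1 := hausdorff_dim_le H0 H1 hol.
have U2 := upper_box_dim_le H0 H1 hol.
have L : (lower_box_dim (graph01 f) <= upper_box_dim (graph01 f))%E.
  exact: limf_einf_le_esup.
have appr (x : \bar R) : (forall g : R, 0 < g < 2 - H -> (g%:E <= x)%E) -> ((2 - H)%:E <= x)%E.
  move=> Hx; apply: lee_lt_approx => e e0.
  pose g := Num.max (2^-1) (2 - H - e).
  apply: (@le_trans _ _ g%:E); first by rewrite lee_fin le_max lexx orbT.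
  apply: Hx; rewrite lt_max gt_max invr_gt0 ltr0n /=; apply/andP; split; lra.
have L1 : ((2 - H)%:E <= hausdorff_dim (graph01 f))%E.
  by apply: appr => g g1; exact/hausdorff_dim_ge/mas.
have L2 : ((2 - H)%:E <= lower_box_dim (graph01 f))%E.
  by apply: appr => g /andP[g0 g1]; apply: lower_box_dim_ge; [exact: ltW|apply: mas; rewrite g0].
split; apply/eqP; rewrite eq_le.
- by rewrite U1 L1.
- by rewrite L2 (le_trans L U2).
- by rewrite U2 (le_trans L2 L).
Qed.

(** * A mass distribution principle on dyadic cells *)

Section MassFromCells.
Context {R : realType}.
Local Notation mu := (@lebesgue_measure R).

(** Time is cut at scale [2 ^- (4 * n)] when space is observed at scale [2 ^- n]: a
    function that is Holder of some order above [1/4] varies by less than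
    [2 ^- n] on a cell, for large [n]. *)
Definition gridpt n (i : nat) : R := i%:R / 2 ^+ (4 * n).
Definition cell n i : set R := `[gridpt n i, gridpt n i.+1]%classic.
Definition cells n (Q : nat -> bool) : set R :=
  \big[setU/set0]_(i < 2 ^ (4 * n)) (if Q i then cell n i else set0).

Lemma gridptS n i : gridpt n i.+1 = gridpt n i + 2 ^- (4 * n).
Proof. by rewrite /gridpt -natr1 mulrDl mul1r. Qed.

Lemma cell_measurable n i (b : bool) : measurable (if b then cell n i else set0 : set R).
Proof. by case: b => //; exact: measurable_itv. Qed.

Lemma cells_measurable n Q : measurable (cells n Q).
Proof. by apply: bigsetU_measurable => i _; exact: cell_measurable. Qed.

Lemma cellsP n (Q : nat -> bool) t : (exists i, [/\ (i < 2 ^ (4 * n))%N, Q i & cell n i t]) -> cells n Q t.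
Proof.
move=> [i [ni Qi ci]].
rewrite /cells -(bigcup_mkord _ (fun i => if Q i then cell n i else set0)).
by exists i => //; rewrite Qi.
Qed.

Lemma cells_mu n Q :
  (mu (cells n Q) <= (2 ^- (4 * n) * \sum_(0 <= i < 2 ^ (4 * n)) (Q i)%:R)%:E)%E.
Proof.
have i0 : 0 < 2 ^- (4 * n) :> R by rewrite invr_gt0 exprn_gt0.
apply: (@le_trans _ _ (\sum_(i < 2 ^ (4 * n)) mu (if Q i then cell n i else set0))%E).
  apply: (@Boole_inequality _ _ _ mu (fun i => if Q i then cell n i else set0)).
  by move=> i _; exact: cell_measurable.
rewrite mulr_sumr big_mkord -sumEFin; apply: lee_sum => i _.
case: (Q i) => /=; last by rewrite measure0 mulr0.
rewrite mulr1 /cell gridptS lebesgue_measure_itv /= lte_fin ltrDl i0.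
by rewrite -EFinB addrC addKr.
Qed.

Variables (f : R -> R) (g : R) (n0 : nat) (bad : nat -> nat -> bool).
Hypotheses (g0 : 0 < g)
  (hosc : forall n, (n0 <= n)%N -> forall s t, s \in `[0, 1] -> t \in `[0, 1] ->
     `|s - t| <= 2 ^- (4 * n) -> `|f s - f t| <= 2 ^- n)
  (hgood : forall n, (n0 <= n)%N -> forall i, (i < 2 ^ (4 * n))%N -> ~~ bad n i ->
     \sum_(0 <= j < 2 ^ (4 * n))
       ((`|gridpt n i - gridpt n j| <= 2 * 2 ^- n)%R &&
        (`|f (gridpt n i) - f (gridpt n j)| <= 3 * 2 ^- n)%R)%:R
     <= 2 ^+ (4 * n) * (2 ^- n) `^ g)
  (hbad : forall N, \sum_(0 <= n < N) ((n0 <= n)%N%:R *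
     (2 ^- (4 * n) * \sum_(0 <= i < 2 ^ (4 * n)) (bad n i)%:R)) <= 2^-1 :> R).

(* The times lying in a bad cell at some scale beyond n0; their measure is at
   most 1/2, so that the other times carry enough mass. *)
Let Bad n : set R := if (n0 <= n)%N then cells n (bad n) else set0.

Let Bad_measurable n : measurable (Bad n).
Proof. by rewrite /Bad; case: ifP => // _; exact: cells_measurable. Qed.

Let Bad_mu : (mu (\bigcup_n Bad n) <= (2^-1)%:E)%E.
Proof.
apply: (@le_trans _ _ (\sum_(0 <= n <oo) mu (Bad n))%E).
  apply: (@generalized_Boole_inequality _ _ _ mu); first exact: Bad_measurable.
  by apply: bigcup_measurable => n _; exact: Bad_measurable.
apply: lime_le; first by apply: is_cvg_nneseries => n _ _; exact: measure_ge0.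
apply: nearW => N.
have : ((\sum_(0 <= n < N) ((n0 <= n)%N%:R *
     (2 ^- (4 * n) * \sum_(0 <= i < 2 ^ (4 * n)) (bad n i)%:R)))%:E <= (2^-1)%:E :> \bar R)%E.
  by rewrite lee_fin; exact: hbad.
apply: le_trans.
rewrite -sumEFin; apply: lee_sum => n _; rewrite /Bad; case: (n0 <= n)%N.
  by rewrite mul1r; exact: cells_mu.
by rewrite measure0 mul0r.
Qed.

(* A set U of diameter about 2^-n that meets the graph at a good time t0 sees
   only the times in the cells counted at the good cell of t0; their total length
   is at most a constant times the weight of U. *)
Let cover_piece (U : set (R * R)) : (diam U <= (2 ^- n0)%:E)%E ->
  exists D : set R, [/\ measurable D, (mu D <= (2 `^ g)%:E * gauge g U)%E &
    forall t, t \in `[0, 1] -> U (t, f t) -> D t \/ (\bigcup_n Bad n) t].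
Proof.
move=> dU.
have g2 : (0 <= (2 `^ g)%:E :> \bar R)%E by rewrite lee_fin powR_ge0.
have [[t0 [t01 Ut0 nB]]|no] :=
    pselect (exists t, [/\ t \in `[0, 1], U (t, f t) & ~ (\bigcup_n Bad n) t]); last first.
  exists set0; split => //; first by rewrite measure0 mule_ge0// gauge_ge0.
  move=> t t01 Ut; right; apply: contrapT => nB; apply: no; by exists t.
have U0 : U != set0 by apply/set0P; exists (t0, f t0).
have dU0 := diam_ge0 U.
have [r rE] : exists r : R, diam U = r%:E.
  by move: dU dU0; case: (diam U) => [r| |] // _ _; exists r.
have Ug : gauge g U = (r `^ g)%:E by rewrite /gauge (negbTE U0) rE poweR_EFin.
rewrite rE lee_fin in dU; rewrite rE lee_fin in dU0.
have Udist t : U (t, f t) -> `|t0 - t| <= r /\ `|f t0 - f t| <= r.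
  by move=> Ut; apply: (diam_dist (U := U) (x := (t0, f t0)) (y := (t, f t))); rewrite ?rE.
move: dU0; rewrite le_eqVlt => /predU1P[r0|r0].
  (* A set of diameter 0 contributes a single time, a null set. *)
  exists [set t0]; split.
  - exact: measurable_set1.
  - by rewrite lebesgue_measure_set1 mule_ge0// gauge_ge0.
  move=> t _ /Udist[]; rewrite -r0 normr_le0 subr_eq0 => /eqP -> _.
  by left.
have n0le1 : 2 ^- n0 <= 1 :> R by rewrite invf_le1 ?exprn_gt0// exprn_ege1// ler1n.
have r01 : 0 < r <= 1 by rewrite r0 (le_trans dU).
have [n /andP[n1 n2]] := dyadic_scale r01.
have n0n : (n0 <= n)%N.
  rewrite leqNgt; apply/negP => nn0.
  have := lt_le_trans n1 dU; rewrite ltf_pV2 ?posrE ?exprn_gt0//.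
  by rewrite ltr_eXn2l ?ltr1n// ltnNge nn0.
have p0 : 0 < 2 ^+ (4 * n) :> R by rewrite exprn_gt0.
have [i iN /andP[i1 i2]] := grid_cell (4 * n) t01.
have ci : cell n i t0 by rewrite /cell /= in_itv /= i1 i2.
have gi : ~~ bad n i.
  apply/negP => bi; apply: nB; exists n => //; rewrite /Bad n0n.
  by apply: cellsP; exists i.
pose Q j := (`|gridpt n i - gridpt n j| <= 2 * 2 ^- n)%R &&
        (`|f (gridpt n i) - f (gridpt n j)| <= 3 * 2 ^- n)%R.
exists (cells n Q); split; first exact: cells_measurable.
- apply: (le_trans (cells_mu _ _)); rewrite Ug -EFinM lee_fin.
  apply: (@le_trans _ _ ((2 ^- n) `^ g)).
    by rewrite ler_pdivrMl//; exact: hgood.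
  rewrite -powRM ?(ltW r0)//; apply: ge0_ler_powR; rewrite ?nnegrE ?(ltW g0)//.
    by rewrite mulr_ge0// ltW.
  by move: n1; rewrite exprS invfM => /ltW H; rewrite -ler_pdivrMl.
move=> t tI /Udist[tt ff]; left.
have [j jN /andP[j1 j2]] := grid_cell (4 * n) tI.
apply: cellsP; exists j; split => //; last by rewrite /cell /= in_itv /= j1 j2.
have step : 2 ^- (4 * n) <= 2 ^- n :> R.
  by rewrite lef_pV2 ?posrE ?exprn_gt0// ler_eXn2l ?ltr1n// leq_pmull.
have gI k : (k < 2 ^ (4 * n))%N -> gridpt n k \in `[0, 1].
  move=> kN; rewrite in_itv /= /gridpt divr_ge0 ?(ltW p0)//= ler_pdivrMr// mul1r -natrX ler_nat.
  exact: ltnW.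
rewrite -/(gridpt n i) -/(gridpt n i.+1) gridptS in i1 i2.
rewrite -/(gridpt n j) -/(gridpt n j.+1) gridptS in j1 j2.
have di : `|t0 - gridpt n i| <= 2 ^- (4 * n) by rewrite ger0_norm ?subr_ge0// lerBlDl.
have dj : `|t - gridpt n j| <= 2 ^- (4 * n) by rewrite ger0_norm ?subr_ge0// lerBlDl.
have oi := hosc n0n t01 (gI _ iN) di.
have oj := hosc n0n tI (gI _ jN) dj.
rewrite /Q; move: tt ff oi oj di dj; rewrite !ler_norml.
move=> /andP[? ?] /andP[? ?] /andP[? ?] /andP[? ?] /andP[? ?] /andP[? ?].
apply/andP; split; apply/andP; split; lra.
Qed.

(** The lifted Lebesgue measure, restricted to the good times, gives every small
    set a mass bounded by its [g]-weight; summing over a covering bounds the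
    total weight below. *)
Lemma mass_from_cells : massive g (graph01 f).
Proof.
have g2 : 0 < 2 `^ g :> R by rewrite powR_gt0.
exists ((2 `^ g)^-1 / 2), (2 ^- n0); split.
- by rewrite divr_gt0// invr_gt0.
- by rewrite invr_gt0 exprn_gt0.
move=> U cU dU.
have [D HD] := choice (fun k => cover_piece (dU k)).
have mD k : measurable (D k) by case: (HD k).
have mUD : measurable (\bigcup_k D k) by apply: bigcup_measurable.
have mB : measurable (\bigcup_n Bad n).
  by apply: bigcup_measurable => n _; exact: Bad_measurable.
have sub : `[0, 1]%classic `<=` (\bigcup_k D k) `|` (\bigcup_n Bad n).
  move=> t /= t01; have [k _ Uk] : (\bigcup_i U i) (t, f t) by apply: cU; exists t.
  have [_ _ /(_ t t01 Uk)[Dt|Bt]] := HD k; [left; by exists k|by right].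
have m1 : mu (`[0, 1]%classic : set R) = 1%E.
  by rewrite lebesgue_measure_itv /= lte_fin ltr01 -EFinB subr0.
have S : (1 <= mu (\bigcup_k D k) + mu (\bigcup_n Bad n))%E.
  rewrite -m1; apply: (@le_trans _ _ (mu ((\bigcup_k D k) `|` (\bigcup_n Bad n)))).
    by apply: le_measure; rewrite ?inE//; exact: measurableU.
  by apply: measureU2.
have SD : (mu (\bigcup_k D k) <= (2 `^ g)%:E * \sum_(0 <= i <oo) gauge g (U i))%E.
  apply: (@le_trans _ _ (\sum_(0 <= k <oo) mu (D k))%E).
    exact: (@generalized_Boole_inequality _ _ _ mu).
  rewrite -nneseriesZl; last by move=> i _; exact: gauge_ge0.
  by apply: lee_nneseries => [i _ _|i _]; [exact: measure_ge0|case: (HD i)].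
have S2 := le_trans S (leeD SD Bad_mu).
have G0 : (0 <= \sum_(0 <= i <oo) gauge g (U i))%E.
  by apply: nneseries_ge0 => n _ _; exact: gauge_ge0.
move: S2 G0; case: (\sum_(0 <= i <oo) gauge g (U i))%E => [x| |] //; last by move=> _ _; rewrite leey.
rewrite -EFinM -EFinD !lee_fin => S2 _.
by rewrite mulrC -ler_pdivlMr ?invr_gt0// invrK mulrC; lra.
Qed.

End MassFromCells.

(** * Increments over a pair of points *)

Section Localize.
Context {R : realType}.
Variable (h : R).
Implicit Types (w v x : word) (s : word -> bool) (t : R).

Lemma wpoint_cat w v : wpoint R (w ++ v) = wpoint R w + 2 ^- size w * wpoint R v.
Proof.
elim: w => [|c w IH]; first by rewrite wpoint_nil expr0 invr1 mul1r add0r.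
by rewrite cat_cons !wpoint_cons IH [size _]/= exprS invfM; field; rewrite expf_neq0.
Qed.

Definition signprod x w s : R := \prod_(1 <= k < (size w).+1) sg s (x ++ take k w).

Lemma signprod_cons x c v s :
  signprod x (c :: v) s = sg s (rcons x c) * signprod (rcons x c) v s.
Proof.
rewrite /signprod [size (c :: v)]/= big_nat_recl// -[take 1 (c :: v)]/(c :: take 0 v) take0 cats1.
by congr (_ * _); apply: eq_bigr => i _; rewrite cat_rcons.
Qed.

Lemma signprod_nil x s : signprod x [::] s = 1.
Proof. by rewrite /signprod big_geq. Qed.

Lemma signprod_sign x w s : signprod x w s = 1 \/ signprod x w s = -1.
Proof.
elim: w x => [|c v IH] x; first by left; rewrite signprod_nil.
rewrite signprod_cons /sg /sgn; case: (s _); rewrite ?mul1r ?mulN1r; first exact: IH.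
by case: (IH (rcons x c)) => ->; [right|left; rewrite opprK].
Qed.

Definition outside w : pred word := fun i => ~~ descendant w i.

Lemma outside_branch x c v : outside (x ++ c :: v) (rcons x c).
Proof.
apply/negP => /andP[/negP H /size_prefix]; rewrite size_cat size_rcons /= addnS => sz.
apply: H; apply/eqP; rewrite -cat_rcons; case: v sz => [|y v]; first by rewrite cats0.
by rewrite /=; lia.
Qed.

Lemma outside_other x c c' v i : c != c' -> prefix (rcons x c') i -> outside (x ++ c :: v) i.
Proof.
move=> cc H; apply/negP => /descendantW H'.
have H2 : prefix (rcons x c) i by apply: prefix_trans H'; rewrite -cat_rcons prefix_prefix.
have := prefix_rcons_disj x i; case: c c' cc H H2 {H'} => -[]// _ -> -> //.
Qed.

Lemma signprod_depends x w : depends (outside (x ++ w)) (signprod x w).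
Proof.
elim: w x => [|c v IH] x; first by move=> s s' _; rewrite !signprod_nil.
move=> s s' ss; rewrite !signprod_cons; congr (_ * _).
  by rewrite /sg ss// outside_branch.
by apply: (IH (rcons x c)) => i; rewrite cat_rcons; exact: ss.
Qed.

(** Isolates the contribution of the interval of [w]: what is left is independent
    of the signs strictly below [x ++ w], in particular of the mass there. *)
Lemma casc_rest x w n t : depends (outside (x ++ w)) (fun s =>
  casc h (sg s) (size w + n) x t -
  signprod x w s * (h ^+ size w * casc h (sg s) n (x ++ w) (wordV w t))).
Proof.
elim: w x t => [|c v IH] x t.
  by move=> s s' _; rewrite !signprod_nil !mul1r !cats0 !subrr.
have other c' y : c != c' -> depends (outside (x ++ c :: v))
    (fun s => sg s (rcons x c') * casc h (sg s) (size v + n) (rcons x c') y).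
  move=> cc s s' ss; congr (_ * _).
    by rewrite /sg ss//; apply: (outside_other _ cc); exact: prefix_refl.
  by apply: casc_depends_descendant => i /descendantW iP; apply: ss; exact: (outside_other _ cc).
have main := IH (rcons x c) (dyadV c t).
rewrite cat_rcons in main.
move=> s s' ss; have {main}M := main _ _ ss.
rewrite !signprod_cons wordV_cons /=.
have Ec : sg s (rcons x c) = sg s' (rcons x c) :> R by rewrite /sg ss// outside_branch.
have E s1 : h * (sg s1 (rcons x false) * casc h (sg s1) (size v + n) (rcons x false) (dyadV false t) +
     sg s1 (rcons x true) * casc h (sg s1) (size v + n) (rcons x true) (dyadV true t)) -
  sg s1 (rcons x c) * signprod (rcons x c) v s1 *
  (h ^+ (size v).+1 * casc h (sg s1) n (x ++ c :: v) (wordV v (dyadV c t))) =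
  h * (sg s1 (rcons x (~~ c)) * casc h (sg s1) (size v + n) (rcons x (~~ c)) (dyadV (~~ c) t)) +
  h * (sg s1 (rcons x c) * (casc h (sg s1) (size v + n) (rcons x c) (dyadV c t) -
     signprod (rcons x c) v s1 * (h ^+ size v * casc h (sg s1) n (x ++ c :: v) (wordV v (dyadV c t))))).
  by case: c {ss M Ec other IH} => /=; rewrite exprS; ring.
rewrite !E Ec; congr (_ * _ + _ * (_ * _)); last exact: M.
by apply: other => //; case: (c).
Qed.

End Localize.

(** Take for [2 ^ q] the largest power of two at most [e / 2], where [e = j - i]
    (or [q = 0] when [e = 1]), and round [i] up to a multiple of [2 ^ q]: between
    [i] and [j] lies a dyadic interval longer than [e / 4]. *)
Lemma dyadic_inside (i j M : nat) : (i < j)%N -> (j <= 2 ^ M)%N ->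
  exists q l, [/\ (2 ^ q <= j - i < 4 * 2 ^ q)%N, (q <= M)%N, (i <= l * 2 ^ q)%N,
    (l.+1 * 2 ^ q <= j)%N & (l < 2 ^ (M - q))%N].
Proof.
move=> ij jM; set e := (j - i)%N; have e0 : (0 < e)%N by rewrite subn_gt0.
have /andP[t1 t2] := trunc_log_bounds (isT : (1 < 2)%N) e0.
set q := (trunc_log 2 e).-1.
have q1 : (2 ^ q <= e)%N.
  by apply: leq_trans t1; rewrite leq_pexp2l// leq_pred.
have q2 : (e < 4 * 2 ^ q)%N.
  apply: (leq_trans t2); rewrite -[4%N]/(2 ^ 2)%N -expnD leq_pexp2l//.
  by rewrite /q; case: trunc_log => [|k] //=; rewrite addnC addn2.
have p0 : (0 < 2 ^ q)%N by rewrite expn_gt0.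
have eM : (e <= 2 ^ M)%N by rewrite (leq_trans _ jM)// leq_subr.
have qM : (q <= M)%N by rewrite -(leq_exp2l q M (isT : (1 < 2)%N)) (leq_trans q1).
pose l := ((i + (2 ^ q).-1) %/ 2 ^ q)%N.
have l1 : (i <= l * 2 ^ q)%N.
  have := divn_eq (i + (2 ^ q).-1) (2 ^ q); rewrite -/l.
  have := ltn_pmod (i + (2 ^ q).-1) p0; move: (_ %% _)%N => m; clear -p0; lia.
have l2 : (l.+1 * 2 ^ q <= j)%N.
  have lq : (l * 2 ^ q <= i + (2 ^ q).-1)%N by exact: leq_divM.
  have [q0|q0] := posnP q.
    move: lq q1; rewrite q0 !expn0 !muln1; clear -ij; lia.
  have : (2 * 2 ^ q <= e)%N.
    by rewrite -expnS; apply: leq_trans t1; rewrite leq_pexp2l// /q prednK//; move: q0; rewrite /q; case: trunc_log.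
  move: lq; rewrite mulSn /e; clear -p0 ij; lia.
exists q, l; split => //; first by rewrite q1 q2.
rewrite -(ltn_pmul2r p0) -expnD subnK//; apply: leq_trans jM.
by apply: leq_trans l2; rewrite ltn_mul2r p0 ltnSn.
Qed.

Section Pairs.
Context {R : realType}.
Variables (h a m2 : R).
Hypotheses (ah : 2 * h * a = 1) (h_gt : 1 < 2 * h) (h_lt : 2 * h ^+ 2 < 1).
Hypotheses (m2_ge1 : 1 <= m2) (m2_rec : 2 * h ^+ 2 * m2 + 2^-1 <= m2).
Variables (l : seq word) (L : nat) (s0 : word -> bool).
Hypothesis lN : forall w, (size w <= L)%N -> w \in l.
Local Notation p := (upprob a).
Local Notation E f := (avg p l f s0).

(** The dyadic interval of [w] lies between the two points, so that the increment
    contains the whole mass of [w], with an independent remainder: the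
    anti-concentration estimate applies with [g = h ^ (M - q)]. *)
Lemma increment_concentration (M i j q k : nat) (r : R) :
  (i <= k * 2 ^ q)%N -> (k.+1 * 2 ^ q <= j)%N -> (k < 2 ^ (M - q))%N -> (q <= M)%N ->
  (M < L)%N -> 0 < r -> h ^+ L <= freq0 m2 * r ->
  E (fun s => ((`|casc h (sg s) L [::] (j%:R / 2 ^+ M) -
                  casc h (sg s) L [::] (i%:R / 2 ^+ M)| <= r)%R)%:R)
  <= conc_cst h a m2 * r / h ^+ (M - q).
Proof.
move=> ik kj kM qM ML r0 hL.
have h0 : 0 < h by move: h_gt; lra.
have [w sw ww] := @wpoint_nat R _ _ kM.
set m := (M - q)%N in sw ww kM *.
have mL : (size w + (L - m) = L)%N by rewrite sw; move: ML qM; rewrite /m; clear; lia.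
have p0 n : 0 < 2 ^+ n :> R by rewrite exprn_gt0.
have PM : 2 ^+ M = 2 ^+ m * 2 ^+ q :> R by rewrite -exprD /m subnK.
have ti : wordV w (i%:R / 2 ^+ M : R) <= 0.
  rewrite wordVE sw ww pmulr_rle0 ?subr_le0// PM.
  rewrite invfM mulrA ler_pdivrMr// mulrAC ler_pM2r ?invr_gt0//.
  by rewrite -natrX -natrM ler_nat.
have tj : 1 <= wordV w (j%:R / 2 ^+ M : R).
  rewrite wordVE sw ww mulrBr PM.
  have -> : 2 ^+ m * (k%:R / 2 ^+ m) = k%:R :> R by rewrite mulrC divfK// gt_eqF.
  have -> : 2 ^+ m * (j%:R / (2 ^+ m * 2 ^+ q)) = j%:R / 2 ^+ q :> R.
    by field; rewrite !gt_eqF.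
  rewrite lerBrDr nat1r ler_pdivlMr// -natrX -natrM ler_nat//.
pose Rest t s := casc h (sg s) (size w + (L - m)) [::] t -
  signprod [::] w s * (h ^+ size w * casc h (sg s) (L - m) ([::] ++ w) (wordV w t)).
have dR t : depends (outside w) (Rest t) by exact: (@casc_rest _ h [::] w (L - m) t).
pose X s := Rest (j%:R / 2 ^+ M) s - Rest (i%:R / 2 ^+ M) s.
have dX : depends (outside w) X by exact: (depends_comp2 (fun x y => x - y) (dR _) (dR _)).
have dY : depends (outside w) (signprod [::] w : _ -> R) by exact: (@signprod_depends R [::] w).
rewrite (@eq_avg _ _ _ _ _ (fun s => ((`|X s + signprod [::] w s *
   (h ^+ m * mass h (sg s) (L - m) w)| <= r)%R)%:R)); last first.
  move=> s; congr ((_ <= _)%R%:R); congr `|_|.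
  rewrite /X /Rest mL /= (casc_le0 _ _ _ _ ti) (casc_ge1 _ _ _ _ tj) sw; ring.
have n0 : (0 < L - m)%N by rewrite subn_gt0 (leq_ltn_trans _ ML)// leq_subr.
have wL : (size w + (L - m) <= L)%N by rewrite mL.
have disj i' : ~~ (outside w i' && descendant w i') by rewrite /outside andNb.
have g0 : 0 < h ^+ m by rewrite exprn_gt0.
apply: (concentration ah h_gt m2_ge1 m2_rec s0 lN n0 wL dX dY disj _ g0 r0).
  by move=> s; exact: signprod_sign.
by rewrite -exprD subnKC// ltnW// (leq_ltn_trans _ ML)// leq_subr.
Qed.

End Pairs.

(** * Expected number of near cells *)

Section Harmonic.
Context {R : realType}.

(** The term of index [0] vanishes, as [0^-1 = 0]. *)
Definition harm (N : nat) : R := \sum_(0 <= k < N) k%:R^-1.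

Lemma le_harm N N' : (N <= N')%N -> harm N <= harm N'.
Proof.
move=> NN; rewrite /harm (@big_cat_nat _ _ _ N 0 N')//= lerDl.
by apply: sumr_ge0 => k _; rewrite invr_ge0.
Qed.

Lemma harm_pow2 k : harm (2 ^ k) <= k%:R.
Proof.
elim: k => [|k IH]; first by rewrite /harm expn0 big_nat1 invr0.
have p0 : (0 < 2 ^ k)%N by rewrite expn_gt0.
have le2 : (2 ^ k <= 2 ^ k.+1)%N by rewrite leq_pexp2l.
rewrite /harm (@big_cat_nat _ _ _ (2 ^ k) 0)//= -natr1; apply: lerD; first exact: IH.
apply: (@le_trans _ _ (\sum_(2 ^ k <= i < 2 ^ k.+1) (2 ^ k)%:R^-1)).
  rewrite big_nat [X in _ <= X]big_nat; apply: ler_sum => i /andP[ki _].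
  by rewrite lef_pV2 ?posrE ?ltr0n ?ler_nat// (leq_trans p0).
by rewrite sumr_const_nat expnS mul2n -addnn addnK -[X in X <= _]mulr_natl divff//.
Qed.

Lemma sum_dist_inv (i N : nat) : (i < N)%N ->
  \sum_(0 <= j < N) ((j - i)%N%:R^-1 + (i - j)%N%:R^-1) <= 2 * harm N.
Proof.
move=> iN; rewrite big_split /= mulr_natl mulr2n; apply: lerD.
  rewrite (@big_cat_nat _ _ _ i 0 N)//=; last exact: ltnW.
  rewrite big_nat big1 ?add0r; last first.
    by move=> j /andP[_ ji]; rewrite (eqP (ltnW ji)) invr0.
  rewrite -{1}[i]add0n big_addn; apply: le_trans (le_harm (leq_subr i N)).
  by apply: ler_sum => j _; rewrite addnK.
rewrite (@big_cat_nat _ _ _ i.+1 0 N)//= [X in _ + X]big_nat [X in _ + X]big1 ?addr0; last first.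
  by move=> j /andP[ij _]; rewrite (eqP (ltnW ij)) invr0.
apply: le_trans (le_harm iN).
rewrite big_nat_rev /= add0n /harm big_nat [X in _ <= X]big_nat; apply: ler_sum => j /andP[_ ji].
by rewrite subSS subKn.
Qed.

End Harmonic.

Section ExpectedCounts.
Context {R : realType}.
Variables (H h a m2 : R).
Hypotheses (hE : h = 2 `^ (- H)) (H_le : H <= 1) (H_gt : 2^-1 < H)
  (ah : 2 * h * a = 1) (h_lt : 2 * h ^+ 2 < 1)
  (m2_ge1 : 1 <= m2) (m2_rec : 2 * h ^+ 2 * m2 + 2^-1 <= m2).
Local Notation p := (upprob a).

Let h0 : 0 < h. Proof. by rewrite hE powR_gt0. Qed.
Let H0 : 0 < H. Proof. by apply: lt_trans H_gt; rewrite invr_gt0. Qed.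

Let hpow n : h ^+ n = (2 ^+ n) `^ (- H).
Proof. by rewrite hE -!powR_mulrn ?powR_ge0// -!powRrM mulrC. Qed.

Let h_ge : 1 <= 2 * h.
Proof.
have -> : 2 * h = 2 `^ (1 - H).
  by rewrite hE powRD ?powRr1// pnatr_eq0 implybT.
apply: (@le_trans _ _ (2 `^ 0)); first by rewrite powRr0.
apply: ler_powR; rewrite ?ler1n// subr_ge0//.
Qed.

Let p01 := upprob01 ah h_ge.

Let x0_gt0 : 0 < freq0 m2.
Proof. by rewrite /freq0 invr_gt0 mulr_gt0// (lt_le_trans ltr01). Qed.

Section Fixed.
Variables (l : seq word) (L : nat) (s0 : word -> bool).
Hypothesis lN : forall w, (size w <= L)%N -> w \in l.
Local Notation E f := (avg p l f s0).

Definition pair_cst : R := 20 * conc_cst h a m2 + 2.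

Let F s (x : R) := casc h (sg s) L [::] x.

(** By [increment_concentration] two grid points at distance [e] steps are within
    [5 * 2^-n] vertically with a probability of order [2^-n / (e 2^(-4n))^H]. As
    [e 2^(-4n) <= 2^(1-n)], this is at most of order [2^(4n) 2^(-n (2 - H)) / e],
    whose sum over [e] is what a set of dimension [2 - H] requires, up to a
    logarithm. For [H = 1], where the process is deterministic and
    [concentration] does not apply, the right side exceeds the trivial bound
    [1]. *)
Lemma pair_bound n i j : (i < j)%N -> (j <= 2 ^ (4 * n))%N -> (4 * n < L)%N ->
  h ^+ L <= freq0 m2 * (5 * 2 ^- n) -> (j - i <= 2 * 2 ^ (3 * n))%N ->
  E (fun s => ((`|F s (gridpt n j) - F s (gridpt n i)| <= 5 * 2 ^- n)%R)%:R) <=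
  `|pair_cst| * (2 ^+ (4 * n) * (2 ^- n) `^ (2 - H)) * (j - i)%:R^-1.
Proof.
move=> ij jM ML hL eE.
have [q [k [/andP[q1 q2] qM ik kj kM]]] := dyadic_inside ij jM.
set M := (4 * n)%N in jM ML qM kM *; set e := (j - i)%N in q1 q2 eE *.
have e0 : 0 < e%:R :> R by rewrite ltr0n subn_gt0.
have p0 m : 0 < 2 ^+ m :> R by rewrite exprn_gt0.
have V0 : 0 < (2 ^- n) `^ (2 - H) :> R by rewrite powR_gt0// invr_gt0.
set T := 2 ^+ M * (2 ^- n) `^ (2 - H).
have T0 : 0 < T by rewrite mulr_gt0.
have Te : 0 < T / e%:R by rewrite divr_gt0.
have P1 : E (fun s => ((`|F s (gridpt n j) - F s (gridpt n i)| <= 5 * 2 ^- n)%R)%:R) <= 1.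
  rewrite -[X in _ <= X](avg_cst p l 1 s0); apply: (ler_avg p01) => s.
  by case: (_ <= 5 * 2 ^- n) => /=; rewrite ?ler01.
have [H1|Hn1] := eqVneq H 1.
  apply: (le_trans P1).
  have T1 : T = 2 ^+ (3 * n).
    rewrite /T H1 (_ : 2 - 1 = 1); last by ring.
    rewrite powRr1 ?invr_ge0 ?(ltW (p0 n))// /M.
    have -> : (4 * n = 3 * n + n)%N by rewrite -mulSnr.
    by rewrite exprD mulfK// gt_eqF.
  have : 1 <= 2 * (T / e%:R).
    rewrite mulrA ler_pdivlMr// mul1r T1 -natrX -natrM ler_nat//.
  have : 2 <= `|pair_cst|.
    rewrite (le_trans _ (ler_norm _))// /pair_cst lerDr mulr_ge0//.
    rewrite /conc_cst divr_ge0 ?mulr_ge0 ?(ltW x0_gt0)// subr_ge0 -expR0 ler_expR.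
    rewrite oppr_le0 divr_ge0// mulr_ge0 ?(ltW x0_gt0)//.
    rewrite /decay divr_ge0 ?(ltW x0_gt0)// mulr_ge0 ?(ltW h0)// divr_ge0// mulr_ge0 ?sqr_ge0//.
    have -> : a = 1.
      move: ah; rewrite hE H1 powR_inv1// divff ?mul1r//.
    by rewrite expr1n subrr.
  move=> p2 t2; rewrite -mulrA; apply: (le_trans t2).
  by apply: ler_wpM2r => //; exact: ltW.
have h_gt : 1 < 2 * h.
  rewrite lt_neqAle h_ge andbT; apply/eqP => E2.
  have : 2 `^ (1 - H) = 1 :> R by rewrite powRD ?powRr1 ?pnatr_eq0 ?implybT// -hE -E2.
  move/(congr1 (@ln R)); rewrite ln_powR ln1 => /eqP; rewrite mulf_eq0 => /orP[/eqP H2|].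
    by move/eqP: Hn1; apply; move: H2; lra.
  by rewrite gt_eqF// ln_gt0// ltr1n.
have r0 : 0 < 5 * 2 ^- n :> R by rewrite mulr_gt0// invr_gt0.
have C := increment_concentration ah h_gt m2_ge1 m2_rec s0 lN ik kj kM qM ML r0 hL.
apply: (le_trans C).
have cc0 : 0 < conc_cst h a m2.
  have a1 : a < 1 by move: ah h_gt; nra.
  rewrite /conc_cst divr_gt0// ?mulr_gt0//.
  rewrite subr_gt0 -expR0 ltr_expR oppr_lt0 divr_gt0// mulr_gt0//.
  exact: (decay_gt0 ah h_gt m2_ge1).
have pc : 20 * conc_cst h a m2 <= `|pair_cst|.
  by rewrite (le_trans _ (ler_norm _))// /pair_cst lerDl.
set c := conc_cst h a m2 in cc0 pc *.
pose y : R := 4 * 2 ^+ M / e%:R.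
have y0 : 0 < y by rewrite divr_gt0// mulr_gt0.
have hy : (h ^+ (M - q))^-1 <= y `^ H.
  rewrite hpow powRN invrK; apply: ge0_ler_powR; rewrite ?nnegrE ?(ltW H0) ?(ltW (p0 _)) ?(ltW y0)//.
  rewrite ler_pdivlMr//.
  have -> : 2 ^+ M = 2 ^+ (M - q) * 2 ^+ q :> R by rewrite -exprD subnK.
  rewrite mulrCA; apply: ler_wpM2l; first exact: ltW.
  by rewrite -natrX -natrM ler_nat ltnW.
have yH : y `^ H <= y * (2 ^- n) `^ (1 - H).
  have -> : y `^ H = y * y `^ (- (1 - H)).
    rewrite -{2}(powRr1 (ltW y0)) -powRD; last by rewrite (gt_eqF y0) implybT.
    by congr (_ `^ _); ring.
  apply: ler_wpM2l; first exact: ltW.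
  have -> : (2 ^- n) `^ (1 - H) = (2 ^+ n) `^ (- (1 - H)) :> R.
    by rewrite -(powR_inv1 (ltW (p0 n))) -powRrM mulN1r.
  rewrite !powRN lef_pV2 ?posrE ?powR_gt0//.
  apply: ge0_ler_powR; rewrite ?nnegrE ?subr_ge0 ?(ltW (p0 _)) ?(ltW y0)//.
  rewrite ler_pdivlMr//.
  apply: (@le_trans _ _ (2 ^+ n * (2 * 2 ^ (3 * n))%:R)).
    by apply: ler_wpM2l; [exact: ltW|rewrite ler_nat].
  rewrite natrM natrX /M.
  have -> : (4 * n = n + 3 * n)%N by rewrite -mulSn.
  rewrite exprD; have := mulr_ge0 (ltW (p0 n)) (ltW (p0 (3 * n)%N)); lra.
have cp : 0 <= c * (5 * 2 ^- n) by rewrite mulr_ge0// ltW.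
apply: (le_trans (ler_wpM2l cp (le_trans hy yH))).
have -> : c * (5 * 2 ^- n) * (y * (2 ^- n) `^ (1 - H)) = 20 * c * (T / e%:R).
  rewrite /T /y; have -> : (2 ^- n) `^ (2 - H) = 2 ^- n * (2 ^- n) `^ (1 - H) :> R.
    have i0 : 0 < 2 ^- n :> R by rewrite invr_gt0.
    rewrite -{2}(powRr1 (ltW i0)) -powRD; last by rewrite (gt_eqF i0) implybT.
    by congr (_ `^ _); ring.
  ring.
by rewrite -[X in _ <= X]mulrA; apply: ler_wpM2r => //; exact: ltW.
Qed.

(** The radius [5 * 2 ^- n] leaves room to replace the limit function by its
    approximation at depth [L], up to [2 ^- n] at each of the two points, in a
    count with radius [3 * 2 ^- n]. *)
Definition near_cells n i s j : bool :=
  (`|gridpt n i - gridpt n j| <= 2 * 2 ^- n :> R)%R &&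
  (`|F s (gridpt n i) - F s (gridpt n j)| <= 5 * 2 ^- n)%R.

Definition near_count n i s : R := \sum_(0 <= j < 2 ^ (4 * n)) (near_cells n i s j)%:R.

Lemma gridpt_dist n i j : (i <= j)%N -> `|gridpt n i - gridpt n j| <= 2 * 2 ^- n :> R ->
  (j - i <= 2 * 2 ^ (3 * n))%N.
Proof.
move=> ij; rewrite distrC /gridpt -mulrBl -natrB// ger0_norm ?divr_ge0 ?exprn_ge0//.
have p0 m : 0 < 2 ^+ m :> R by rewrite exprn_gt0.
rewrite ler_pdivrMr//.
have -> : 2 * 2 ^- n * 2 ^+ (4 * n) = (2 * 2 ^ (3 * n))%:R :> R.
  have -> : (4 * n = n + 3 * n)%N by rewrite -mulSn.
  by rewrite exprD natrM natrX mulrA divfK// gt_eqF.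
by rewrite ler_nat.
Qed.

Lemma expected_count n i : (i < 2 ^ (4 * n))%N -> (4 * n < L)%N ->
  h ^+ L <= freq0 m2 * (5 * 2 ^- n) ->
  E (near_count n i) <= (1 + 8 * `|pair_cst|) * (n.+1%:R * (2 ^+ (4 * n) * (2 ^- n) `^ (2 - H))).
Proof.
move=> iN ML hL.
have p0 m : 0 < 2 ^+ m :> R by rewrite exprn_gt0.
set T := 2 ^+ (4 * n) * (2 ^- n) `^ (2 - H).
have T1 : 1 <= T.
  rewrite /T -(powR_inv1 (ltW (p0 n))) -powRrM.
  have -> : 2 ^+ (4 * n) = (2 ^+ n) `^ 4%:R :> R.
    by rewrite powR_mulrn ?(ltW (p0 n))// -exprM mulnC.
  rewrite -powRD; last by rewrite (gt_eqF (p0 n)) implybT.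
  apply: (@le_trans _ _ ((2 ^+ n) `^ 0)); first by rewrite powRr0.
  apply: ler_powR; first by rewrite exprn_ege1// ler1n.
  by move: H_gt; lra.
have pc := normr_ge0 pair_cst.
have term j : (j < 2 ^ (4 * n))%N -> E (fun s => (near_cells n i s j)%:R) <=
    (j == i)%:R + `|pair_cst| * T * ((j - i)%N%:R^-1 + (i - j)%N%:R^-1).
  move=> jN.
  have le1 s : (near_cells n i s j)%:R <= 1 :> R by case: (near_cells _ _ _ _).
  have inv0 m : 0 <= m%:R^-1 :> R by rewrite invr_ge0.
  have PT : 0 <= `|pair_cst| * T by rewrite mulr_ge0// (le_trans _ T1).
  have E1 : E (fun s => (near_cells n i s j)%:R) <= 1.
    by rewrite -[X in _ <= X](avg_cst p l 1 s0); apply: (ler_avg p01) => s; exact: le1.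
  have [ji|ji] := eqVneq j i.
    by apply: (le_trans E1); rewrite ji subnn invr0 addr0 mulr0 addr0.
  rewrite add0r.
  have [far|close] := boolP (`|gridpt n i - gridpt n j| <= 2 * 2 ^- n :> R)%R; last first.
    rewrite (@eq_avg _ _ _ _ _ (fun=> 0)) ?avg_cst ?mulr_ge0 ?addr_ge0//.
    by move=> s; rewrite /near_cells (negbTE close).
  move: ji; rewrite neq_ltn => /orP[ji|ij].
    have e1 := @gridpt_dist n j i (ltnW ji); rewrite distrC in e1.
    apply: (le_trans (le_trans (ler_avg p01 l s0 _)
      (pair_bound ji (ltnW iN) ML hL (e1 far)))).
      by move=> s; rewrite /near_cells; case: (X in X && _); case: (X in (_ && X)%:R <= _) => //=.
    by rewrite (eqP (ltnW ji)) invr0 add0r.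
  have e1 := @gridpt_dist n i j (ltnW ij) far.
  apply: (le_trans (le_trans (ler_avg p01 l s0 _)
      (pair_bound ij (ltnW jN) ML hL e1))).
    by move=> s; rewrite /near_cells distrC [`|F _ _ - F _ _|]distrC; case: (_ <= 2 * 2 ^- n) => //=.
  by rewrite (eqP (ltnW ij)) invr0 addr0.
rewrite /near_count avg_sum.
apply: (@le_trans _ _ (\sum_(0 <= j < 2 ^ (4 * n)) ((j == i)%:R +
   `|pair_cst| * T * ((j - i)%N%:R^-1 + (i - j)%N%:R^-1)))).
  by rewrite big_nat [X in _ <= X]big_nat; apply: ler_sum => j /andP[_ jN]; exact: term.
rewrite big_split /= -mulr_sumr.
have -> : \sum_(0 <= j < 2 ^ (4 * n)) (j == i)%:R = 1 :> R.
  rewrite (bigD1_seq i) ?iota_uniq ?mem_index_iota//= eqxx big1 ?addr0//.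
  by move=> j /negbTE ->.
have PT : 0 <= `|pair_cst| * T by rewrite mulr_ge0// (le_trans _ T1).
have S := le_trans (@sum_dist_inv R _ _ iN) (ler_wpM2l (ler0n _ 2) (harm_pow2 (4 * n))).
apply: (le_trans (lerD (lexx 1) (ler_wpM2l PT S))).
rewrite natrM -natr1; have n0 := ler0n R n.
have : n%:R <= n%:R * T by rewrite ler_peMr.
have := mulr_ge0 PT n0; rewrite mulrDl; nra.
Qed.

(** A cell is bad when the graph has too much mass near it for dimension [g]. *)
Definition is_bad (g : R) n i s : bool := (2 ^+ (4 * n) * (2 ^- n) `^ g < near_count n i s)%R.

Definition bad_fraction g n s : R :=
  2 ^- (4 * n) * \sum_(0 <= i < 2 ^ (4 * n)) (is_bad g n i s)%:R.

(** Markov's inequality: for [g < 2 - H] bad cells are exponentially rare. *)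
Lemma expected_bad g n : (4 * n < L)%N -> h ^+ L <= freq0 m2 * (5 * 2 ^- n) ->
  E (bad_fraction g n) <= (1 + 8 * `|pair_cst|) * (n.+1%:R * (2 ^- n) `^ (2 - H - g)).
Proof.
move=> ML hL.
have p0 m : 0 < 2 ^+ m :> R by rewrite exprn_gt0.
have i0 : 0 < 2 ^- n :> R by rewrite invr_gt0.
set V := 2 ^+ (4 * n) * (2 ^- n) `^ g.
have V0 : 0 < V by rewrite mulr_gt0// powR_gt0.
have nc0 i s : 0 <= near_count n i s by apply: sumr_ge0.
have markov i s : (is_bad g n i s)%:R <= V^-1 * near_count n i s.
  rewrite /is_bad -/V; case: ltP => [H1|_] /=; last by rewrite mulr_ge0// invr_ge0 ltW.
  by rewrite ler_pdivlMl// mulr1 ltW.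
rewrite /bad_fraction avgZ avg_sum ler_pdivrMl//.
set B := (1 + _) * _.
apply: (@le_trans _ _ (\sum_(0 <= i < 2 ^ (4 * n)) B)); last first.
  by rewrite sumr_const_nat subn0 -[X in X <= _]mulr_natl natrX.
rewrite big_nat [X in _ <= X]big_nat; apply: ler_sum => i /andP[_ iN].
apply: (le_trans (ler_avg p01 l s0 (markov i))); rewrite avgZ ler_pdivrMl//.
apply: (le_trans (expected_count iN ML hL)).
have -> : (2 ^- n) `^ (2 - H) = (2 ^- n) `^ g * (2 ^- n) `^ (2 - H - g) :> R.
  rewrite -powRD; last by rewrite (gt_eqF i0) implybT.
  by congr (_ `^ _); ring.
by apply: eq_ler; rewrite /B /V; ring.
Qed.

End Fixed.
End ExpectedCounts.

(** * Constants attached to the exponent *)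

Lemma tail_half (R : realType) (Y : nat -> R) (K : R) : (forall n, 0 <= Y n) ->
  (forall N, \sum_(0 <= n < N) Y n <= K) ->
  exists n0, forall N, \sum_(0 <= n < N) ((n0 <= n)%N%:R * Y n) <= 2^-1.
Proof.
move=> Y0 YK; pose S := [set \sum_(0 <= n < N) Y n | N in [set: nat]].
have supS : has_sup S.
  split; first by exists (\sum_(0 <= n < 0) Y n); exists 0%N.
  by exists K => _ [N _ <-].
have [_ [n0 _ <-] Hn] := @sup_adherent R S 2^-1 ltac:(by rewrite invr_gt0) supS.
exists n0 => N.
have bound M : \sum_(0 <= n < M) Y n <= sup S.
  by apply: ub_le_sup; [case: supS|exists M].
have [Nn|nN] := leqP N n0.
  rewrite big_nat big1 ?invr_ge0// => n /andP[_ nN].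
  by rewrite leqNgt (leq_trans nN Nn) mul0r.
rewrite (@big_cat_nat _ _ _ n0 0 N)//=; last exact: ltnW.
rewrite big_nat big1 ?add0r; last by move=> n /andP[_ nn]; rewrite leqNgt nn mul0r.
have := bound N; rewrite (@big_cat_nat _ _ _ n0 0 N)//=; last exact: ltnW.
have -> : \sum_(n0 <= n < N) ((n0 <= n)%N%:R * Y n) = \sum_(n0 <= n < N) Y n.
  by apply: eq_big_nat => n /andP[-> _]; rewrite mul1r.
move: Hn; lra.
Qed.

Section Constants.
Context {R : realType}.
Variable (H : R).
Hypotheses (H_gt : 2^-1 < H) (H_le : H <= 1).
Local Notation h := (2 `^ (- H) : R).
Local Notation a := (2 `^ (H - 1) : R).

Lemma h_gt0 : 0 < h. Proof. by rewrite powR_gt0. Qed.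

Lemma h_a : 2 * h * a = 1.
Proof.
rewrite -mulrA -powRD; last by rewrite pnatr_eq0 implybT.
rewrite -{1}(powRr1 (_ : 0 <= 2)) // -powRD; last by rewrite pnatr_eq0 implybT.
by rewrite (_ : 1 + _ = 0) ?powRr0//; ring.
Qed.

Lemma h_ge : 1 <= 2 * h.
Proof.
have -> : 2 * h = 2 `^ (1 - H) by rewrite powRD ?powRr1// pnatr_eq0 implybT.
apply: (@le_trans _ _ (2 `^ 0)); first by rewrite powRr0.
by apply: ler_powR; rewrite ?ler1n// subr_ge0.
Qed.

Lemma h_lt : 2 * h ^+ 2 < 1.
Proof.
have -> : 2 * h ^+ 2 = 2 `^ (1 - H - H).
  by rewrite expr2 -!powRD ?powRD ?powRr1 ?pnatr_eq0 ?implybT// mulrA.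
rewrite -[X in _ < X](powRr0 (2 : R)) /powR pnatr_eq0 /= ltr_expR ltr_pM2r ?ln_gt0 ?ltr1n//.
by move: H_gt; lra.
Qed.

Lemma h_le1 : h <= 1.
Proof. by have := h_lt; have := sqr_ge0 (h - 1); nra. Qed.

(** The geometric rate of the increments of the masses in the mean square. *)
Definition kap : R := Num.sqrt 2 * h.

Lemma kapE : kap ^+ 2 = 2 * h ^+ 2.
Proof. by rewrite exprMn sqr_sqrtr. Qed.

Lemma kap_gt0 : 0 < kap.
Proof. by rewrite mulr_gt0 ?sqrtr_gt0 ?h_gt0. Qed.

Lemma kap_lt1 : kap < 1.
Proof.
rewrite -(@ltr_pXn2r _ 2) ?nnegrE ?(ltW kap_gt0)//.
by rewrite expr1n kapE h_lt.
Qed.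

(** The fixed point of the recursion satisfied by the second moments, up to the
    value of its constant term. *)
Definition msq : R := (1 - 2 * h ^+ 2)^-1.

Lemma msq_ge1 : 1 <= msq.
Proof.
rewrite /msq invf_ge1 ?subr_gt0 ?h_lt// gerBl mulr_ge0// sqr_ge0//.
Qed.

Lemma msq_rec : 2 * h ^+ 2 * msq + 2^-1 <= msq.
Proof.
have : (1 - 2 * h ^+ 2) * msq = 1.
  by rewrite /msq divff// gt_eqF// subr_gt0 h_lt.
lra.
Qed.

(** The largest base used below: it stays above [1] while [base * kap < 1], so
    that the approximations still converge geometrically. *)
Definition base : R := (1 + kap^-1) / 2.

Lemma base_gt1 : 1 < base.
Proof.
have : 1 < kap^-1 by rewrite invf_gt1 ?kap_gt0 ?kap_lt1.
rewrite /base; lra.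
Qed.

Lemma base_kap : base * kap < 1.
Proof.
have -> : base * kap = (kap + 1) / 2.
  by rewrite /base; field; rewrite gt_eqF ?kap_gt0.
by have := kap_lt1; lra.
Qed.

Lemma base_le2 : base <= 2.
Proof.
have h1 : 2^-1 <= h by have := h_ge; lra.
have k2 : 2^-1 <= kap.
  rewrite /kap (le_trans h1)// ler_peMl ?(ltW h_gt0)//.
  by rewrite -{1}(sqrtr1 R) ler_wsqrtr// ler1n.
have : kap^-1 <= 2 by rewrite invf_ple ?posrE ?kap_gt0.
rewrite /base; lra.
Qed.

End Constants.

(** * Almost sure regularity, oscillation and scarcity of bad cells *)

Section Events.
Context {R : realType} {d : measure_display} {Omega : measurableType d}.
Variables (P : probability Omega R) (H : R).
Hypotheses (H_gt : 2^-1 < H) (H_le : H <= 1).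
Variable (eps : word -> {RV P >-> R}).
Hypotheses (eps_val : forall w omega, eps w omega = 1 \/ eps w omega = -1)
  (eps_pos : forall w, P [set omega | eps w omega = 1] = ((1 + 2 `^ (H - 1)) / 2)%:E)
  (eps_neg : forall w, P [set omega | eps w omega = -1] = ((1 - 2 `^ (H - 1)) / 2)%:E)
  (eps_indep : mutually_independent eps).
Local Notation h := (2 `^ (- H) : R).
Local Notation a := (2 `^ (H - 1) : R).
Local Notation p := (upprob a).
Local Notation k := (kap H).
Local Notation Z n w s := (mass h (sg s) n w).
Local Notation cf := (conf eps).

Let s0 : word -> bool := fun=> true.
Let lN N w : (size w <= N)%N -> w \in undup (tree N).
Proof. by rewrite mem_undup mem_tree. Qed.

Lemma eps_pos' w : P [set omega | eps w omega = 1] = p%:E.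
Proof. exact: eps_pos. Qed.

Lemma eps_neg' w : P [set omega | eps w omega = -1] = (1 - p)%:E.
Proof. by rewrite eps_neg; congr EFin; rewrite /upprob; field. Qed.

Let p01 : 0 <= p <= 1. Proof. exact: upprob01 (h_a H) (h_ge H_le). Qed.

Lemma casc_depends_tree N n w t : (size w + n <= N)%N ->
  depends (mem (tree N)) (fun s => casc h (sg s) n w t).
Proof.
move=> wn; apply: (dependsW _ (@casc_depends R h n w t)) => i /andP[_ iw].
by rewrite -topredE /= mem_tree (leq_trans iw wn).
Qed.

(** The [q]-th powers of the normalized increments of the masses that end at
    depth [n], over all nodes [v] of depth at most [n]. Being defined everywhere
    and integrable, their sum gives a random constant for [regular] with explicit
    moments, which the convergence in [L^q] requires. *)
Definition moment_term (b : R) (q n : nat) s : R :=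
  \sum_(0 <= i < n.+1) \sum_(v : i.-tuple bool)
    ((Z (n - i).+1 v s - Z (n - i) v s) / k ^+ (n - i) / b ^+ n) ^+ q.

Lemma moment_term_depends b q n : depends (mem (tree n.+1)) (moment_term b q n).
Proof.
move=> s s' ss; rewrite /moment_term; apply: eq_big_nat => i /andP[_ ni].
apply: eq_bigr => v _; have sv : size v = i := size_tuple v.
congr ((_ / _ / _) ^+ _); congr (_ - _).
  by apply: (@casc_depends_tree n.+1 (n - i).+1 v 1 _ s s' ss); rewrite sv; move: ni; clear; lia.
by apply: (@casc_depends_tree n.+1 (n - i) v 1 _ s s' ss); rewrite sv; move: ni; clear; lia.
Qed.

Section Moments.
Variables (b : R) (q : nat).
Hypotheses (b1 : 1 < b) (q0 : (0 < q)%N) (qe : ~~ odd q) (bq : 4 <= b ^+ q).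

Lemma moment_term_ge0 n s : 0 <= moment_term b q n s.
Proof.
by apply: sumr_ge0 => i _; apply: sumr_ge0 => v _; rewrite exprn_even_ge0.
Qed.

Definition moment_cst : R := 2 * (2 * q%:R ^+ q * expR 8).

Lemma moment_cst_ge0 : 0 <= moment_cst.
Proof. by rewrite !mulr_ge0 ?exprn_ge0 ?expR_ge0. Qed.

(** The even order [q] is chosen with [b ^ q >= 4]: one factor [2 ^ n] absorbs
    the number of nodes, the other one makes the series converge. *)
Lemma avg_moment_term n :
  avg p (undup (tree n.+1)) (moment_term b q n) s0 <= moment_cst * 2^-1 ^+ n.
Proof.
have b0 : 0 < b by rewrite (lt_trans ltr01).
rewrite /moment_term avg_sum.
apply: (@le_trans _ _ (\sum_(0 <= i < n.+1) 2 ^+ i * (2 * q%:R ^+ q * expR 8 / 4 ^+ n))).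
  rewrite big_nat [X in _ <= X]big_nat; apply: ler_sum => i /andP[_ ni].
  rewrite avg_sum.
  have -> : 2 ^+ i * (2 * q%:R ^+ q * expR 8 / 4 ^+ n) =
     \sum_(v : i.-tuple bool) (2 * q%:R ^+ q * expR 8 / 4 ^+ n) :> R.
    by rewrite sumr_const card_tuple card_bool -[RHS]mulr_natl natrX.
  apply: ler_sum => v _.
  rewrite (@eq_avg _ _ _ _ _ (fun s => (b ^+ q) ^- n *
      ((Z (n - i).+1 v s - Z (n - i) v s) / k ^+ (n - i)) ^+ q)); last first.
    by move=> s; rewrite [in RHS]mulrC exprMn exprVn -!exprM mulnC.
  rewrite avgZ mulrC; apply: ler_pM.
  - apply: (avg_ge0 p01) => s; exact: exprn_even_ge0.
  - by rewrite invr_ge0 !exprn_ge0// ltW.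
  - apply: (avg_dmass_pow s0 (h_a H) (h_ge H_le) (h_lt H_gt) (@lN n.+1) q0 qe (kap_gt0 H) (kapE H)).
    by rewrite size_tuple; move: ni; clear; lia.
  - rewrite lef_pV2 ?posrE ?exprn_gt0//.
    by apply: lerXn2r; rewrite ?nnegrE ?exprn_ge0// ltW.
rewrite -mulr_suml.
have S : \sum_(0 <= i < n.+1) 2 ^+ i <= 2 * 2 ^+ n :> R.
  elim: n => [|n IH]; first by rewrite big_nat1 expr0; lra.
  rewrite big_nat_recr//=; move: IH; rewrite !exprS; lra.
have C : 0 <= 2 * q%:R ^+ q * expR 8 / 4 ^+ n :> R.
  by rewrite !mulr_ge0 ?exprn_ge0 ?expR_ge0// invr_ge0 exprn_ge0.
apply: (le_trans (ler_wpM2r C S)).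
have -> : 4 ^+ n = 2 ^+ n * 2 ^+ n :> R by rewrite -exprMn; congr (_ ^+ _); ring.
rewrite /moment_cst exprVn; apply: eq_ler; field.
by rewrite expf_neq0.
Qed.

Lemma regular_of_moments (K : R) s : 0 <= K -> (forall n, moment_term b q n s <= K ^+ q) ->
  regular h k (sg s) K b.
Proof.
move=> K0 HK m v; set n := (size v + m)%N.
have b0 : 0 < b by rewrite (lt_trans ltr01).
have kn : 0 < k ^+ m by rewrite exprn_gt0// kap_gt0.
have bn : 0 < b ^+ n by rewrite exprn_gt0.
pose D := (Z m.+1 v s - Z m v s) / k ^+ m / b ^+ n.
have DK : D ^+ q <= K ^+ q.
  apply: le_trans (HK n); rewrite /moment_term.
  have sn : (size v < n.+1)%N by rewrite ltnS leq_addr.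
  rewrite (bigD1_seq (size v)) ?iota_uniq ?mem_index_iota//=.
  rewrite -[X in X <= _]addr0; apply: lerD; last first.
    by apply: sumr_ge0 => i _; apply: sumr_ge0 => v' _; rewrite exprn_even_ge0.
  rewrite (bigD1 (in_tuple v))//= /n addKn.
  rewrite -[X in X <= _]addr0; apply: lerD; first by [].
  by apply: sumr_ge0 => v' _; rewrite exprn_even_ge0.
have D1 : `|D| <= K.
  rewrite -(@ler_pXn2r _ q) ?nnegrE// -normrX ger0_norm//.
  exact: exprn_even_ge0.
move: D1; rewrite /D !normrM !normfV (gtr0_norm kn) (gtr0_norm bn).
rewrite ler_pdivrMr// ler_pdivrMr// => H1; apply: (le_trans H1).
by rewrite /n exprD [(b * k) ^+ m]exprMn; apply: eq_ler; ring.
Qed.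

Definition moment_series omega : \bar R :=
  (\sum_(0 <= n <oo) (moment_term b q n (cf omega))%:E)%E.

Lemma moment_series_ge0 omega : (0 <= moment_series omega)%E.
Proof. by apply: nneseries_ge0 => n _ _; rewrite lee_fin moment_term_ge0. Qed.

Lemma moment_series_measurable : measurable_fun setT moment_series.
Proof.
apply: ge0_emeasurable_sum => n; first by move=> omega _ _; rewrite lee_fin moment_term_ge0.
move=> _; apply/measurable_EFinP.
exact: (conf_measurable eps_val eps_pos' eps_neg' eps_indep (@moment_term_depends b q n)).
Qed.

Lemma moment_series_integral : (\int[P]_omega moment_series omega <= (moment_cst / (1 - 2^-1))%:E)%E.
Proof.
apply: (integral_conf_series eps_val eps_pos' eps_neg' eps_indep (l := fun n => tree n.+1)
   (s0 := s0)).
- exact: moment_term_ge0.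
- exact: moment_term_depends.
- by apply/andP; split; lra.
- exact: moment_cst_ge0.
- exact: avg_moment_term.
Qed.

(** Each increment is one term of the series, hence bounded by the [q]-th root of
    its sum. *)
Lemma regular_of_series omega (K : R) : 0 <= K -> (moment_series omega <= (K ^+ q)%:E)%E ->
  regular h k (fun v => eps v omega) K b.
Proof.
move=> K0 HK.
have -> : (fun v => eps v omega) = sg (cf omega) :> (word -> R).
  by apply/funext => v; rewrite sg_conf.
apply: regular_of_moments => // n; rewrite -lee_fin; apply: le_trans HK.
apply: le_trans (nneseries_lim_ge n.+1 _); last first.
  by move=> i _ _; rewrite lee_fin moment_term_ge0.
rewrite sumEFin lee_fin big_nat_recr//= lerDr; apply: sumr_ge0 => i _.
exact: moment_term_ge0.
Qed.

Lemma moment_series_integrable : P.-integrable setT moment_series.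
Proof.
apply/integrableP; split; first exact: moment_series_measurable.
under eq_integral do rewrite gee0_abs ?moment_series_ge0//.
exact: le_lt_trans moment_series_integral (ltry _).
Qed.

Lemma ae_moment_series : {ae P, forall omega, moment_series omega \is a fin_num}.
Proof.
have := integrable_ae measurableT moment_series_integrable.
by apply: filterS => omega /(_ Logic.I).
Qed.

Lemma regular_of_fin omega : moment_series omega \is a fin_num ->
  exists2 K : R, 1 <= K & regular h k (fun v => eps v omega) K b.
Proof.
move=> Sf; have S0 := moment_series_ge0 omega.
exists (1 + fine (moment_series omega)); first by rewrite lerDl fine_ge0.
have x0 : 0 <= fine (moment_series omega) by rewrite fine_ge0.
apply: regular_of_series; first by rewrite addr_ge0.
rewrite -(fineK Sf) lee_fin.
apply: (@le_trans _ _ (1 + fine (moment_series omega))); first by rewrite lerDr.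
by apply: ler_eXnr => //; rewrite lerDl.
Qed.

End Moments.

Lemma exists_moment_order (b : R) m : 1 < b -> exists q, [/\ (0 < q)%N, ~~ odd q, 4 <= b ^+ q & (m <= q)%N].
Proof.
move=> b1.
have [n nb] : exists n, 4 <= b ^+ n.
  pose n := (Num.truncn (4 / (b - 1))).+1.
  exists n; have bb : 0 < b - 1 by rewrite subr_gt0.
  have H1 : 4 <= 1 + (b - 1) *+ n.
    have := truncnS_gt (4 / (b - 1)); rewrite -/n ltr_pdivrMr// -mulr_natl; lra.
  apply: (le_trans H1).
  have : 1 + (b - 1) *+ n <= (1 + (b - 1)) ^+ n.
    elim: n {H1} => [|n IH]; first by rewrite mulr0n expr0 addr0.
    rewrite mulrS exprSr.
    have x0 : 0 <= (b - 1) *+ n by rewrite mulrn_wge0// ltW.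
    have b0 : 0 <= 1 + (b - 1) by lra.
    apply: (le_trans _ (ler_wpM2r b0 IH)).
    have := mulr_ge0 x0 (ltW bb); lra.
  by have -> : 1 + (b - 1) = b by ring.
exists (2 * (n + m).+1)%N; split.
- by rewrite muln_gt0.
- by rewrite oddM.
- apply: (le_trans nb); rewrite ler_weXn2l ?(ltW b1)//; clear; lia.
- clear; lia.
Qed.

Lemma ae_regular (b : R) : 1 < b -> {ae P, forall omega, exists2 K : R, 1 <= K &
  regular h k (fun v => eps v omega) K b}.
Proof.
move=> b1; have [q [q0 qe bq _]] := exists_moment_order 0 b1.
have := ae_moment_series b1 q0 qe bq; apply: filterS => omega.
exact: (regular_of_fin b1 q0 qe).
Qed.

End Events.

(** The left side is [(2 * rho ^+ (2 ^ m)) ^+ (2 ^ m)]. *)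
Lemma pow_pow_le (R : realType) (rho : R) : 0 <= rho < 1 ->
  exists2 C : R, 0 <= C & forall m, 2 ^+ (2 ^ m) * rho ^+ (2 ^ (2 * m)) <= C * 2^-1 ^+ m.
Proof.
move=> /andP[r0 r1].
have [n1 _ Hn1] : \forall n \near \oo, `|rho ^+ n| < 4^-1.
  have : rho ^+ n @[n --> \oo] --> 0 by apply: cvg_expr; rewrite ger0_norm.
  by move/cvgr0Pnorm_lt; apply; rewrite invr_gt0.
exists (4 ^+ n1); first by rewrite exprn_ge0.
move=> m; rewrite mul2n -addnn expnD exprM -exprMn.
set n := (2 ^ m)%N.
have mn : (m <= n)%N by rewrite ltnW// ltn_expl.
have i0 : 0 <= 2^-1 ^+ m :> R by rewrite exprn_ge0.
have rn0 : 0 <= rho ^+ n by rewrite exprn_ge0.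
have [n1n|nn1] := leqP n1 n.
  have := Hn1 n n1n; rewrite ger0_norm// => rn.
  apply: (@le_trans _ _ (2^-1 ^+ n)).
    apply: lerXn2r; rewrite ?nnegrE ?mulr_ge0// ?invr_ge0//; lra.
  apply: (@le_trans _ _ (2^-1 ^+ m)); first by apply: ler_wiXn2l => //; lra.
  by rewrite ler_peMl// exprn_ege1// ler1n.
have rn1 : rho ^+ n <= 1 by rewrite exprn_ile1// ltW.
apply: (@le_trans _ _ (2 ^+ n)).
  by apply: lerXn2r; rewrite ?nnegrE ?mulr_ge0//; lra.
have -> : 4 ^+ n1 = 2 ^+ n1 * 2 ^+ n1 :> R by rewrite -exprMn; congr (_ ^+ _); ring.
apply: (@le_trans _ _ (2 ^+ n1)); first by rewrite ler_weXn2l ?ler1n// ltnW.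
rewrite -mulrA ler_peMr ?exprn_ge0// exprVn ler_pdivlMr ?exprn_gt0// mul1r.
by rewrite ler_weXn2l ?ler1n// (leq_trans mn (ltnW nn1)).
Qed.

(** [y ^+ n] is the smallest of the first [n.+1] terms of the geometric series. *)
Lemma linear_geom_le (R : realType) (y : R) n : 0 < y < 1 ->
  n.+1%:R * (y ^+ n * y ^+ n) <= (1 - y)^-1 * y ^+ n.
Proof.
move=> /andP[y0 y1]; rewrite mulrA; apply: ler_wpM2r; first by rewrite exprn_ge0// ltW.
have T : 0 <= y < 1 by rewrite ltW.
apply: le_trans (@sum_geom_le R y n.+1 T).
have -> : n.+1%:R * y ^+ n = \sum_(0 <= i < n.+1) y ^+ n.
  by rewrite sumr_const_nat subn0 mulr_natl.
rewrite big_nat [X in _ <= X]big_nat; apply: ler_sum => i /andP[_ ni].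
by apply: ler_wiXn2l; rewrite ?ltW.
Qed.

Section Events2.
Context {R : realType} {d : measure_display} {Omega : measurableType d}.
Variables (P : probability Omega R) (H : R).
Hypotheses (H_gt : 2^-1 < H) (H_le : H <= 1).
Variable (eps : word -> {RV P >-> R}).
Hypotheses (eps_val : forall w omega, eps w omega = 1 \/ eps w omega = -1)
  (eps_pos : forall w, P [set omega | eps w omega = 1] = ((1 + 2 `^ (H - 1)) / 2)%:E)
  (eps_neg : forall w, P [set omega | eps w omega = -1] = ((1 - 2 `^ (H - 1)) / 2)%:E)
  (eps_indep : mutually_independent eps).
Local Notation h := (2 `^ (- H) : R).
Local Notation a := (2 `^ (H - 1) : R).
Local Notation p := (upprob a).
Local Notation Z n w s := (mass h (sg s) n w).
Local Notation cf := (conf eps).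

Let s0 : word -> bool := fun=> true.
Let lN N w : (size w <= N)%N -> w \in undup (tree N).
Proof. by rewrite mem_undup mem_tree. Qed.

Let p01 : 0 <= p <= 1. Proof. exact: upprob01 (h_a H) (h_ge H_le). Qed.

Lemma sg_cf omega : sg (cf omega) = (fun v => eps v omega) :> (word -> R).
Proof. by apply/funext => v; rewrite sg_conf. Qed.

Lemma allsmall_depends_tree N n m w : (size w + m + n <= N)%N ->
  depends (mem (tree N)) (allsmall h n m w).
Proof.
elim: m w => [|m IH] w wN /= s s' ss.
  rewrite /small /mass (casc_depends_tree H (N := N) 1 _ ss)//.
  by rewrite addn0 in wN.
by rewrite (IH (rcons w false) _ _ _ ss) ?(IH (rcons w true) _ _ _ ss)// size_rcons;
  move: wN; clear; lia.
Qed.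

Lemma allsmall01 n m w s : allsmall h n m w s = 0 \/ allsmall h n m w s = 1.
Proof.
elim: m w => [|m IH] w /=.
  by rewrite /small; case: (_ <= _); [right|left].
case: (IH (rcons w false)) => ->; first by left; rewrite mul0r.
by case: (IH (rcons w true)) => ->; rewrite mul1r; [left|right].
Qed.

(** Every dyadic interval of generation [2 ^ m] contains, only [2 m] generations
    below, one whose mass is not small. Indeed the masses of its [2 ^ (2 m)]
    descendants are independent, so that all are small with probability
    [rho ^ (4 ^ m)], which beats the number [2 ^ (2 ^ m)] of intervals. The depth
    [A * 2 ^ m] of the masses is free, to be compared with the limit later. *)
Lemma ae_oscillation A : {ae P, forall omega, exists m0, forall m, (m0 <= m)%N ->
  forall w, size w = (2 ^ m)%N -> exists2 v, size v = (2 * m)%N &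
    2^-1 < mass h (fun u => eps u omega) (A * 2 ^ m) (w ++ v)}.
Proof.
pose rho : R := 1 - (4 * msq H)^-1.
have m41 : 1 < 4 * msq H by have := msq_ge1 H_gt; lra.
have rho01 : 0 <= rho < 1.
  rewrite /rho subr_ge0 invf_le1 ?(lt_trans ltr01)// (ltW m41)/= gtrBl invr_gt0.
  exact: lt_trans ltr01 m41.
have [C C0 HC] := pow_pow_le rho01.
pose N m := (2 ^ m + 2 * m + A * 2 ^ m)%N.
pose Y m s : R := \sum_(w : (2 ^ m).-tuple bool) allsmall h (A * 2 ^ m) (2 * m) w s.
have Y0 m s : 0 <= Y m s by apply: sumr_ge0 => w _; exact: allsmall_ge0.
have dY m : depends (mem (tree (N m))) (Y m).
  move=> s s' ss; apply: eq_bigr => w _; apply: (allsmall_depends_tree _ ss).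
  by rewrite size_tuple.
have EY m : avg p (undup (tree (N m))) (Y m) s0 <= C * 2^-1 ^+ m.
  apply: le_trans (HC m); rewrite avg_sum.
  have -> : 2 ^+ (2 ^ m) * rho ^+ (2 ^ (2 * m)) =
      \sum_(w : (2 ^ m).-tuple bool) rho ^+ (2 ^ (2 * m)).
    by rewrite sumr_const card_tuple card_bool -[RHS]mulr_natl natrX.
  apply: ler_sum => w _.
  apply: (avg_allsmall s0 (h_a H) (h_ge H_le) (h_lt H_gt) (@lN (N m)) (msq_ge1 H_gt) (msq_rec H_gt)).
  by rewrite size_tuple.
have half01 : 0 <= (2^-1 : R) < 1 by apply/andP; split; lra.
have := ae_bounded_series eps_val (eps_pos' eps_pos) (eps_neg' eps_neg) eps_indep Y0 dY half01 C0 EY.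
apply: filterS => omega [K HK].
have [m0 Hm] := tail_half (fun n => Y0 n (cf omega)) HK.
exists m0 => m mm w sw.
have Ym : Y m (cf omega) <= 2^-1.
  apply: le_trans (Hm m.+1); rewrite big_nat_recr//= mm mul1r lerDr.
  by apply: sumr_ge0 => i _; rewrite mulr_ge0.
have sw' : size w == (2 ^ m)%N by rewrite sw.
have aw : allsmall h (A * 2 ^ m) (2 * m) w (cf omega) = 0.
  case: (allsmall01 (A * 2 ^ m) (2 * m) w (cf omega)) => // a1.
  have : allsmall h (A * 2 ^ m) (2 * m) w (cf omega) <= Y m (cf omega).
    rewrite /Y (bigD1 (Tuple sw'))//= lerDl.
    by apply: sumr_ge0 => v _; exact: allsmall_ge0.
  by rewrite a1; move: Ym; lra.
by have [v sv] := allsmall0 aw; rewrite sg_cf => zv; exists v.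
Qed.

(** The depth of the approximation observed at scale [n]; the constant [L0] makes
    the smallest scale of the cascade negligible at the radius [5 * 2 ^- n]. *)
Definition bad_level A L0 n := (A * n + L0)%N.

Lemma ae_bad_cells_summable A : (4 <= A)%N -> exists L0, forall g, g < 2 - H ->
  {ae P, forall omega, exists n0, forall n1, (n0 <= n1)%N -> forall N,
     \sum_(0 <= n < N) ((n1 <= n)%N%:R *
       bad_fraction h (bad_level A L0 n) g n (cf omega)) <= 2^-1}.
Proof.
move=> A4.
have x0 : 0 < freq0 (msq H).
  by rewrite /freq0 invr_gt0 mulr_gt0// (lt_le_trans ltr01 (msq_ge1 H_gt)).
have h0 := h_gt0 H; have hl := h_lt H_gt.
have h1 : h < 1 by have := sqr_ge0 (h - 1); nra.
have [L0 L00 hL0] : exists2 L0, (0 < L0)%N & h ^+ L0 <= freq0 (msq H).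
  have [n1 _ Hn1] : \forall n \near \oo, `|h ^+ n| < freq0 (msq H).
    have : h ^+ n @[n --> \oo] --> 0 by apply: cvg_expr; rewrite ger0_norm// ltW.
    by move/cvgr0Pnorm_lt; apply.
  exists n1.+1 => //; have := Hn1 n1.+1 (leqnSn n1).
  by rewrite ger0_norm ?exprn_ge0 ?(ltW h0)// => /ltW.
exists L0 => g gH.
pose L n := bad_level A L0 n.
have ML n : (4 * n < L n)%N.
  by rewrite /L /bad_level; move: A4 L00; clear; nia.
have hL n : h ^+ L n <= freq0 (msq H) * (5 * 2 ^- n).
  rewrite /L /bad_level exprD mulrC; apply: ler_pM; rewrite ?exprn_ge0 ?(ltW h0)//.
  apply: (@le_trans _ _ (2 ^- n)); last first.
    by rewrite ler_peMl ?invr_ge0 ?exprn_ge0// ler1n.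
  rewrite exprM -exprVn; apply: lerXn2r; rewrite ?nnegrE ?exprn_ge0 ?(ltW h0)//.
  apply: (@le_trans _ _ (h ^+ 2)); last by lra.
  by apply: ler_wiXn2l; rewrite ?(ltW h0) ?(ltW h1)// (leq_trans _ A4).
pose Y n s := bad_fraction h (L n) g n s.
have Y0 n s : 0 <= Y n s.
  by rewrite /Y /bad_fraction mulr_ge0 ?invr_ge0 ?exprn_ge0// sumr_ge0.
have dY n : depends (mem (tree (L n))) (Y n).
  move=> s s' ss; rewrite /Y /bad_fraction; congr (_ * _); apply: eq_bigr => i _.
  congr (nat_of_bool _)%:R; rewrite /is_bad; congr (_ < _).
  apply: eq_bigr => j _; congr (nat_of_bool _)%:R; rewrite /near_cells.
  have E t : casc h (sg s) (L n) [::] t = casc h (sg s') (L n) [::] t.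
    exact: (casc_depends_tree H (N := L n) t _ ss).
  by rewrite !E.
(* Half of the decay absorbs the factor n + 1. *)
pose y : R := 2 `^ (- ((2 - H - g) / 2)).
have y01 : 0 < y < 1.
  rewrite /y powR_gt0//= powRN invf_lt1 ?powR_gt0//.
  rewrite -[X in X < _](congr1 (fun f => f ((2 - H - g) / 2)) (powR1 R)); apply: gt0_ltr_powR.
  - by rewrite divr_gt0//; move: gH; lra.
  - by rewrite nnegrE.
  - by rewrite nnegrE.
  - by rewrite ltr1n.
have [yy0 yy1] := andP y01.
pose C : R := (1 + 8 * `|pair_cst h a (msq H)|) * (1 - y)^-1.
have c0 : 0 <= 1 + 8 * `|pair_cst h a (msq H)| by rewrite addr_ge0 ?mulr_ge0.
have C0 : 0 <= C by rewrite /C mulr_ge0// invr_ge0 subr_ge0 ltW.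
have EY n : avg p (undup (tree (L n))) (Y n) s0 <= C * y ^+ n.
  apply: (le_trans (expected_bad erefl H_le H_gt (h_a H) (msq_ge1 H_gt) (msq_rec H_gt)
     s0 (@lN (L n)) g (ML n) (hL n))).
  rewrite /C -mulrA; apply: ler_wpM2l => //.
  apply: le_trans (linear_geom_le n y01); apply: eq_ler; congr (_ * _).
  have p0 : 0 <= 2 ^+ n :> R by rewrite exprn_ge0.
  rewrite -(powR_inv1 p0) -powRrM -(powR_mulrn n (_ : 0 <= 2 :> R))// -powRrM.
  rewrite -[y ^+ n]powR_mulrn ?(ltW yy0)// /y -powRrM -powRD ?pnatr_eq0 ?implybT//.
  by congr (_ `^ _); field.
have y01' : 0 <= y < 1 by rewrite ltW.
have := ae_bounded_series eps_val (eps_pos' eps_pos) (eps_neg' eps_neg) eps_indep Y0 dY y01' C0 EY.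
apply: filterS => omega [K HK].
have [n0 Hn] := tail_half (fun n => Y0 n (cf omega)) HK.
exists n0 => n1 n01 M; apply: le_trans (Hn M); apply: ler_sum => n _.
apply: ler_wpM2r; first exact: Y0.
by rewrite ler_nat; case: (leqP n1 n) => // n1n; rewrite (leq_trans n01 n1n).
Qed.

End Events2.

(** * Regularity of a sample path *)

Section SamplePath.
Context {R : realType}.
Variable H : R.
Hypotheses (H_gt : 2^-1 < H) (H_le : H <= 1).
Variable s : word -> bool.
Local Notation h := (2 `^ (- H) : R).
Local Notation k := (kap H).
Local Notation e := (sg s : word -> R).
Local Notation F := (casc_lim h e).

(** With bases arbitrarily close to [1] the loss with respect to the exponent [H]
    is arbitrarily small. *)
Definition subexponential := forall b : R, 1 < b -> exists2 K : R, 1 <= K & regular h k e K b.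
Hypothesis subexp : subexponential.

Lemma geom_small (y C c : R) : 0 <= y < 1 -> 0 < c ->
  exists M, forall m, (M <= m)%N -> C * y ^+ m <= c.
Proof.
move=> /andP[y0 y1] c0.
have [M _ HM] : \forall m \near \oo, `|C * y ^+ m| < c.
  have : C * y ^+ m @[m --> \oo] --> C * 0.
    by apply: cvgMr; apply: cvg_expr; rewrite ger0_norm.
  by rewrite mulr0 => /cvgr0Pnorm_lt; apply.
by exists M => m Mm; exact: le_trans (ler_norm _) (ltW (HM m Mm)).
Qed.

Let h1 : h <= 1. Proof. exact: h_le1. Qed.
Let k0 : 0 <= k. Proof. exact: ltW (kap_gt0 H). Qed.
Let e1 w : `|e w| <= 1. Proof. by rewrite /sg /sgn; case: (s w); rewrite ?normrN normr1. Qed.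

Lemma norm_sg w : `|e w| = 1.
Proof. by rewrite /sg /sgn; case: (s w); rewrite ?normrN normr1. Qed.

Lemma base_subkap (b : R) : b <= base H -> b * k < 1.
Proof. by move=> bb; apply: le_lt_trans (base_kap H_gt); rewrite ler_wpM2r. Qed.

Lemma path_modulus (b : R) : 1 < b -> b <= base H -> exists2 C : R, 0 <= C &
  forall n t u, `|t - u| <= 2 ^- n -> `|F [::] t - F [::] u| <= C * (h * b) ^+ n.
Proof.
move=> b1 bb; have [K K1 reg] := subexp b1.
have q1 := base_subkap bb; have b1' := ltW b1.
have K0 : 0 <= K by rewrite (le_trans ler01).
exists (4 * (1 + 3 * K / (1 - b * k))).
  by rewrite mulr_ge0// addr_ge0// divr_ge0 ?mulr_ge0// subr_ge0 ltW.
have S := casc_limS (h_gt0 H) h1 k0 (kapE H) e1 K1 b1' reg q1.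
have B := casc_lim_bound (h_gt0 H) h1 k0 (kapE H) e1 K1 b1' reg q1.
have M n t u : t <= u -> 2 ^+ n * (u - t) <= 1 ->
    `|F [::] u - F [::] t| <= 4 * (1 + 3 * K / (1 - b * k)) * (h * b) ^+ n.
  move=> tu; move/(modulus (h_gt0 H) (@casc_lim_le0 R h e) (@casc_lim_ge1 R h e) S b1' e1 B [::] tu).
  by rewrite /= expr0 mulr1.
move=> n t u; case: (leP u t) => [ut|/ltW tu].
  by rewrite ger0_norm ?subr_ge0// => H1; apply: M => //; rewrite mulrC -ler_pdivlMr ?exprn_gt0// mul1r.
rewrite (distrC t u) (distrC (F [::] t)) ger0_norm ?subr_ge0// => H1; apply: M => //.
by rewrite mulrC -ler_pdivlMr ?exprn_gt0// mul1r.
Qed.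

Lemma path_holder alpha : 0 < alpha < H -> exists2 C : R, 0 <= C &
  forall t u : R, t \in `[0, 1] -> u \in `[0, 1] ->
    `|F [::] t - F [::] u| <= C * `|t - u| `^ alpha.
Proof.
move=> /andP[a0 aH].
pose b : R := Num.min (base H) (2 `^ (H - alpha)).
have b1 : 1 < b.
  rewrite /b lt_min base_gt1//= -[X in X < _](congr1 (fun f => f (H - alpha)) (powR1 R)).
  by apply: gt0_ltr_powR; rewrite ?nnegrE ?subr_gt0 ?ltr1n.
have bb : b <= base H by rewrite ge_min lexx.
have hb : h * b <= 2 `^ (- alpha).
  apply: (@le_trans _ _ (h * 2 `^ (H - alpha))).
    by rewrite ler_wpM2l ?powR_ge0// ge_min lexx orbT.
  by rewrite -powRD ?pnatr_eq0 ?implybT//; apply: eq_ler; congr (_ `^ _); ring.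
have [C C0 HC] := path_modulus b1 bb.
exists (C * 2 `^ alpha); first by rewrite mulr_ge0// powR_ge0.
move=> t u tI uI; have [->|tu] := eqVneq t u.
  by rewrite subrr normr0 mulr_ge0 ?powR_ge0// mulr_ge0// powR_ge0.
have x01 : 0 < `|t - u| <= 1.
  rewrite normr_gt0 subr_eq0 tu/=.
  by move: tI uI; rewrite !in_itv /= ler_norml => /andP[? ?] /andP[? ?]; lra.
have [n /andP[n1 n2]] := dyadic_scale x01.
have x0 : 0 <= `|t - u| by [].
apply: (le_trans (HC n t u n2)); rewrite -mulrA; apply: ler_wpM2l => //.
apply: (@le_trans _ _ ((2 `^ (- alpha)) ^+ n)).
  by apply: lerXn2r => //; rewrite nnegrE ?powR_ge0// mulr_ge0 ?powR_ge0// (le_trans ler01 (ltW b1)).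
have -> : (2 `^ (- alpha)) ^+ n = (2 ^- n) `^ alpha :> R.
  by rewrite -powR_mulrn ?powR_ge0// -powRrM -powR_invn// -powRrM; congr (_ `^ _); ring.
rewrite -powRM//; apply: ge0_ler_powR; rewrite ?nnegrE ?(ltW a0) ?invr_ge0 ?exprn_ge0 ?mulr_ge0//.
by move: n1; rewrite exprS invfM => /ltW; rewrite ler_pdivrMl.
Qed.

Lemma path_holder01 alpha : 0 < alpha < H -> holder01 alpha (F [::]).
Proof. by move=> /path_holder[C _ HC]; exists C. Qed.

Let H0 : 0 < H. Proof. by rewrite (lt_trans _ H_gt)// invr_gt0. Qed.

Hypothesis osc : forall A, exists m0, forall m, (m0 <= m)%N ->
  forall w, size w = (2 ^ m)%N -> exists2 v, size v = (2 * m)%N &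
    2^-1 < mass h e (A * 2 ^ m) (w ++ v).

Lemma path_mass_lower : exists m0, forall m, (m0 <= m)%N ->
  forall w, size w = (2 ^ m)%N -> exists2 v, size v = (2 * m)%N &
    4^-1 <= `|F (w ++ v) 1|.
Proof.
have b1 := base_gt1 H_gt; have q1 := base_kap H_gt; have b2 := base_le2 H_le.
have [K K1 reg] := subexp b1.
have K0 : 0 <= K by rewrite (le_trans ler01).
have D := casc_lim_dist (h_gt0 H) h1 k0 (kapE H) e1 K1 (ltW b1) reg q1.
set b := base H in b1 q1 b2 reg D *.
have b0 : 0 <= b by rewrite (le_trans ler01 (ltW b1)).
have bk0 : 0 <= b * k by rewrite mulr_ge0.
have q01 : 0 <= b * k < 1 by apply/andP.
have i16 : 0 < 16^-1 :> R by rewrite invr_gt0.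
(* The factor b ^ (n + 2 m) of the approximation error is at most 8 ^ n, where
   n = 2 ^ m; the choice of A makes the error at most a constant times 2^-n. *)
have [A HA] := geom_small 1 q01 i16.
have {HA} HA := HA A (leqnn A); rewrite mul1r in HA.
have [m0 Hm0] := osc A.
pose C := 3 * K / (1 - b * k).
have C0 : 0 <= C by rewrite divr_ge0 ?mulr_ge0// subr_ge0 ltW.
have h01 : 0 <= (2^-1 : R) < 1 by apply/andP; split; lra.
have i4 : 0 < 4^-1 :> R by rewrite invr_gt0.
have [m1 Hm1] := geom_small C h01 i4.
exists (maxn m0 m1) => m; rewrite geq_max => /andP[mm0 mm1] w sw.
have [v sv Hv] := Hm0 m mm0 w sw; exists v => //.
have := D (A * 2 ^ m)%N (w ++ v) 1; rewrite -/(mass h e (A * 2 ^ m) (w ++ v)).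
have -> : 3 * K * b ^+ size (w ++ v) * (b * k) ^+ (A * 2 ^ m) / (1 - b * k) =
   C * (b ^+ size (w ++ v) * (b * k) ^+ (A * 2 ^ m)) by rewrite /C; ring.
have : C * (b ^+ size (w ++ v) * (b * k) ^+ (A * 2 ^ m)) <= 4^-1.
  apply: le_trans (Hm1 m mm1); apply: ler_wpM2l => //.
  rewrite size_cat sw sv exprM.
  set n := (2 ^ m)%N.
  have mn : (m <= n)%N by rewrite ltnW// ltn_expl.
  apply: (@le_trans _ _ (8 ^+ n * 16^-1 ^+ n)).
    apply: ler_pM; rewrite ?exprn_ge0//; last first.
      by apply: lerXn2r; rewrite ?nnegrE ?exprn_ge0// invr_ge0.
    have -> : 8 ^+ n = 2 ^+ (3 * n) :> R by rewrite exprM; congr (_ ^+ _); ring.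
    apply: (@le_trans _ _ (2 ^+ (n + 2 * m))).
      by apply: lerXn2r; rewrite ?nnegrE.
    by rewrite ler_weXn2l ?ler1n//; move: mn; clear; lia.
  rewrite -exprMn; have -> : 8 * 16^-1 = 2^-1 :> R by field.
  by apply: ler_wiXn2l => //; lra.
have := ler_norm (F (w ++ v) 1).
move: Hv; rewrite ler_norml => ? ? ? /andP[? ?]; lra.
Qed.

(** Near [t] take the dyadic interval of generation [n = 2 ^ m] and inside it a
    subinterval of generation [n + 2 m] with a mass bounded below. Its two ends
    differ by at least [h ^ (n + 2 m) / 4], so one of them differs from the value
    at [t] by half of that. Since [2 m] is negligible before [2 ^ m], this beats
    [(2 ^- n) `^ c] for every [c > H]; the scales [2 ^ m] are sparse, but a lower
    limit only requires infinitely many. *)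
Lemma path_rough (c : R) : H < c -> forall t : R, t \in `[0, 1] -> forall d : R, 0 < d ->
  exists u : R, [/\ u \in `[0, 1], 0 < `|u - t| < d & `|u - t| `^ c <= `|F [::] u - F [::] t|].
Proof.
move=> Hc t tI d d0.
have [m0 Hm0] := path_mass_lower.
have h01 : 0 <= (2^-1 : R) < 1 by apply/andP; split; lra.
have y01 : 0 <= (3 / 4 : R) < 1 by apply/andP; split; lra.
have y01' : 0 < (3 / 4 : R) < 1 by apply/andP; split; lra.
have d2 : 0 < d / 2 by rewrite divr_gt0.
have cH : 0 < c - H by rewrite subr_gt0.
have [m1 Hm1] := geom_small 1 h01 d2.
(* Used with (m + 1) * 2^-m <= 4 * (3/4)^m, which holds as (3/4)^2 > 1/2. *)
have [m2 Hm2] := geom_small 12 y01 cH.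
pose m := maxn m0 (maxn m1 m2).
have mm0 : (m0 <= m)%N by rewrite leq_maxl.
have mm1 : (m1 <= m)%N by rewrite leq_max leq_max leqnn /= orbT.
have mm2 : (m2 <= m)%N by rewrite leq_max leq_max leqnn !orbT.
have {}Hm1 := Hm1 m mm1; have {}Hm2 := Hm2 m mm2; rewrite mul1r in Hm1.
set n := (2 ^ m)%N.
have mn : (m <= n)%N by rewrite ltnW// ltn_expl.
have [w sw tw] := winterval_cover n tI.
have [v sv Fv] := Hm0 m mm0 w sw.
pose u := w ++ v.
have su : size u = (n + 2 * m)%N by rewrite size_cat sw sv.
have r0 (j : nat) : 0 < 2 ^- j :> R by rewrite invr_gt0 exprn_gt0.
pose x0 := wpoint R u; pose x1 := wpoint R u + 2 ^- size u.
have x0I : x0 \in winterval R u by rewrite inE /winterval /= in_itv /= lexx lerDl ltW.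
have x1I : x1 \in winterval R u by rewrite inE /winterval /= in_itv /= lexx lerDl ltW.
have K1 : exists K : R, 1 <= K /\ regular h k e K (base H) by have [K ? ?] := subexp (base_gt1 H_gt); exists K.
have [K [K1' reg]] := K1.
have S := casc_limS (h_gt0 H) h1 k0 (kapE H) e1 K1' (ltW (base_gt1 H_gt)) reg (base_kap H_gt).
have := self_similar (@casc_lim_le0 R h e) (@casc_lim_ge1 R h e) S [::] x1I.
rewrite cat0s wordVE {1}/x1 addrAC subrr add0r mulfV ?expf_neq0// -/x0 => E.
have {E} E : h ^+ (n + 2 * m) * 4^-1 <= `|F [::] x1 - F [::] x0|.
  rewrite E !normrM normr_prod big1; last by move=> i _; rewrite norm_sg.
  rewrite mul1r ger0_norm ?exprn_ge0 ?powR_ge0// -su.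
  by apply: ler_wpM2l => //; rewrite exprn_ge0 ?powR_ge0.
have inI x : x \in winterval R u -> x \in `[0, 1] /\ `|x - t| <= 2 ^- n.
  rewrite inE /winterval /= in_itv /= => /andP[xl xr].
  have := @wpoint_ge0 R u; have := @wpoint_le1 R u.
  have := @wpoint_ge0 R v; have := @wpoint_le1 R v.
  move: xl xr tw; rewrite inE /winterval /= in_itv /= size_cat exprD sw wpoint_cat sw invfM.
  move=> xl xr /andP[tl tr] v1 v0 u1 u0; split.
    by rewrite in_itv /=; apply/andP; split; lra.
  have := ler_wpM2l (ltW (r0 n)) v1; rewrite mulrDr mulr1 => v1'.
  have := mulr_ge0 (ltW (r0 n)) v0 => v0'.
  by rewrite ler_norml; apply/andP; split; lra.
have pos : 0 < h ^+ (n + 2 * m) / 8 by rewrite divr_gt0// exprn_gt0 ?powR_gt0.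
have [x [xI dx]] : exists x, x \in winterval R u /\ h ^+ (n + 2 * m) / 8 <= `|F [::] x - F [::] t|.
  have [le|gt] := leP (h ^+ (n + 2 * m) / 8) `|F [::] x0 - F [::] t|; first by exists x0.
  exists x1; split => //.
  have := ler_distD (F [::] t) (F [::] x1) (F [::] x0).
  rewrite [`|F [::] t - _|]distrC; lra.
have [xI' xt] := inI x xI.
exists x; split => //.
  apply/andP; split.
    rewrite normr_gt0 subr_eq0; apply/eqP => xE.
    by move: dx; rewrite xE subrr normr0; move: pos; lra.
  apply: (le_lt_trans xt); apply: (@le_lt_trans _ _ (2^-1 ^+ m)); last by lra.
  by rewrite -exprVn; apply: ler_wiXn2l => //; lra.
apply: le_trans dx; have c0 : 0 <= c by rewrite (le_trans (ltW H0) (ltW Hc)).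
apply: (@le_trans _ _ ((2 ^- n) `^ c)).
  by apply: ge0_ler_powR; rewrite ?nnegrE// ltW.
have -> : (2 ^- n) `^ c = 2 `^ (- (n%:R * c)) :> R.
  by rewrite -powR_invn// -powRrM mulNr.
have -> : h ^+ (n + 2 * m) / 8 = 2 `^ (- (H * (n + 2 * m)%:R) - 3%:R) :> R.
  rewrite powRD ?pnatr_eq0 ?implybT// powR_invn// -powR_mulrn ?powR_ge0// -powRrM mulNr.
  by congr (_ / _); ring.
apply: ler_powR; first by rewrite ler1n.
have nc : 2 * m%:R + 3 <= (c - H) * n%:R.
  apply: (@le_trans _ _ (3 * m.+1%:R)); first by rewrite -natr1; have : 0 <= m%:R :> R by []; lra.
  have := linear_geom_le m y01'; rewrite (_ : (1 - 3 / 4)^-1 = 4 :> R); last by field.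
  move=> L; have n0 : 0 < n%:R :> R by rewrite ltr0n expn_gt0.
  have L2 : m.+1%:R * n%:R^-1 <= 4 * (3 / 4) ^+ m :> R.
    apply: le_trans L; apply: ler_wpM2l => //.
    rewrite natrX -exprVn -exprMn; apply: lerXn2r; rewrite ?nnegrE ?invr_ge0//; lra.
  have L3 : m.+1%:R <= 4 * (3 / 4) ^+ m * n%:R :> R by rewrite -ler_pdivrMr.
  have := ler_wpM2r (ltW n0) Hm2; lra.
rewrite natrD natrM.
have m0' : 0 <= m%:R :> R by [].
have := ler_wpM2r m0' H_le; lra.
Qed.

Lemma path_exponent t : t \in `[0, 1] -> pointwise_exponent01 (F [::]) t = H%:E.
Proof.
move=> tI; apply: pointwise_exponent_eq => c Hc; last exact: path_rough.
pose al := Num.max ((c + H) / 2) (H / 2).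
have alH : 0 < al < H.
  have h2 : 0 < H / 2 by rewrite divr_gt0.
  rewrite /al lt_max h2 orbT /= gt_max; apply/andP; split; [move: Hc; lra|move: H0; lra].
have cal : c < al by rewrite /al lt_max; apply/orP; left; move: Hc; lra.
have [C C0 HC] := path_holder alH.
have ca : 0 < al - c by rewrite subr_gt0.
have [d d0 Hd] := small_powR C0 ca.
exists d => // u uI /andP[u0 ud].
apply: (le_trans (HC u t uI tI)).
have := Hd `|u - t|; rewrite u0 (ltW ud) => /(_ isT) S.
have -> : `|u - t| `^ al = `|u - t| `^ (al - c) * `|u - t| `^ c.
  by rewrite -powRD ?subrK// (gt_eqF u0) implybT.
by rewrite mulrA ler_piMl ?powR_ge0.
Qed.

Hypothesis bad : forall A, (4 <= A)%N -> exists L0, forall g, g < 2 - H ->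
  exists n0, forall n1, (n0 <= n1)%N -> forall N,
     \sum_(0 <= n < N) ((n1 <= n)%N%:R *
       bad_fraction h (bad_level A L0 n) g n s) <= 2^-1.

(** The counts of [mass_from_cells] for the limit function are dominated by those
    of [bad_fraction] at a finite depth: the depth [A * n + L0] is such that the
    approximation error [(base * kap) ^ (A * n)] falls below [2 ^- n]. *)
Lemma path_massive (g : R) : 0 < g < 2 - H -> massive g (graph01 (F [::])).
Proof.
move=> /andP[g0 gH].
have b1 := base_gt1 H_gt; have q1 := base_kap H_gt.
have [C C0 Hmod] := path_modulus b1 (lexx _).
have [K K1 reg] := subexp b1.
have K0 : 0 <= K by rewrite (le_trans ler01).
have D := casc_lim_dist (h_gt0 H) h1 k0 (kapE H) e1 K1 (ltW b1) reg q1.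
set b := base H in b1 q1 reg D Hmod *.
have b0 : 0 <= b by rewrite (le_trans ler01 (ltW b1)).
have bk0 : 0 <= b * k by rewrite mulr_ge0.
have q01 : 0 <= b * k < 1 by apply/andP.
have i4 : 0 < 4^-1 :> R by rewrite invr_gt0.
have [A' HA] := geom_small 1 q01 i4.
pose A := (A' + 4)%N; have A4 : (4 <= A)%N by rewrite leq_addl.
have {HA} HA := HA A (leq_addr _ _); rewrite mul1r in HA.
have [L0 /(_ g gH)[n0 Hbad]] := bad A4.
have h01 : 0 <= (2^-1 : R) < 1 by apply/andP; split; lra.
pose C' := 3 * K / (1 - b * k).
have C'0 : 0 <= C' by rewrite divr_ge0 ?mulr_ge0// subr_ge0 ltW.
have [n1 Hn1] := geom_small C h01 ltr01.
have [n2 Hn2] := geom_small C' h01 ltr01.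
pose N0 := maxn n0 (maxn n1 n2).
have N0n0 : (n0 <= N0)%N by rewrite leq_maxl.
have N0n1 : (n1 <= N0)%N by rewrite leq_max leq_max leqnn /= orbT.
have N0n2 : (n2 <= N0)%N by rewrite leq_max leq_max leqnn !orbT.
have E4 n : 4^-1 ^+ n = 2^-1 ^+ n * 2^-1 ^+ n :> R.
  by rewrite -exprMn; congr (_ ^+ _); field.
apply: (@mass_from_cells R (F [::]) g N0
   (fun n i => is_bad h (bad_level A L0 n) g n i s)) => //.
- move=> n Nn t u tI uI tu; apply: (le_trans (Hmod (4 * n)%N t u tu)).
  have hb4 : (h * b) ^+ 4 <= 4^-1.
    have E : (h * b) ^+ 2 = (b * k) ^+ 2 / 2 by rewrite [(b * k) ^+ 2]exprMn (kapE H) exprMn; field.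
    have : (b * k) ^+ 2 <= 1 by rewrite exprn_ile1// ltW.
    have -> : (h * b) ^+ 4 = ((b * k) ^+ 2 / 2) ^+ 2 by rewrite -E -exprM.
    have : 0 <= (b * k) ^+ 2 by rewrite exprn_ge0.
    nra.
  apply: (@le_trans _ _ (C * 4^-1 ^+ n)).
    apply: ler_wpM2l => //; rewrite exprM; apply: lerXn2r; rewrite ?nnegrE ?exprn_ge0 ?invr_ge0//.
    by rewrite mulr_ge0 ?powR_ge0.
  rewrite E4 mulrA -exprVn ler_piMl ?exprn_ge0 ?invr_ge0//.
  exact/Hn1/(leq_trans N0n1).
- move=> n Nn i iN; rewrite /is_bad -leNgt; apply: le_trans.
  apply: ler_sum => j _; rewrite ler_nat.
  case: (boolP (_ && _)) => // /andP[near1 near2]; rewrite /near_cells near1 /=.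
  rewrite (_ : (_ <= _) = true)//.
  have dist x : `|F [::] x - casc h e (bad_level A L0 n) [::] x| <= 2 ^- n.
    apply: (le_trans (D _ _ _)); rewrite /= expr0 mulr1 mulrAC -/C'.
    apply: (@le_trans _ _ (C' * 4^-1 ^+ n)).
      apply: ler_wpM2l => //; rewrite /bad_level exprD exprM.
      rewrite -[X in _ <= X]mulr1; apply: ler_pM; rewrite ?exprn_ge0//.
        by apply: lerXn2r; rewrite ?nnegrE ?exprn_ge0// invr_ge0.
      by rewrite exprn_ile1// ltW.
    rewrite E4 mulrA -exprVn ler_piMl ?exprn_ge0 ?invr_ge0//.
    exact/Hn2/(leq_trans N0n2).
  have := dist (gridpt n i); have := dist (gridpt n j); move: near2.
  rewrite !ler_norml => /andP[? ?] /andP[? ?] /andP[? ?]; apply/andP; split; lra.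
- by move=> N; exact: Hbad.
Qed.

Lemma path_dims : [/\ hausdorff_dim (graph01 (F [::])) = (2 - H)%:E,
    lower_box_dim (graph01 (F [::])) = (2 - H)%:E
  & upper_box_dim (graph01 (F [::])) = (2 - H)%:E].
Proof.
by apply: graph_dims; [rewrite H0|exact: path_holder01|exact: path_massive].
Qed.

End SamplePath.

(** * The limit process *)

(** The integral of a nonnegative function is a supremum over simple functions,
    hence monotone even for functions not known to be measurable. This applies
    to the uniform norm, a supremum over an uncountable set. *)
Lemma ge0_le_integralT d (T : measurableType d) (R : realType)
    (mu : {measure set T -> \bar R}) (f g : T -> \bar R) :
  (forall x, 0 <= f x)%E -> (forall x, f x <= g x)%E ->
  (\int[mu]_x f x <= \int[mu]_x g x)%E.
Proof.
move=> f0 fg; have g0 x : (0 <= g x)%E by apply: le_trans (fg x).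
rewrite !ge0_integralTE//; apply: ereal_sup_le => _ [u uf <-]; exists u => //= x.
exact: le_trans (uf x) (fg x).
Qed.

(** A crude bound, enough for integrability at a fixed depth. *)
Lemma casc_bound (R : realType) (h : R) (e : word -> R) n w t : 0 <= h <= 1 ->
  (forall v, `|e v| <= 1) -> `|casc h e n w t| <= 2 ^+ n.
Proof.
move=> /andP[h0 h1] e1; elim: n w t => [|n IH] w t.
  rewrite expr0 /= ger0_norm; last by rewrite le_max lexx.
  by rewrite ge_max ler01 ge_min lexx orbT.
rewrite cascS normrM (ger0_norm h0) exprS -[X in _ <= X]mul1r.
apply: ler_pM => //; rewrite mulr_natl mulr2n; apply: (le_trans (ler_normD _ _)).
by apply: lerD; rewrite normrM -[X in _ <= X]mul1r; apply: ler_pM.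
Qed.

Section Limit.
Context {R : realType} {d : measure_display} {Omega : measurableType d}.
Variables (P : probability Omega R) (H : R).
Hypotheses (H_gt : 2^-1 < H) (H_le : H <= 1).
Variable (eps : word -> {RV P >-> R}).
Hypotheses (eps_val : forall w omega, eps w omega = 1 \/ eps w omega = -1)
  (eps_pos : forall w, P [set omega | eps w omega = 1] = ((1 + 2 `^ (H - 1)) / 2)%:E)
  (eps_neg : forall w, P [set omega | eps w omega = -1] = ((1 - 2 `^ (H - 1)) / 2)%:E)
  (eps_indep : mutually_independent eps).
Variable q0 : nat.
Hypotheses (q00 : (0 < q0)%N) (q0e : ~~ odd q0) (bq0 : 4 <= base H ^+ q0).
Local Notation h := (2 `^ (- H) : R).
Local Notation a := (2 `^ (H - 1) : R).
Local Notation p := (upprob a).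
Local Notation k := (kap H).
Local Notation b := (base H).
Local Notation cf := (conf eps).
Local Notation e omega := (fun v => eps v omega).
Local Notation S := (moment_series H eps b).

Let s0 : word -> bool := fun=> true.
Let b1 : 1 < b. Proof. exact: base_gt1. Qed.
Let h01 : 0 <= h <= 1. Proof. by rewrite powR_ge0 h_le1. Qed.
Let h1 : h <= 1. Proof. by case/andP: h01. Qed.
Let k0 : 0 <= k. Proof. exact: ltW (kap_gt0 H). Qed.
Let e1 omega w : `|e omega w| <= 1.
Proof. by case: (eps_val w omega) => ->; rewrite ?normrN normr1. Qed.
Let q1 : b * k < 1. Proof. exact: base_kap. Qed.
Lemma integral_const (c : R) : (\int[P]_omega c%:E = c%:E)%E.
Proof.
rewrite integral_cst// [X in (_ * X)%E](_ : _ = 1%E) ?mule1//.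
exact: probability_setT.
Qed.
Let bk0 : 0 < b * k. Proof. by rewrite mulr_gt0 ?kap_gt0// (lt_trans ltr01). Qed.

(** The limit where the series of [regular_of_series] is finite, and [0] on the
    complementary null set: continuity then holds for every sample, and
    measurability because the exceptional set is measurable. *)
Definition limit_process w omega t : R :=
  if S q0 omega \is a fin_num then casc_lim h (e omega) w t else 0.

Lemma good_regular omega : S q0 omega \is a fin_num ->
  exists2 K, 1 <= K & regular h k (e omega) K b.
Proof. exact: regular_of_fin. Qed.

Lemma limit_process_continuous w omega : continuous (limit_process w omega).
Proof.
have [Sf|nSf] := boolP (S q0 omega \is a fin_num).
  have -> : limit_process w omega = casc_lim h (e omega) w.
    by apply/funext => t; rewrite /limit_process Sf.
  have [K K1 reg] := good_regular Sf.
  exact: (casc_lim_continuous (h_gt0 H) h1 k0 (kapE H) (e1 omega) K1 (ltW b1) reg q1).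
have -> : limit_process w omega = (fun=> 0).
  by apply/funext => t; rewrite /limit_process (negbTE nSf).
exact: cst_continuous.
Qed.

Lemma casc_measurable n w t : measurable_fun setT (fun omega => casc h (e omega) n w t).
Proof.
have -> : (fun omega => casc h (e omega) n w t) =
    (fun s => casc h (sg s) n w t) \o cf.
  by apply/funext => omega /=; rewrite sg_cf.
exact: (conf_measurable eps_val (eps_pos' eps_pos) (eps_neg' eps_neg) eps_indep
  (casc_depends_tree H t (leqnn _))).
Qed.

Lemma limit_process_measurable w t :
  measurable_fun setT (fun omega => limit_process w omega t).
Proof.
pose f n omega := if S q0 omega \is a fin_num then casc h (e omega) n w t else 0.
have mS := moment_series_measurable eps_val eps_pos eps_neg eps_indep b q0e.
apply: (@measurable_fun_cvg _ _ _ _ f) => [n|omega _].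
  apply: measurable_fun_ifT; [|exact: casc_measurable|exact: measurable_cst].
  by apply: (measurable_fun_bool true); exact/emeasurable_fin_num.
have [Sf|nSf] := boolP (S q0 omega \is a fin_num); last first.
  by rewrite /f /limit_process (negbTE nSf); exact: cvg_cst.
have [K K1 reg] := good_regular Sf; rewrite /f /limit_process Sf.
exact: (casc_lim_cvg (h_gt0 H) h1 k0 (kapE H) (e1 omega) K1 (ltW b1) reg q1).
Qed.

Lemma limit_process_dist omega (K : R) n w t : S q0 omega \is a fin_num ->
  1 <= K -> regular h k (e omega) K b -> t \in `[0, 1] ->
  `|Bn H eps n w omega t - limit_process w omega t| <=
     3 * K * b ^+ size w * (b * k) ^+ n / (1 - b * k).
Proof.
move=> Sf K1 reg tI; rewrite Bn_casc// /limit_process Sf distrC.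
exact: (casc_lim_dist (h_gt0 H) h1 k0 (kapE H) (e1 omega) K1 (ltW b1) reg q1).
Qed.

Lemma limit_process_uniform w omega : S q0 omega \is a fin_num ->
  {uniform `[0, 1], (fun n => Bn H eps n w omega) @ \oo --> limit_process w omega}.
Proof.
move=> Sf; have [K K1 reg] := good_regular Sf.
apply/uniform_restrict_cvg => /= U /=; rewrite !uniform_nbhsT.
case/nbhs_ex => del /= ballU; apply: filterS; first by move=> ?; exact: ballU.
have q01 : 0 <= b * k < 1 by rewrite (ltW bk0).
have d2 : 0 < del%:num / 2 by rewrite divr_gt0.
have [M HM] := geom_small (3 * K * b ^+ size w / (1 - b * k)) q01 d2.
exists M => // n /= Mn t.
rewrite /patch; case: ifPn => [/set_mem tI|_]; last exact: ballxx.
rewrite /ball /= distrC; apply: (@le_lt_trans _ _ (del%:num / 2)).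
  apply: (le_trans (limit_process_dist n w Sf K1 reg tI)).
  by rewrite mulrAC; exact: HM.
by rewrite ltr_pdivrMr// ltr_pMr// ltr1n.
Qed.

Definition rate n : R := 3 * (b * k) ^+ n / (1 - b * k).

Lemma rate_gt0 n : 0 < rate n.
Proof. by rewrite divr_gt0 ?subr_gt0// mulr_gt0// exprn_gt0. Qed.

Section Moment.
Variables (q : R) (N : nat).
Hypotheses (qg1 : 1 <= q) (N0 : (0 < N)%N) (Ne : ~~ odd N) (bN : 4 <= b ^+ N) (qN : q <= N%:R).

Lemma supnorm_ge0 (f : R -> R) : (0 <= supnorm01 f)%E.
Proof.
apply: (@le_trans _ _ `|f 0|%:E); first by rewrite lee_fin.
by apply: ereal_sup_ubound; exists 0 => //=; rewrite in_itv /= lexx ler01.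
Qed.

(** Valid for every sample, the right side being infinite on the exceptional sets.
    The uniform error is [rate n] times the random constant
    [K = (1 + S N omega) `^ (N%:R^-1)], and [K `^ q <= K ^+ N] as soon as
    [q <= N]. *)
Lemma supnorm_le n omega :
  (supnorm01 (Bn H eps n [::] omega \- limit_process [::] omega)%R `^ q <=
    (rate n `^ q)%:E * (1 + S N omega + S q0 omega))%E.
Proof.
have SN0 := moment_series_ge0 H eps b Ne omega.
have Sq0 := moment_series_ge0 H eps b q0e omega.
have r0 : (0 < (rate n `^ q)%:E)%E by rewrite lte_fin powR_gt0// rate_gt0.
have [Sf|] := boolP (S q0 omega \is a fin_num); last first.
  rewrite ge0_fin_numE// -leNgt leye_eq => /eqP ->.
  by rewrite addey ?gt0_muley ?leey// gt_eqF// (lt_le_trans ltNy0)// adde_ge0.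
have [SNf|] := boolP (S N omega \is a fin_num); last first.
  rewrite ge0_fin_numE// -leNgt leye_eq => /eqP ->.
  rewrite addey// addye ?gt0_muley ?leey//.
  by rewrite gt_eqF// (lt_le_trans ltNy0).
pose x := fine (S N omega); have x0 : 0 <= x by rewrite fine_ge0.
have x1 : 1 <= 1 + x by rewrite lerDl.
have x1' : 0 <= 1 + x by rewrite (le_trans ler01).
pose K := (1 + x) `^ (N%:R^-1).
have K1 : 1 <= K.
  by rewrite -[X in X <= _](powRr0 (1 + x)) /K; apply: ler_powR.
have K0 := le_trans ler01 K1.
have KN : K ^+ N = 1 + x.
  by rewrite -powR_mulrn// -powRrM mulVf ?powRr1// pnatr_eq0 -lt0n.
have reg : regular h k (e omega) K b.
  apply: (regular_of_series eps_val b1 N0 Ne K0).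
  by rewrite KN -(fineK SNf) lee_fin lerDr.
have sup : (supnorm01 (Bn H eps n [::] omega \- limit_process [::] omega)%R <=
    (rate n * K)%:E)%E.
  apply: ge_ereal_sup => _ [t tI <-]; rewrite lee_fin.
  apply: (le_trans (limit_process_dist n [::] Sf K1 reg tI)).
  by rewrite /= expr0 /rate; apply: eq_ler; ring.
have rK : 0 <= rate n * K by rewrite mulr_ge0// ltW// rate_gt0.
have q0' : 0 <= q by rewrite (le_trans ler01).
apply: (@le_trans _ _ ((rate n * K)%:E `^ q)%E).
  apply: (gt0_ler_poweR q0') => //; rewrite in_itv /= leey andbT.
    exact: supnorm_ge0.
  by rewrite lee_fin.
rewrite poweR_EFin powRM ?(ltW (rate_gt0 n))// EFinM; apply: lee_wpmul2l; first exact: ltW.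
apply: (@le_trans _ _ (1 + S N omega)%E); last by rewrite leeDl.
rewrite -(fineK SNf) -EFinD lee_fin -/x -KN -powR_mulrn//.
exact: ler_powR.
Qed.

Lemma limit_process_moment :
  (\int[P]_omega (supnorm01 (Bn H eps n [::] omega \- limit_process [::] omega)%R `^ q))%E
     @[n --> \oo] --> 0%E.
Proof.
have IN := moment_series_integral H_gt H_le eps_val eps_pos eps_neg eps_indep b1 N0 Ne bN.
have Iq := moment_series_integral H_gt H_le eps_val eps_pos eps_neg eps_indep b1 q00 q0e bq0.
have mN := moment_series_measurable eps_val eps_pos eps_neg eps_indep b Ne.
have mq := moment_series_measurable eps_val eps_pos eps_neg eps_indep b q0e.
have SN0 omega := moment_series_ge0 H eps b Ne omega.
have Sq0 omega := moment_series_ge0 H eps b q0e omega.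
pose M : R := 1 + moment_cst N / (1 - 2^-1) + moment_cst q0 / (1 - 2^-1).
have IM : (\int[P]_omega (1 + S N omega + S q0 omega) <= M%:E)%E.
  rewrite ge0_integralD//; [|by move=> w _; rewrite adde_ge0|exact: emeasurable_funD].
  rewrite ge0_integralD//.
  rewrite (integral_const 1).
  by rewrite /M !EFinD; apply: leeD => //; apply: leeD.
pose y := (b * k) `^ q; pose c := (3 / (1 - b * k)) `^ q.
have rE n : rate n `^ q = c * y ^+ n.
  have bkn : 0 <= (b * k) ^+ n by rewrite exprn_ge0// ltW.
  have c3 : 0 <= 3 / (1 - b * k) by rewrite divr_ge0// subr_ge0 ltW.
  rewrite /rate mulrAC powRM// -/c; congr (_ * _).
  by rewrite -powR_mulrn ?(ltW bk0)// powRAC powR_mulrn// powR_ge0.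
have y01 : 0 <= y < 1.
  rewrite powR_ge0 /= -[X in _ < X](congr1 (fun f => f q) (powR1 R)).
  by apply: gt0_ltr_powR; rewrite ?nnegrE// ?(lt_le_trans ltr01)// ltW.
apply: (@squeeze_cvge _ _ _ _ (fun=> 0%E) _ (fun n => (M * (c * y ^+ n))%:E)).
- apply: nearW => n; rewrite integral_ge0 ?poweR_ge0//=.
    apply: (@le_trans _ _ (\int[P]_omega ((rate n `^ q)%:E * (1 + S N omega + S q0 omega)))%E).
      apply: ge0_le_integralT => omega; first exact: poweR_ge0.
      exact: supnorm_le.
    rewrite ge0_integralZl//.
    + rewrite mulrC EFinM -rE; apply: lee_wpmul2l => //.
      by rewrite lee_fin powR_ge0.
    + by apply: emeasurable_funD => //; exact: emeasurable_funD.
    + by move=> w _; rewrite !adde_ge0.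
    + by rewrite lee_fin powR_ge0.
  by move=> *; exact: poweR_ge0.
- exact: cvg_cst.
apply: cvg_EFin; first exact: nearW.
rewrite [X in _ --> X](_ : _ = M * (c * 0)); last by rewrite !mulr0.
have [y0 y1] := andP y01.
by do 2 apply: cvgMr; apply: cvg_expr; rewrite ger0_norm.
Qed.

End Moment.

Lemma casc_integrable n w t : P.-integrable setT (fun omega => (casc h (e omega) n w t)%:E).
Proof.
apply: (@le_integrable _ _ _ _ _ measurableT _ (fun=> (2 ^+ n)%:E)).
- exact/measurable_EFinP/casc_measurable.
- move=> omega _ /=; rewrite lee_fin [X in _ <= X]ger0_norm ?exprn_ge0//.
  exact: casc_bound.
- exact: finite_measure_integrable_cst.
Qed.

Lemma casc_expectation n t : t \in `[0, 1] ->
  (\int[P]_omega (casc h (e omega) n [::] t)%:E = t%:E)%E.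
Proof.
rewrite in_itv /= => /andP[t0 t1].
have C := finite_measure_integrable_cst P (2 ^+ n : R) measurableT.
have : (\int[P]_omega (casc h (e omega) n [::] t + 2 ^+ n)%:E = (t + 2 ^+ n)%:E)%E.
  transitivity (\int[P]_omega ((fun s => casc h (sg s) n [::] t + 2 ^+ n) (cf omega))%:E)%E.
    by apply: eq_integral => omega _ /=; rewrite sg_cf.
  have dep : depends (mem (tree n)) (fun s => casc h (sg s) n [::] t + 2 ^+ n).
    by move=> s s' ss; rewrite (casc_depends_tree H (N := n) t _ ss).
  rewrite (integral_conf eps_val (eps_pos' eps_pos) (eps_neg' eps_neg) eps_indep s0 dep); last first.
    move=> s; have s1 v : `|(sg s : word -> R) v| <= 1 by rewrite norm_sg.
    by have := casc_bound n [::] t h01 s1; rewrite ler_norml => /andP[? _]; lra.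
  congr EFin; rewrite avgD avg_cst; congr (_ + _).
  have lN w : (size w <= n)%N -> w \in undup (tree n) by rewrite mem_undup mem_tree.
  by rewrite (avg_casc s0 (h_a H) lN)// (min_idPl t1) (max_idPr t0).
under eq_integral do rewrite EFinD.
rewrite (integralD measurableT (casc_integrable n [::] t) C).
rewrite integral_const.
have := integrable_fin_num measurableT (casc_integrable n [::] t).
case: (integral _ _ _) => // r _; rewrite -EFinD => -[/addIr ->] //.
Qed.

(** Dominated convergence: the means are [t] at every finite depth, and the
    approximations are dominated by an affine function of the integrable
    series. *)
Lemma limit_process_expectation t : t \in `[0, 1] ->
  ('E_P[fun omega => limit_process [::] omega t] = t%:E)%E.
Proof.
move=> tI; rewrite unlock.
have aeS := ae_moment_series H_gt H_le eps_val eps_pos eps_neg eps_indep b1 q00 q0e bq0.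
have IS := moment_series_integrable H_gt H_le eps_val eps_pos eps_neg eps_indep b1 q00 q0e bq0.
pose c : R := 1 + 3 / (1 - b * k).
have c3 : 0 <= 3 / (1 - b * k) by rewrite divr_ge0// subr_ge0 ltW.
have Ig : P.-integrable setT (fun omega => c%:E * (1 + S q0 omega))%E.
  apply: integrableZl => //; apply: integrableD => //.
  exact: finite_measure_integrable_cst.
have aecv : {ae P, forall omega, setT omega ->
    (casc h (e omega) n [::] t)%:E @[n --> \oo] --> (limit_process [::] omega t)%:E}.
  apply: filterS aeS => omega Sf _; apply: cvg_EFin; first exact: nearW.
  rewrite /limit_process Sf; have [K K1 reg] := good_regular Sf.
  exact: (casc_lim_cvg (h_gt0 H) h1 k0 (kapE H) (e1 omega) K1 (ltW b1) reg q1).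
have aebd : {ae P, forall omega n, setT omega ->
    (`|(casc h (e omega) n [::] t)%:E| <= c%:E * (1 + S q0 omega))%E}.
  apply: filterS aeS => omega Sf n _.
  pose x := fine (S q0 omega).
  have x0 : 0 <= x by rewrite fine_ge0// moment_series_ge0.
  have K1 : 1 <= 1 + x by rewrite lerDl.
  have reg : regular h k (e omega) (1 + x) b.
    apply: (regular_of_series eps_val b1 q00 q0e (le_trans ler01 K1)).
    rewrite -(fineK Sf) lee_fin -/x; apply: (@le_trans _ _ (1 + x)).
      by rewrite lerDr.
    by apply: ler_eXnr.
  rewrite -(fineK Sf) -EFinD -EFinM lee_fin -/x /c.
  have := casc_cauchy (h_gt0 H) h1 k0 (kapE H) (e1 omega) K1 (ltW b1) reg q1 0 n [::] t.
  rewrite add0n /= !expr0 !mulr1.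
  have -> : Num.max 0 (Num.min t 1) = t.
    by move: tI; rewrite in_itv /= => /andP[t0 t1]; rewrite (min_idPl t1) (max_idPr t0).
  have -> : 3 * (1 + x) / (1 - b * k) = 3 / (1 - b * k) * (1 + x) by ring.
  have : `|t| <= 1 by move: tI; rewrite in_itv /= => /andP[t0 t1]; rewrite ger0_norm.
  have := ler_normD (casc h (e omega) n [::] t - t) t; rewrite subrK.
  move: K1; lra.
have [_ _ X] := @dominated_convergence _ _ _ P setT measurableT
  (fun n omega => (casc h (e omega) n [::] t)%:E)
  (fun omega => (limit_process [::] omega t)%:E)
  (fun omega => c%:E * (1 + S q0 omega))%E
  (fun n => proj2 (measurable_EFinP _ _) (casc_measurable n [::] t))
  (proj2 (measurable_EFinP _ _) (limit_process_measurable [::] t)) aecv Ig aebd.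
have Y : (\int[P]_omega (casc h (e omega) n [::] t)%:E)%E @[n --> \oo] --> t%:E.
  by under eq_fun do rewrite casc_expectation//; exact: cvg_cst.
exact: (cvg_unique _ X Y).
Qed.

End Limit.

(** * Passage to almost every sample *)

Lemma regular_mono (R : realType) (h k : R) (e : word -> R) K b b' : 0 <= K -> 0 <= k -> 0 <= b ->
  b <= b' -> regular h k e K b -> regular h k e K b'.
Proof.
move=> K0 k0 b0 bb reg m v; apply: (le_trans (reg m v)).
have b'0 := le_trans b0 bb.
apply: ler_pM; rewrite ?mulr_ge0 ?exprn_ge0 ?mulr_ge0//.
  by apply: ler_wpM2l => //; apply: lerXn2r.
by apply: lerXn2r; rewrite ?nnegrE ?mulr_ge0// ler_wpM2r.
Qed.

Lemma bad_fraction_mono (R : realType) (h : R) L g g' n s : g <= g' ->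
  bad_fraction h L g n s <= bad_fraction h L g' n s.
Proof.
move=> gg; apply: ler_wpM2l; first by rewrite invr_ge0 exprn_ge0.
apply: ler_sum => i _; rewrite ler_nat /is_bad.
case: (ltP (2 ^+ (4 * n) * (2 ^- n) `^ g)) => //= B; rewrite (le_lt_trans _ B)//.
apply: ler_wpM2l; first by rewrite exprn_ge0.
by apply: ger_powR => //; rewrite invr_gt0 exprn_gt0//= invf_le1 ?exprn_gt0// exprn_ege1// ler1n.
Qed.

Lemma exists_harmonic_lt (R : realType) (x : R) : 0 < x -> exists j, j.+1%:R^-1 <= x.
Proof.
move=> x0; exists (Num.truncn x^-1).
rewrite invf_ple ?posrE//; apply: ltW; exact: truncnS_gt.
Qed.

Section AlmostSure.
Context {R : realType} {d : measure_display} {Omega : measurableType d}.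
Variables (P : probability Omega R) (H : R).
Hypotheses (H_gt : 2^-1 < H) (H_le : H <= 1).
Variable (eps : word -> {RV P >-> R}).
Hypotheses (eps_val : forall w omega, eps w omega = 1 \/ eps w omega = -1)
  (eps_pos : forall w, P [set omega | eps w omega = 1] = ((1 + 2 `^ (H - 1)) / 2)%:E)
  (eps_neg : forall w, P [set omega | eps w omega = -1] = ((1 - 2 `^ (H - 1)) / 2)%:E)
  (eps_indep : mutually_independent eps).
Local Notation h := (2 `^ (- H) : R).
Local Notation cf := (conf eps).

(** By monotonicity in the base, countably many bases suffice to reach all of
    them. *)
Lemma ae_subexponential : {ae P, forall omega, subexponential H (cf omega)}.
Proof.
have j1 j : 1 < 1 + j.+1%:R^-1 :> R by rewrite ltrDl invr_gt0.
have := ae_foralln (fun j => ae_regular H_gt H_le eps_val eps_pos eps_neg eps_indep (j1 j)).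
apply: filterS => omega reg b b1.
have [j jb] : exists j, j.+1%:R^-1 <= b - 1 by apply: exists_harmonic_lt; rewrite subr_gt0.
have [K K1 rK] := reg j; exists K => //; rewrite sg_cf//.
apply: (regular_mono _ (ltW (kap_gt0 H)) _ _ rK); first exact: le_trans K1.
  by rewrite addr_ge0 ?invr_ge0.
by rewrite addrC -lerBrDr.
Qed.

Lemma ae_oscillation_all : {ae P, forall omega, forall A, exists m0, forall m, (m0 <= m)%N ->
  forall w, size w = (2 ^ m)%N -> exists2 v, size v = (2 * m)%N &
    2^-1 < mass h (sg (cf omega)) (A * 2 ^ m) (w ++ v)}.
Proof.
have := ae_foralln (ae_oscillation H_gt H_le eps_val eps_pos eps_neg eps_indep).
by apply: filterS => omega osc A; rewrite sg_cf//; exact: osc.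
Qed.

(** Likewise countably many exponents [g] suffice, since there are fewer bad cells
    for a smaller [g]. *)
Lemma ae_bad_cells_rare : {ae P, forall omega, forall A, (4 <= A)%N -> exists L0, forall g, g < 2 - H ->
  exists n0, forall n1, (n0 <= n1)%N -> forall N,
     \sum_(0 <= n < N) ((n1 <= n)%N%:R *
       bad_fraction h (bad_level A L0 n) g n (cf omega)) <= 2^-1}.
Proof.
have gj j : 2 - H - j.+1%:R^-1 < 2 - H by rewrite ltrBlDr ltrDl invr_gt0.
have HL A : exists L0, (4 <= A)%N -> forall g, g < 2 - H ->
  {ae P, forall omega, exists n0, forall n1, (n0 <= n1)%N -> forall N,
     \sum_(0 <= n < N) ((n1 <= n)%N%:R *
       bad_fraction h (bad_level A L0 n) g n (cf omega)) <= 2^-1}.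
  have [A4|_] := leqP 4 A; last by exists 0%N.
  by have [L0 HL] := ae_bad_cells_summable H_gt H_le eps_val eps_pos eps_neg eps_indep A4; exists L0.
have [L0 {}HL] := choice HL.
have HA A : {ae P, forall omega, (4 <= A)%N -> forall j, exists n0, forall n1, (n0 <= n1)%N -> forall N,
     \sum_(0 <= n < N) ((n1 <= n)%N%:R *
       bad_fraction h (bad_level A (L0 A) n) (2 - H - j.+1%:R^-1) n (cf omega)) <= 2^-1}.
  have [A4|_] := leqP 4 A; last by apply: aeW.
  by have := ae_foralln (fun j => HL A A4 _ (gj j)); apply: filterS => omega + _; exact.
have := ae_foralln HA; apply: filterS => omega {}HA A A4; exists (L0 A) => g gH.
have [j jb] : exists j, j.+1%:R^-1 <= 2 - H - g by apply: exists_harmonic_lt; rewrite subr_gt0.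
have [n0 Hn0] := HA A A4 j; exists n0 => n1 n01 N; apply: le_trans (Hn0 n1 n01 N).
apply: ler_sum => n _; apply: ler_wpM2l; first by [].
by apply: bad_fraction_mono; rewrite lerBrDl -lerBrDr.
Qed.

Lemma limit_process_self_similar q0 omega w (t : R) : (0 < q0)%N -> ~~ odd q0 ->
  moment_series H eps (base H) q0 omega \is a fin_num -> t \in winterval R w ->
  limit_process H eps q0 [::] omega t - limit_process H eps q0 [::] omega (wpoint R w) =
  epsprod eps w omega * 2 `^ (- ((size w)%:R * H)) * limit_process H eps q0 w omega (wordV w t).
Proof.
move=> q00 q0e Sf tw.
have [K K1 reg] := regular_of_fin eps_val (base_gt1 H_gt) q00 q0e Sf.
have e1 v : `|eps v omega| <= 1 by case: (eps_val v omega) => ->; rewrite ?normrN normr1.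
have S := casc_limS (h_gt0 H) (h_le1 H_gt) (ltW (kap_gt0 H)) (kapE H) e1 K1 (ltW (base_gt1 H_gt)) reg (base_kap H_gt).
rewrite /limit_process Sf.
have -> : 2 `^ (- ((size w)%:R * H)) = h ^+ size w.
  by rewrite -powR_mulrn ?powR_ge0// -powRrM; congr (_ `^ _); ring.
exact: (@self_similar R h (fun v => eps v omega) _ (@casc_lim_le0 R h _) (@casc_lim_ge1 R h _) S [::] w t tw).
Qed.

End AlmostSure.

Theorem theorem1p1 (R : realType) (d : measure_display)
    (Omega : measurableType d) (P : probability Omega R)
    (H : R) (H_gt : 2^-1 < H) (H_le : H <= 1)
    (eps : word -> {RV P >-> R})
    (eps_val : forall w omega, eps w omega = 1 \/ eps w omega = -1)
    (eps_pos : forall w, P [set omega | eps w omega = 1] =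
                         ((1 + 2 `^ (H - 1)) / 2)%:E)
    (eps_neg : forall w, P [set omega | eps w omega = -1] =
                         ((1 - 2 `^ (H - 1)) / 2)%:E)
    (eps_indep : mutually_independent eps) :
  exists B : word -> Omega -> R -> R,
    (forall w omega, {within `[0, 1], continuous (B w omega)}) /\
    (forall w (t : R), t \in `[0, 1] -> measurable_fun setT (fun omega => B w omega t)) /\
    (forall w, {ae P, forall omega,
       {uniform `[0, 1], (fun n => Bn H eps n w omega) @ \oo --> B w omega}}) /\
    (forall q : R, 1 <= q ->
       (\int[P]_omega
          (supnorm01 (Bn H eps n [::] omega \- B [::] omega)%R `^ q))%E
         @[n --> \oo] --> 0%E) /\
    (forall t : R, t \in `[0, 1] -> 'E_P[fun omega => B [::] omega t]%E = t%:E) /\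
    {ae P, forall omega,
      (forall (w : word) (t : R), (1 <= size w)%N -> t \in winterval R w ->
         B [::] omega t - B [::] omega (wpoint R w) =
         epsprod eps w omega * 2 `^ (- ((size w)%:R * H)) *
         B w omega (wordV w t)) /\
      ((forall alpha : R, 0 < alpha < H -> holder01 alpha (B [::] omega)) /\
       (forall t : R, t \in `[0, 1] ->
          pointwise_exponent01 (B [::] omega) t = H%:E)) /\
      (hausdorff_dim (graph01 (B [::] omega)) = (2 - H)%:E /\
       lower_box_dim (graph01 (B [::] omega)) = (2 - H)%:E /\
       upper_box_dim (graph01 (B [::] omega)) = (2 - H)%:E)}.
Proof.
  (* your proof *)
Proof.
have [q0 [q00 q0e bq0 _]] := exists_moment_order 0 (base_gt1 H_gt).
have aeS := ae_moment_series H_gt H_le eps_val eps_pos eps_neg eps_indep (base_gt1 H_gt) q00 q0e bq0.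
exists (limit_process H eps q0); split; [|split; [|split; [|split; [|split]]]].
- move=> w omega; apply: continuous_subspaceT.
  exact: (limit_process_continuous H_gt eps_val q00 q0e).
- move=> w t _.
  exact: (limit_process_measurable H_gt eps_val eps_pos eps_neg eps_indep q00 q0e).
- move=> w; apply: filterS aeS => omega.
  exact: (limit_process_uniform H_gt eps_val q00 q0e).
- move=> q q1.
  have [N [N0 Ne bN qN]] := exists_moment_order (Num.truncn q).+1 (base_gt1 H_gt).
  apply: (limit_process_moment H_gt H_le eps_val eps_pos eps_neg eps_indep q00 q0e bq0 q1 N0 Ne bN).
  by apply: le_trans (ltW (truncnS_gt q)) _; rewrite ler_nat.
- exact: (limit_process_expectation H_gt H_le eps_val eps_pos eps_neg eps_indep q00 q0e bq0).
have aeR := ae_subexponential H_gt H_le eps_val eps_pos eps_neg eps_indep.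
have aeO := ae_oscillation_all H_gt H_le eps_val eps_pos eps_neg eps_indep.
have aeB := ae_bad_cells_rare H_gt H_le eps_val eps_pos eps_neg eps_indep.
apply: filterS (filterI (filterI aeS aeR) (filterI aeO aeB)) => omega [[Sf sub] [osc bad]].
split; first by move=> w t _; exact: (limit_process_self_similar H_gt eps_val q00 q0e Sf).
have -> : limit_process H eps q0 [::] omega = casc_lim (2 `^ (- H)) (sg (conf eps omega)) [::].
  by apply/funext => t; rewrite /limit_process Sf sg_cf.
split; first split.
- exact: path_holder01.
- exact: path_exponent.
by have [-> -> ->] := path_dims H_gt H_le sub bad.
Qed.
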